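(* $1105\leqslant\dim_{\mathbb F_2}(QP_5)_{62}\leqslant 1175$.
   Context: $P_5=\mathbb F_2[x_1,\ldots,x_5]$ is the graded polynomial algebra with each $x_i$ of degree $1$, regarded as a module over the mod-2 Steenrod algebra $\mathcal A$ in the usual way (it is $H^*(B(\mathbb Z/2)^5;\mathbb F_2)$; the action is determined by $Sq^0=\mathrm{id}$, $Sq^1x_i=x_i^2$, $Sq^jx_i=0$ for $j>1$, and the Cartan formula). $\mathcal A^+$ is the augmentation ideal of $\mathcal A$, $QP_5=P_5/\mathcal A^+P_5$, and $(QP_5)_n$ is its degree $n$ part. *)

(* Defs.v *)
From HB Require Import structures.
From mathcomp Require Import all_boot all_order all_algebra.
From mathcomp Require Import generic_quotient ring_quotient.
From mathcomp.multinomials Require Import mpoly.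

Set Implicit Arguments.
Unset Strict Implicit.
Unset Printing Implicit Defensive.

Import GRing.Theory.
Local Open Scope ring_scope.
Local Open Scope quotient_scope.

Section QuotientSpace.

Variables (K : fieldType) (vT : vectType K) (U : {vspace vT}).

Definition quotv := Quotient.quot (U : zmodClosed vT).

HB.instance Definition _ := ZmodQuotient.on quotv.

Lemma quotvP (x y : vT) : reflect (\pi_quotv x = \pi_quotv y) (x - y \in U).
Proof. by rewrite (Quotient.idealrBE (U : zmodClosed vT)); apply: eqP. Qed.

Lemma pi_quotvD (x y : vT) : \pi_quotv (x + y) = \pi_quotv x + \pi_quotv y.
Proof. exact: (raddfD (\pi_(Quotient.quot (U : zmodClosed vT)))). Qed.

Definition quotv_scale (a : K) (q : quotv) : quotv := \pi_quotv (a *: repr q).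

Lemma pi_quotv_scale a (x : vT) :
  quotv_scale a (\pi_quotv x) = \pi_quotv (a *: x).
Proof.
apply/quotvP; rewrite -scalerBr rpredZ //.
by apply/quotvP; rewrite reprK.
Qed.

Lemma quotv_scaleA a b (q : quotv) :
  quotv_scale a (quotv_scale b q) = quotv_scale (a * b) q.
Proof. by elim/quotW: q => x; rewrite (pi_quotv_scale b) !pi_quotv_scale scalerA. Qed.

Lemma quotv_scale1 : left_id 1 quotv_scale.
Proof. by elim/quotW=> x; rewrite pi_quotv_scale scale1r. Qed.

Lemma quotv_scaleDr : right_distributive quotv_scale +%R.
Proof.
move=> a; elim/quotW=> x; elim/quotW=> y.
by rewrite -pi_quotvD !pi_quotv_scale scalerDr pi_quotvD.
Qed.

Lemma quotv_scaleDl (q : quotv) : {morph quotv_scale^~ q : a b / a + b}.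
Proof.
move=> a b /=; elim/quotW: q => x; rewrite !pi_quotv_scale.
by rewrite scalerDl pi_quotvD.
Qed.

HB.instance Definition _ := GRing.Zmodule_isLmodule.Build K quotv
  quotv_scaleA quotv_scale1 quotv_scaleDr quotv_scaleDl.

Lemma pi_quotvZ a (x : vT) : \pi_quotv (a *: x) = a *: \pi_quotv x.
Proof. by rewrite -pi_quotv_scale. Qed.

Lemma quotv_vect_iso : Vector.axiom (\dim (U^C)%VS) quotv.
Proof.
set W := (U^C)%VS.
have WU0 : (W :&: U = 0)%VS by rewrite capvC capv_compl.
pose proj (x : vT) : subvs_of W := vsproj W (daddv_pi W U x).
have projE x : x - vsval (proj x) \in U.
  have xWU : x \in (W + U)%VS by rewrite addvC addv_complf memvf.
  rewrite vsprojK ?memv_pi // -{1}(daddv_pi_add WU0 xWU).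
  by rewrite addrC addKr memv_pi.
have WU_eq0 x : x \in W -> x \in U -> x = 0.
  by move=> xW xU; apply/eqP; rewrite -memv0 -WU0 memv_cap xW.
have projP x (w : subvs_of W) : x - vsval w \in U -> proj x = w.
  move=> xw; apply/val_inj/eqP; rewrite -subr_eq0; apply/eqP/WU_eq0.
    by rewrite rpredB ?subvsP.
  have -> : val (proj x) - val w = (x - vsval w) - (x - vsval (proj x)).
    by rewrite opprB [RHS]addrC subrKA.
  exact: rpredB.
have [h hlin bij_h] := subvs_vect_iso W.
exists (fun q : quotv => h (proj (repr q))).
  move=> a p q; rewrite -hlin; congr h.
  transitivity (proj (a *: repr p + repr q)); last by rewrite /proj !linearP.
  apply: projP; set y := _ + repr q; set x := repr _.
  rewrite -[x](subrK y) -addrA; apply: rpredD => //.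
  by apply/quotvP; rewrite pi_quotvD pi_quotvZ !reprK.
case: bij_h => h' hK h'K.
exists (fun r => \pi_quotv (vsval (h' r))) => [q | r].
  by rewrite hK -[RHS]reprK; apply/esym/quotvP.
rewrite -[RHS]h'K; congr h; apply: projP.
by apply/quotvP; rewrite reprK.
Qed.

HB.instance Definition _ := Lmodule_hasFinDim.Build K quotv quotv_vect_iso.

Lemma dim_quotv : \dim {: quotv} = (\dim {: vT} - \dim U)%N.
Proof. by rewrite -dimv_compl; apply: dimvf. Qed.

End QuotientSpace.


Section Steenrod.

Variable n : nat.

Local Notation P := {mpoly 'F_2[n]}.

Implicit Types (f g : P) (m : 'X_{1..n}) (w : seq nat).

(* The total square x_i |-> x_i + x_i^2 T, extended to a ring morphism
   P -> P[T]; the coefficient of T^k is Sq^k. *)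
Definition total_Sq : P -> {poly P} :=
  mmap (polyC \o @mpolyC n 'F_2) (fun i => ('X_i)%:P + ('X_i ^+ 2) *: 'X).

HB.instance Definition _ := GRing.RMorphism.on total_Sq.

Definition Sq (k : nat) f : P := (total_Sq f)`_k.

Lemma Sq_linear k : linear (Sq k).
Proof.
move=> c f g; rewrite /Sq raddfD /= coefD {1}/total_Sq mmapZ coefCM.
by rewrite mul_mpolyC.
Qed.

HB.instance Definition _ k := GRing.isLinear.Build 'F_2 P P _ (Sq k) (Sq_linear k).

Lemma Sq_cartan k f g : Sq k (f * g) = \sum_(i < k.+1) Sq i f * Sq (k - i) g.
Proof. by rewrite /Sq rmorphM coefM. Qed.

Lemma Sq1 k : Sq k 1 = (k == 0)%:R.
Proof. by rewrite /Sq rmorph1 coef1. Qed.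

Lemma total_SqX i : total_Sq 'X_i = ('X_i)%:P + ('X_i ^+ 2) *: 'X.
Proof. by rewrite /total_Sq mmapX mmap1U. Qed.

Lemma SqX k i :
  Sq k 'X_i = if k == 0 then 'X_i else if k == 1 then 'X_i ^+ 2 else 0.
Proof.
rewrite /Sq total_SqX coefD coefC coefZ coefX.
by case: k => [|[|k]] /=; rewrite ?mulr0 ?mulr1 ?addr0 ?add0r.
Qed.

Lemma Sq0 f : Sq 0 f = f.
Proof.
elim/mpolyind: f => [|c m f _ _ IHf]; first exact: raddf0.
rewrite linearP /= IHf; congr (_ *: _ + _).
rewrite mpolyXE_id; elim/big_rec: _ => [|i g _ IHg]; first exact: Sq1.
rewrite Sq_cartan big_ord1 IHg; congr (_ * _).
elim: (m i) => [|e IHe]; first exact: Sq1.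
by rewrite !exprS Sq_cartan big_ord1 IHe SqX.
Qed.

(* The Steenrod monomial Sq^{i_1} ... Sq^{i_k}, for w = [:: i_1; ...; i_k]. *)
Definition Sq_seq w f : P := foldr Sq f w.

(* Membership in A^+ P.  The Steenrod algebra A is generated by the Sq^i, so
   its augmentation ideal A^+ is spanned by the Steenrod monomials of positive
   degree; over F_2 a linear combination of them is just a sum.  The Adem
   relations play no role here, since they only identify operations that
   already agree on P. *)
Definition hit f : Prop :=
  exists2 s : seq (seq nat * P),
    all (fun t => 0 < sumn t.1)%N s & f = \sum_(t <- s) Sq_seq t.1 t.2.

Lemma hit0 : hit 0.
Proof. by exists [::]; rewrite ?big_nil. Qed.

Lemma hitD f g : hit f -> hit g -> hit (f + g).
Proof.
move=> [s s_gt0 ->] [t t_gt0 ->]; exists (s ++ t); rewrite ?big_cat //.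
by rewrite all_cat s_gt0.
Qed.

Lemma hitZ c f : hit f -> hit (c *: f).
Proof.
move=> hf; have [->|] := eqVneq c 0; first by rewrite scale0r; apply: hit0.
case: c => -[|[|//]] // lt_c2 _; rewrite (_ : Ordinal _ = 1) ?scale1r //.
exact: val_inj.
Qed.

Lemma hit_Sq k f : (0 < k)%N -> hit (Sq k f).
Proof.
by move=> k_gt0; exists [:: ([:: k], f)]; rewrite /= ?big_seq1 ?addn0 ?k_gt0.
Qed.

Lemma Sq_seq_gt0 w f :
  (0 < sumn w)%N -> exists k, exists2 g, (0 < k)%N & Sq_seq w f = Sq k g.
Proof.
elim: w => [|[|k] w IHw] //= w_gt0; last by exists k.+1, (Sq_seq w f).
by have [k [g k_gt0 fE]] := IHw w_gt0; exists k, g; rewrite // Sq0.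
Qed.

Lemma Sq_homog d k f : f \is d.-homog -> Sq k f \is (k + d).-homog.
Proof.
pose gr e (q : {poly P}) := forall j, q`_j \is (j + e).-homog.
have gr1 : gr 0 1.
  move=> j; rewrite coef1 addn0; case: j => [|j] /=; first exact: dhomog1.
  exact: dhomog0.
have grM e e' q q' : gr e q -> gr e' q' -> gr (e + e') (q * q').
  move=> grq grq' j; rewrite coefM rpred_sum // => i _.
  have -> : (j + (e + e') = (i + e) + (j - i + e'))%N.
    by rewrite addnACA subnKC // -ltnS.
  exact: dhomogM.
have grX i : gr 1 (total_Sq 'X_i).
  move=> j; rewrite -/(Sq j _) SqX.
  have X1 : ('X_i : P) \is 1.-homog by rewrite dhomogX; apply/eqP/mdeg1.
  case: j => [|[|j]] //=; last exact: dhomog0.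
  by rewrite expr2; apply: (dhomogM X1 X1).
have grXm m : gr (mdeg m) (total_Sq 'X_[m]).
  rewrite mpolyXE_id rmorph_prod mdegE /=.
  elim/big_rec2: _ => [|i e q _ grq]; first exact: gr1.
  apply: (grM _ _ _ _ _ grq); elim: (m i) => [|r IHr]; first by rewrite expr0 rmorph1.
  by rewrite exprS rmorphM -add1n; exact: (grM _ _ _ _ (grX i) IHr).
move=> fd; rewrite [f]mpolyE raddf_sum big_seq rpred_sum //= => m mf.
by rewrite linearZ rpredZ // -(dhomogP _ _ _ fd m mf); apply: grXm.
Qed.

End Steenrod.

Section Hits.

Variables (n d : nat).

Local Notation P := {mpoly 'F_2[n.+1]}.

Lemma hits_subproof :
  {H : {vspace dhomog n.+1 'F_2 d} | forall f, f \in H <-> hit (val f)}.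
Proof.
pose V := dhomog n.+1 'F_2 d.
pose gen (i : 'I_d.+1) (m : 'X_{1..n.+1 < d.+1}) : V :=
  if (0 < i)%N then indhomog d (Sq i 'X_[val m]) else 0.
pose X := [seq gen i m | i <- enum {: 'I_d.+1}, m <- enum {: 'X_{1..n.+1 < d.+1}}].
have val_in (g : P) : g \is d.-homog -> val (indhomog d g : V) = g.
  by move=> gd; rewrite /indhomog insubdK.
have hit_gen i m : hit (val (gen i m)).
  rewrite /gen; case: ifP => [i_gt0|_]; last exact: hit0.
  by rewrite /indhomog val_insubd; case: ifP => _; [apply: hit_Sq | apply: hit0].
have hit_sum (I : Type) (r : seq I) (F : I -> P) :
  (forall i, hit (F i)) -> hit (\sum_(i <- r) F i).
  by move=> hF; elim/big_ind: _ => //; [apply: hit0 | apply: hitD].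
have pi_gen i (m : 'X_{1..n.+1}) : (0 < i)%N ->
  exists2 v : V, v \in <<X>>%VS & val v = pihomog mdeg d (Sq i 'X_[m]).
  move=> i_gt0; have Sd : Sq i ('X_[m] : P) \is (i + mdeg m).-homog.
    by apply: Sq_homog; rewrite dhomogX.
  have [dE|ne_d] := eqVneq (i + mdeg m)%N d; last first.
    by exists 0; rewrite ?mem0v // (pihomog_ne0 ne_d).
  rewrite dE in Sd; rewrite pihomog_dE //.
  have lt_i : (i < d.+1)%N by rewrite ltnS -dE leq_addr.
  have lt_m : (mdeg m < d.+1)%N by rewrite ltnS -dE leq_addl.
  exists (gen (Ordinal lt_i) (BMultinom lt_m)); last by rewrite /gen i_gt0 val_in.
  by apply: memv_span; apply: allpairs_f; rewrite mem_enum.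
have pi_Sq i (g : P) : (0 < i)%N ->
  exists2 v : V, v \in <<X>>%VS & val v = pihomog mdeg d (Sq i g).
  move=> i_gt0; elim/mpolyind: g => [|c m g _ _ [v vX vE]].
    by exists 0; rewrite ?mem0v // !linear0.
  have [u uX uE] := pi_gen i m i_gt0.
  exists (c *: u + v); first by rewrite memvD ?memvZ.
  have -> : val (c *: u + v) = c *: val u + val v by [].
  by rewrite uE vE (linearP (Sq i)) linearP.
exists <<X>>%VS => f; split=> [|[s s_gt0 fE]].
  move=> /(@coord_span _ _ _ (in_tuple X)) ->; rewrite raddf_sum /=.
  apply: hit_sum => j; apply: (@hitZ _ _ (val X`_j)).
  by have /allpairsP[[i m] [_ _ ->]] := mem_nth 0 (ltn_ord j); apply: hit_gen.
have {}fE : pihomog mdeg d (\sum_(t <- s) Sq_seq t.1 t.2) = val f.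
  by rewrite -fE; apply/pihomog_dE/dhomog_is_dhomog.
have {s_gt0 fE} [v vX vE] : exists2 v : V, v \in <<X>>%VS & val v = val f.
  rewrite -fE; elim: s s_gt0 {fE} => [|[w g] s IHs] /=.
    by exists 0; rewrite ?mem0v // big_nil [RHS]linear0.
  case/andP=> w_gt0 /IHs[v vX vE].
  have [i [h i_gt0 wE]] := Sq_seq_gt0 g w_gt0.
  have [u uX uE] := pi_Sq i h i_gt0.
  exists (u + v); first exact: memvD.
  by rewrite big_cons [RHS]linearD /= wE -uE -vE.
by rewrite -(val_inj vE).
Qed.

(* The degree d part of A^+ P, characterized by hitsP.  The polynomial ring
   has n.+1 variables because only then does dhomog carry its vectType
   instance. *)
Definition hits : {vspace dhomog n.+1 'F_2 d} := sval hits_subproof.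

Lemma hitsP f : f \in hits <-> hit (val f).
Proof. exact: (svalP hits_subproof). Qed.

End Hits.

Arguments hits {n d}.
Arguments hitsP {n d f}.

(* Main.v *)
From HB Require Import structures.
From Stdlib Require Import BinNat.
Require Import Defs.
From mathcomp Require Import all_boot all_order all_algebra.
From mathcomp Require Import ring.
From mathcomp.multinomials Require Import mpoly.

Set Implicit Arguments.
Unset Strict Implicit.
Unset Printing Implicit Defensive.

Import GRing.Theory.

(** Both bounds come from finite computations on the monomials of degree 62,
    each reduced to a manageable size by a structural argument.

    A monomial is written as the word of the columns of its exponents in base
    two: the column of index b is the set of the variables whose exponent has
    the b-th bit, so that X (A :: w) = X_A * (X w)^2, where X_A is the product
    of the variables in A.  The Cartan formula and the Frobenius turn this into
    a recursion for the squares, Sq^k (X_A f^2) being the sum over the subsets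
    U of A of X_{A minus U} (X_U Sq^{(k - |U|)/2} f)^2 (Sq_mon_sqr).

    Upper bound.  Words are ordered lexicographically by the sizes of their
    columns, and then by the columns.  A word is reducible when modulo hit
    polynomials its monomial is a sum of smaller ones; the quotient is then
    spanned by the irreducible words (dim_quotient_le).  Following Kameko and
    Sum, reducibility is local.  A column may be prepended
    (reducible_cons), because X_A (Sq^k h)^2 differs from Sq^{2k} (X_A h^2) by
    monomials with a smaller first column.  If in the reduction of w only
    squares Sq^k with k < 2^s occur, s being the length of w, then columns may
    be appended (reducible_cat), because such squares are linear over the
    2^s-th powers.  So every reduction of a short word rules out all the words
    that contain it as a window.  A list of 675 windows, each with the squares
    that reduce it (certificates), leaves 1174 words of degree 62.

    Lower bound.  Let G be a substitution of linear forms for the variables and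
    E a set of monomials such that for every polynomial g and every k > 0 the
    sum of the coefficients of Sq^k g at the monomials in E is zero.  Then f
    maps to the sum of the coefficients of f(G) at E, and this functional
    vanishes on hit polynomials, since substitutions commute with the squares.
    The simplest E consists of one spike, a monomial whose exponents have the
    form 2^s - 1.  On the words that matter these functionals are sums of
    products of minors of G (mcoeff_substitution).  Three families are used:
    - the spike (31, 31), where the value on a word depends on the plane spanned
      by two vectors; these have rank 155, the number of planes in F_2^5;
    - the spike (31, 15, 15, 1), where it depends on a flag of a line, a
      3-space and a hyperplane; suitable flags give rank 904;
    - a set of 96 monomials (exotic_terms), which gives 55 functionals that are
      independent of those from the two spikes.
    Arranged in blocks, every functional vanishes on the test vectors of the
    earlier blocks, so the ranks of the blocks add up (blocks_rank_le), to 1114. *)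

(** * Monomials as words of columns *)

Notation column := bitseq (only parsing).
Notation word := (seq bitseq) (only parsing).

Fixpoint weight (A : column) : nat :=
  if A is a :: A' then if a then (weight A').+1 else weight A' else 0.

Fixpoint code (A : column) : nat :=
  if A is a :: A' then if a then (code A').*2.+1 else (code A').*2 else 0.

Fixpoint nul (A : column) : bool :=
  if A is a :: A' then if a then false else nul A' else true.

Fixpoint xorc (A B : column) : column :=
  match A, B with
  | [::], _ => B
  | _, [::] => A
  | a :: A', b :: B' => (if a then ~~ b else b) :: xorc A' B'
  end.

Fixpoint andc (A B : column) : column :=
  match A, B with
  | a :: A', b :: B' => (if a then b else false) :: andc A' B'
  | _, _ => [::]
  end.

(** Carries the set U of variables into w: the word of X_U times the monomial of w. *)
Fixpoint addc (U : column) (w : word) : word :=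
  if nul U then w else
  if w is A :: w' then xorc A U :: addc (andc A U) w' else [:: U].

Fixpoint addw (v w : word) : word :=
  if all nul v then w else
  match v, w with
  | A :: v', B :: w' => xorc A B :: addc (andc A B) (addw v' w')
  | _, _ => v
  end.

(** All the pairs (U, A minus U) for U a subset of A; the pair with U empty comes
    first. *)
Fixpoint splits (A : column) : seq (column * column) :=
  if A is a :: A' then
    let r := splits A' in
    let l := [seq (false :: p.1, a :: p.2) | p <- r] in
    if a then l ++ [seq (true :: p.1, false :: p.2) | p <- r] else l
  else [:: ([::], [::])].

(** The words of the monomials of Sq^k, by the recursion of Sq_mon_sqr: U is the
    set of variables of the first column whose exponent bit is raised, which
    leaves A minus U there and carries U into the next column. *)
Fixpoint sqw (k : nat) (w : word) : seq word :=
  if w is A :: w' then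
    flatten [seq let c := weight p.1 in
                 if (c <= k) && ~~ odd (k - c) then
                   [seq p.2 :: addc p.1 t | t <- sqw (k - c)./2 w']
                 else [::]
            | p <- splits A]
  else if k is 0 then [:: [::]] else [::].

Fixpoint degw (w : word) : nat :=
  if w is A :: w' then weight A + (degw w').*2 else 0.

(** Columns may be shorter than n, absent bits being false; full asks for exactly
    n bits, so that equal monomials are equal lists. *)
Definition wf n (w : word) := all (fun A => size A <= n) w.

Definition full n (w : word) := all (fun A => size A == n) w.

Lemma full_wf n w : full n w -> wf n w.
Proof. by apply: sub_all => A /eqP->. Qed.

(** Lexicographic comparison of the values of f on the columns.  It recurses on
    the larger word: columns of t beyond the length of w never decide. *)
Fixpoint lexlt (f : column -> nat) (t w : word) : bool :=
  if w is A :: w' then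
    let a := f (head [::] t) in let b := f A in
    if a < b then true else if a == b then lexlt f (behead t) w' else false
  else false.

Fixpoint lexeq (f : column -> nat) (t w : word) : bool :=
  if w is A :: w' then
    if f (head [::] t) == f A then lexeq f (behead t) w' else false
  else all nul t.

(** Comparing the weights of all the columns first makes this the order by weight
    vectors that is usual for this problem. *)
Definition ltw t w := if lexlt weight t w then true else
  if lexeq weight t w then lexlt code t w else false.

Fixpoint eqc (A B : column) : bool :=
  match A, B with
  | [::], _ => nul B
  | _, [::] => nul A
  | a :: A', b :: B' => if a == b then eqc A' B' else false
  end.

Fixpoint eqw (t w : word) : bool :=
  match t, w with
  | [::], _ => all nul w
  | _, [::] => all nul t
  | A :: t', B :: w' => if eqc A B then eqw t' w' else false
  end.

Section Columns.

Lemma nul_weight A : nul A = (weight A == 0).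
Proof. by elim: A => //= -[]. Qed.

Lemma weight_le A : weight A <= size A.
Proof. by elim: A => //= -[] A /= IH; rewrite ?ltnS // ltnW. Qed.

Lemma weight_lt n A : size A <= n -> weight A < 2 ^ n.
Proof. by move=> le; apply: leq_ltn_trans (ltn_expl n _); rewrite ?(leq_trans (weight_le A)). Qed.

Lemma code_lt n A : size A <= n -> code A < 2 ^ n.
Proof.
elim: A n => [|a A IH] [|n] //=; rewrite ?expn_gt0 // ltnS => /IH.
by rewrite expnS mul2n; case: a; rewrite ?ltn_Sdouble ?ltn_double.
Qed.

Lemma size_xorc A B : size (xorc A B) = maxn (size A) (size B).
Proof. by elim: A B => [|a A IH] [|b B] //=; rewrite IH maxnSS. Qed.

Lemma size_andc n A B : size A <= n -> size (andc A B) <= n.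
Proof. by elim: A B n => [|a A IH] [|b B] [|n] //=; rewrite !ltnS; apply: IH. Qed.

Lemma wf_addc n U w : size U <= n -> wf n w -> wf n (addc U w).
Proof.
elim: w U => [|A w IH] U sU /=; first by case: ifP => //=; rewrite sU.
case/andP=> sA ww; case: ifP => _ /=; first by rewrite sA.
by rewrite size_xorc geq_max sA sU IH // size_andc.
Qed.

Lemma wf_addw n v w : wf n v -> wf n w -> wf n (addw v w).
Proof.
elim: v w => [|A v IH] [|B w] //=; first by case: ifP.
case/andP=> sA wv /andP[sB ww]; case: ifP => _ /=; rewrite ?sB //.
by rewrite size_xorc geq_max sA sB wf_addc ?size_andc ?IH.
Qed.

Lemma size_splits A p : p \in splits A -> size p.1 = size A /\ size p.2 = size A.
Proof.
elim: A p => [|a A IH] p /=; first by rewrite inE => /eqP->.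
have l q : q \in [seq (false :: p.1, a :: p.2) | p <- splits A] ->
    size q.1 = (size A).+1 /\ size q.2 = (size A).+1.
  by case/mapP=> r /IH[/= <- h] ->; rewrite /= h.
case: a l => l; last exact: l.
rewrite mem_cat => /orP[/l//|/mapP[r /IH[/= <- h] ->]].
by rewrite /= h.
Qed.

Lemma weight_splits A p : p \in splits A -> weight p.1 + weight p.2 = weight A.
Proof.
elim: A p => [|a A IH] p /=; first by rewrite inE => /eqP->.
case: a; last by case/mapP=> r /IH <- ->.
by rewrite mem_cat => /orP[]/mapP[r /IH <- ->]; rewrite /= ?addnS.
Qed.

Lemma splits_cons A : exists2 r, splits A = (nseq (size A) false, A) :: r &
  forall p, p \in r -> 0 < weight p.1.
Proof.
elim: A => [|a A [r E rP]] /=; first by exists [::].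
rewrite E /=; case: a.
  eexists; first by reflexivity.
  move=> p; rewrite mem_cat => /orP[]; first by case/mapP=> q /rP ? ->.
  by rewrite inE => /orP[/eqP->|/mapP[q _ ->]].
eexists; first by reflexivity.
by move=> p /mapP[q /rP ? ->].
Qed.

Lemma wf_sqw n k w t : wf n w -> t \in sqw k w -> wf n t.
Proof.
elim: w k t => [|A w IH] k t /=; first by case: k => [|k] //; rewrite inE => _ /eqP->.
case/andP=> sA ww /flatten_mapP[p /size_splits[s1 s2]].
case: ifP => // _ /mapP[u /(IH _ _ ww) wu ->] /=.
by rewrite s2 sA wf_addc // s1.
Qed.

End Columns.
(** * Evaluation of words *)

Local Open Scope ring_scope.

Section Evaluation.

Variable R : comNzRingType.
Implicit Types (xs : seq R) (A B U : column) (v w : word).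

Fixpoint mon xs A : R :=
  match xs, A with
  | x :: xs', a :: A' => (if a then x else 1) * mon xs' A'
  | _, _ => 1
  end.

Fixpoint evw xs w : R := if w is A :: w' then mon xs A * evw xs w' ^+ 2 else 1.

Definition evs xs (p : seq word) : R := \sum_(t <- p) evw xs t.

Lemma mon_nil xs : mon xs [::] = 1.
Proof. by case: xs. Qed.

Lemma mon_nul xs A : nul A -> mon xs A = 1.
Proof. by elim: xs A => [|x xs IH] [|[] A] //= /IH->; rewrite mul1r. Qed.

(** Addition with carry of two columns. *)
Lemma mon_carry xs A B : mon xs A * mon xs B = mon xs (xorc A B) * mon xs (andc A B) ^+ 2.
Proof.
elim: xs A B => [|x xs IH] [|a A] [|b B] //=; rewrite ?(mul1r, expr1n, mulr1) //.
by rewrite mulrACA IH; case: a; case: b => /=; ring.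
Qed.

Lemma evw_nul xs w : all nul w -> evw xs w = 1.
Proof. by elim: w => //= A w IH /andP[/mon_nul-> /IH->]; rewrite expr1n mulr1. Qed.

Lemma evw_addc xs U w : evw xs (addc U w) = mon xs U * evw xs w.
Proof.
elim: w U => [|A w IH] U /=; case: ifP => [/mon_nul->|_] /=;
  rewrite ?mul1r ?expr1n ?mulr1 //.
by rewrite IH exprMn [LHS]mulrA -mon_carry; ring.
Qed.

Lemma evw_addw xs v w : evw xs (addw v w) = evw xs v * evw xs w.
Proof.
elim: v w => [|A v IH] [|B w] //=; rewrite ?(mul1r, mulr1) //.
  by case: ifP => [/andP[/mon_nul-> /(evw_nul xs)->]|_]; rewrite ?expr1n ?mulr1.
case: ifP => [/andP[/mon_nul-> /(evw_nul xs)->]|_] /=; first by rewrite expr1n !mul1r.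
by rewrite evw_addc IH !exprMn [LHS]mulrA -mon_carry; ring.
Qed.

Lemma mon_eqc xs A B : eqc A B -> mon xs A = mon xs B.
Proof.
elim: A B xs => [|a A IH] [|b B] [|x xs] //=; rewrite ?mul1r //.
- by case: b => // /(mon_nul xs)->; rewrite mul1r.
- by case: a => // /(mon_nul xs)->; rewrite mul1r.
by case: eqP => // -> /IH->.
Qed.

Lemma evw_eqw xs t w : eqw t w -> evw xs t = evw xs w.
Proof.
elim: t w => [|A t IH] [|B w] //.
- by move=> /(evw_nul xs) ->.
- by move=> /(evw_nul xs) ->.
by rewrite /=; case: ifP => // /(mon_eqc xs)-> /IH->.
Qed.

Lemma evw_cat xs v w : evw xs (v ++ w) = evw xs v * evw xs w ^+ (2 ^ size v).
Proof.
elim: v => [|A v IH] /=; first by rewrite mul1r.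
by rewrite IH exprMn -exprM -expnSr mulrA.
Qed.

Lemma evs_cons xs t p : evs xs (t :: p) = evw xs t + evs xs p.
Proof. by rewrite /evs big_cons. Qed.

Lemma evs_cat xs p q : evs xs (p ++ q) = evs xs p + evs xs q.
Proof. by rewrite /evs big_cat. Qed.

Lemma evs_flatten xs (ps : seq (seq word)) : evs xs (flatten ps) = \sum_(p <- ps) evs xs p.
Proof. by elim: ps => [|p ps IH] /=; rewrite ?big_nil /evs ?big_nil // big_cons -IH -big_cat. Qed.

End Evaluation.

Lemma rmorph_mon (R S : comNzRingType) (f : {rmorphism R -> S}) xs A :
  f (mon xs A) = mon (map f xs) A.
Proof.
elim: xs A => [|x xs IH] [|a A] //=; rewrite ?rmorph1 // rmorphM IH.
by case: a; rewrite ?rmorph1.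
Qed.

Lemma rmorph_evw (R S : comNzRingType) (f : {rmorphism R -> S}) xs w :
  f (evw xs w) = evw (map f xs) w.
Proof. by elim: w => [|A w IH] /=; rewrite ?rmorph1 // rmorphM rmorphXn IH rmorph_mon. Qed.

Definition char2 (R : nmodType) := forall x : R, x + x = 0.

Lemma sqrD2 (R : comNzRingType) : char2 R -> {morph (fun x : R => x ^+ 2) : x y / x + y}.
Proof. by move=> R2 x y; rewrite sqrrD mulr2n R2 addr0. Qed.

Lemma sqr_sum2 (R : comNzRingType) (I : Type) (r : seq I) (F : I -> R) :
  char2 R -> (\sum_(i <- r) F i) ^+ 2 = \sum_(i <- r) F i ^+ 2.
Proof. by move=> R2; apply: (big_morph (fun x => x ^+ 2) (sqrD2 R2)); rewrite expr0n. Qed.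

Lemma char2_poly (R : nzRingType) : char2 R -> char2 {poly R}.
Proof. by move=> R2 Q; apply/polyP => i; rewrite coefD R2 coef0. Qed.

(** Squaring is additive, so Q^2 has the squares of the coefficients of Q in even
    degrees and nothing else. *)
Lemma coef_sqr2 (R : comNzRingType) (Q : {poly R}) k :
  char2 R -> (Q ^+ 2)`_k = if odd k then 0 else Q`_k./2 ^+ 2.
Proof.
move=> R2; elim/poly_ind: Q k => [|Q c IH] k; first by rewrite expr0n /= !coef0 expr0n if_same.
rewrite (sqrD2 (char2_poly R2)) exprMn -polyC_exp !coefD !coefC coefMX coefMXn.
by case: k => [|[|k]] /=; rewrite ?add0r ?addr0 // subn2 IH /= negbK.
Qed.

Lemma evs_cons_sqr (R : comNzRingType) (xs : seq R) A U p : char2 R ->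
  evs xs [seq A :: addc U t | t <- p] = mon xs A * (mon xs U * evs xs p) ^+ 2.
Proof.
move=> R2; rewrite /evs big_map mulr_sumr sqr_sum2 // mulr_sumr.
by apply: eq_bigr => t _ /=; rewrite evw_addc.
Qed.
(** * Steenrod squares of words *)

Section SteenrodWords.

Variable n : nat.
Local Notation P := {mpoly 'F_2[n]}.

Lemma char2_mpoly : char2 P.
Proof.
move=> f; rewrite -mulr2n -scaler_nat.
by rewrite (_ : 2%:R = 0) ?scale0r //; apply: val_inj.
Qed.

Definition vars : seq P := [seq 'X_i | i <- enum 'I_n].

Lemma size_vars : size vars = n.
Proof. by rewrite size_map size_enum_ord. Qed.

Definition steenrod_linear (x : P) := total_Sq x = x%:P + (x ^+ 2) *: 'X.

Lemma vars_linear x : x \in vars -> steenrod_linear x.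
Proof. by case/mapP=> i _ ->; apply: total_SqX. Qed.

Lemma total_Sq_mon xs A : (size A <= size xs)%N ->
    (forall x, x \in xs -> steenrod_linear x) ->
  total_Sq (mon xs A) =
    \sum_(p <- splits A) (mon xs p.2 * mon xs p.1 ^+ 2) *: 'X^(weight p.1).
Proof.
elim: A xs => [|a A IH] [|x xs] //= le_A xsP.
- by rewrite big_seq1 rmorph1 expr1n mulr1 expr0 alg_polyC.
- by rewrite big_seq1 rmorph1 expr1n mulr1 expr0 alg_polyC.
rewrite rmorphM /= IH //; last by move=> y xs_y; apply: xsP; rewrite inE xs_y orbT.
case: a => /=; last first.
  by rewrite rmorph1 mul1r big_map; apply: eq_bigr => p _ /=; rewrite !mul1r.
rewrite (xsP x) ?mem_head // mulrDl big_cat !big_map /=; congr (_ + _).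
  rewrite mulr_sumr; apply: eq_bigr => p _ /=.
  by rewrite mul1r -mulrA mul_polyC scalerA.
rewrite mulr_sumr; apply: eq_bigr => p _ /=.
rewrite -scalerAl -scalerAr scalerA -exprS mul1r exprMn; congr (_ *: _).
by rewrite mulrCA.
Qed.

(** The Cartan formula for the column A, in which each variable is raised at most
    once, together with Sq^{2j} (f^2) = (Sq^j f)^2. *)
Lemma Sq_mon_sqr k A (f : P) : (size A <= n)%N ->
  Sq k (mon vars A * f ^+ 2) =
    \sum_(p <- splits A)
      if (weight p.1 <= k)%N && ~~ odd (k - weight p.1) then
        mon vars p.2 * (mon vars p.1 * Sq (k - weight p.1)./2 f) ^+ 2
      else 0.
Proof.
move=> le_A; rewrite /Sq rmorphM rmorphXn /= total_Sq_mon ?size_vars //; last exact: vars_linear.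
rewrite mulr_suml coef_sum; apply: eq_bigr => p _.
rewrite -scalerAl coefZ coefXnM coef_sqr2; last exact: char2_mpoly.
case: leqP => //= _; last by rewrite mulr0.
case: odd => /=; first by rewrite mulr0. by rewrite exprMn -mulrA.
Qed.

Lemma Sq_sqr k (f : P) : Sq k (f ^+ 2) = if odd k then 0 else Sq k./2 f ^+ 2.
Proof. by rewrite /Sq rmorphXn coef_sqr2 //; apply: char2_mpoly. Qed.

Lemma Sq_evw k w : wf n w -> Sq k (evw vars w) = evs vars (sqw k w).
Proof.
elim: w k => [|A w IH] k /=.
  by rewrite Sq1; case: k => [|k] _; rewrite /evs ?big_nil ?big_seq1.
case/andP=> le_A wf_w; rewrite Sq_mon_sqr // evs_flatten big_map.
apply: eq_bigr => p _; case: ifP => _; last by rewrite /evs big_nil.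
by rewrite IH // evs_cons_sqr //; apply: char2_mpoly.
Qed.

(** By the Frobenius Sq^k kills a 2^s-th power unless 2^s divides k. *)
Lemma Sq_exp2 s k (f : P) : (0 < k < 2 ^ s)%N -> Sq k (f ^+ (2 ^ s)) = 0.
Proof.
elim: s k => [|s IH] k; first by case: k => [|[]].
rewrite expnSr exprM Sq_sqr => /andP[k_gt0 k_lt]; case: ifP => // /negbT k_even.
have kE : k = (k./2).*2 by rewrite -[LHS]odd_double_half (negbTE k_even).
rewrite IH ?expr0n //; move: k_gt0 k_lt; rewrite kE double_gt0 muln2 ltn_double doubleK.
by move=> -> ->.
Qed.

Lemma Sq_mul_exp2 s k (f g : P) : (k < 2 ^ s)%N ->
  Sq k (f * g ^+ (2 ^ s)) = Sq k f * g ^+ (2 ^ s).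
Proof.
move=> lt_k; rewrite Sq_cartan big_ord_recr /= subnn Sq0 big1 ?add0r // => i _.
rewrite Sq_exp2 ?mulr0 // subn_gt0 ltn_ord /=.
exact: leq_ltn_trans (leq_subr _ _) lt_k.
Qed.

End SteenrodWords.
(** * Reducible words *)

Section Reduction.

Variable n : nat.
Local Notation P := {mpoly 'F_2[n]}.
Local Notation X := (evw (@vars n)).
Local Notation Xs := (evs (@vars n)).

(** The bound on the squares makes this the notion of strict inadmissibility: for
    s the length of w it allows appending columns to w.  A polynomial Sq^k (X h)
    is recorded by the pair (k, h). *)
Definition reducible_by (s : nat) (w : word) :=
  exists2 cs : seq (nat * word),
    all (fun c => (0 < c.1 < 2 ^ s)%N && wf n c.2) cs &
  exists2 ts : seq word, all (fun t => wf n t && ltw t w) ts &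
    \sum_(c <- cs) Sq c.1 (X c.2) = X w + Xs ts.

(** The word of t * y^(2^s): t may be longer than s, and then its last columns
    overlap with y and are added to it. *)
Fixpoint attach (s : nat) (t y : word) : word :=
  if s is s'.+1 then head [::] t :: attach s' (behead t) y else addw t y.

Lemma evw_attach (R : comNzRingType) (xs : seq R) s t y :
  evw xs (attach s t y) = evw xs t * evw xs y ^+ (2 ^ s).
Proof.
elim: s t => [|s IH] t /=; first exact: evw_addw.
rewrite IH exprMn -exprM -expnSr mulrA.
by case: t => //=; rewrite mon_nil expr1n mulr1.
Qed.

Lemma wf_attach s t y : wf n t -> wf n y -> wf n (attach s t y).
Proof.
move=> wt wy; elim: s t wt => [|s IH] t wt /=; first exact: wf_addw.
by case: t wt => [|A t] /=; [rewrite IH | case/andP=> -> /IH->].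
Qed.

Lemma lexlt_attach f t w y : lexlt f t w -> lexlt f (attach (size w) t y) (w ++ y).
Proof. by elim: w t => //= A w IH t; case: ifP => // _; case: ifP => // _ /IH. Qed.

Lemma lexeq_refl f w : lexeq f w w.
Proof. by elim: w => //= A w IH; rewrite eqxx. Qed.

Lemma addw_nul t y : all nul t -> addw t y = y.
Proof. by case: t => [|A t] /= => [_|->]; case: y. Qed.

Lemma lexeq_attach f t w y : lexeq f t w -> lexeq f (attach (size w) t y) (w ++ y).
Proof.
elim: w t => [|A w IH] t /=; first by move/addw_nul->; apply: lexeq_refl.
by case: ifP => // _ /IH.
Qed.

Lemma ltw_attach t w y : ltw t w -> ltw (attach (size w) t y) (w ++ y).
Proof.
rewrite /ltw; case: ifP => [/lexlt_attach->//|_].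
by case: ifP => // /lexeq_attach-> /lexlt_attach->; case: ifP.
Qed.

(** All the squares involved are linear over 2^s-th powers, s being the length of
    w, so the reduction can be multiplied by the 2^s-th power of y. *)
Lemma reducible_cat w y : wf n y ->
  reducible_by (size w) w -> forall s, (size w <= s)%N -> reducible_by s (w ++ y).
Proof.
move=> wy [cs csP [ts tsP E]] s le_s.
exists [seq (c.1, attach (size w) c.2 y) | c <- cs].
  rewrite all_map; apply: sub_all csP => -[k h] /= /andP[/andP[-> lt_k] wh].
  by rewrite wf_attach ?andbT //=; apply: leq_trans lt_k _; rewrite leq_exp2l.
exists [seq attach (size w) t y | t <- ts].
  rewrite all_map; apply: sub_all tsP => t /= /andP[wt lt_t].
  by rewrite wf_attach // ltw_attach.
rewrite big_map; under eq_bigr => c _ do rewrite evw_attach.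
transitivity ((\sum_(c <- cs) Sq c.1 (X c.2)) * X y ^+ (2 ^ size w)).
  rewrite mulr_suml big_seq [RHS]big_seq; apply: eq_bigr => c cs_c.
  by rewrite Sq_mul_exp2 //; have /andP[/andP[]] := allP csP c cs_c.
rewrite E mulrDl evw_cat; congr (_ + _).
by rewrite /evs mulr_suml big_map; apply: eq_bigr => t _; rewrite evw_attach.
Qed.

(** In Sq^{2k} (X_A h^2) the terms where A is not raised give X_A (Sq^k h)^2; in
    the others the first column has lost at least one variable. *)
Lemma sqw_double k A h : exists2 r,
  sqw k.*2 (A :: h) = [seq A :: t | t <- sqw k h] ++ r &
  forall t, t \in r -> (weight (head [::] t) < weight A)%N.
Proof.
have [r E rP] := splits_cons A; rewrite /= E /=.
have w0 : weight (nseq (size A) false) = 0%N by elim: (size A).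
rewrite w0 leq0n subn0 odd_double doubleK /=; eexists.
  congr (_ ++ _); apply: eq_map => t; congr (_ :: _).
  by case: t => [|B t] /=; rewrite nul_weight w0.
move=> t /flatten_mapP[p rp]; case: ifP => // _ /mapP[u _ ->] /=.
have /weight_splits <- : p \in splits A by rewrite E inE rp orbT.
by rewrite -[X in (X < _)%N]add0n ltn_add2r rP.
Qed.

(** Replacing each Sq^k (X h) by Sq^{2k} (X_A (X h)^2) gives X_A times the square
    of the original reduction, up to the smaller words of sqw_double. *)
Lemma reducible_cons s A w : (size A <= n)%N ->
  reducible_by s w -> reducible_by s.+1 (A :: w).
Proof.
move=> sA [cs csP [ts tsP E]].
(* The words of sqw_double with a smaller first column. *)
pose low (c : nat * word) := [seq t <- sqw c.1.*2 (A :: c.2) | weight (head [::] t) < weight A]%N.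
exists [seq (c.1.*2, A :: c.2) | c <- cs].
  rewrite all_map; apply: sub_all csP => -[k h] /= /andP[/andP[k_gt0 lt_k] wh].
  by rewrite double_gt0 k_gt0 expnS mul2n ltn_double lt_k sA.
have wfc c : c \in cs -> wf n (A :: c.2).
  by move=> /(allP csP)/andP[_] /=; rewrite sA.
exists ([seq A :: t | t <- ts] ++ flatten [seq low c | c <- cs]).
  rewrite all_cat all_map; apply/andP; split.
    by apply: sub_all tsP => t; rewrite /= sA /ltw /= !ltnn !eqxx.
  apply/allP=> t /flatten_mapP[c cs_c]; rewrite mem_filter => /andP[lt_t t_in].
  by rewrite (wf_sqw (wfc c cs_c) t_in) /ltw /= lt_t.
transitivity (\sum_(c <- cs) (mon (@vars n) A * Sq c.1 (X c.2) ^+ 2 + Xs (low c))).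
  rewrite big_map big_seq [RHS]big_seq; apply: eq_bigr => c cs_c /=.
  have wc := wfc c cs_c.
  rewrite -[mon _ _ * _]/(X (A :: c.2)) Sq_evw // /low.
  have [r rE rP] := sqw_double c.1 A c.2; rewrite rE filter_cat evs_cat.
  have -> : [seq t <- [seq A :: t | t <- sqw c.1 c.2] | (weight (head [::] t) < weight A)%N] = [::].
    by elim: (sqw _ _) => //= t l ->; rewrite ltnn.
  rewrite (all_filterP _) /=; last by apply/allP=> t /rP.
  congr (_ + _); rewrite Sq_evw; last by case/andP: wc.
  rewrite /evs big_map sqr_sum2; last exact: char2_mpoly.
  by rewrite mulr_sumr.
rewrite big_split /= -mulr_sumr -sqr_sum2; last exact: char2_mpoly.
rewrite E sqrD2; last exact: char2_mpoly.
rewrite mulrDr -addrA evs_cat evs_flatten big_map; congr (_ + (_ + _)).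
rewrite /evs big_map sqr_sum2; last exact: char2_mpoly.
by rewrite mulr_sumr.
Qed.

Lemma reducible_window p w y : wf n p -> wf n y ->
  reducible_by (size w) w -> reducible_by (size (p ++ w ++ y)) (p ++ w ++ y).
Proof.
move=> wp wy red_w; have red_wy : reducible_by (size (w ++ y)) (w ++ y).
  by apply: reducible_cat; rewrite // size_cat leq_addr.
by elim: p wp => //= A p IH /andP[sA /IH]; apply: reducible_cons.
Qed.

End Reduction.

(** Adds t to a sum of words modulo two, cancelling it if it is already there. *)
Fixpoint toggle (t : word) (l : seq word) : seq word :=
  if l is u :: l' then if eqw t u then l' else u :: toggle t l' else [:: t].

(** The pair (w, hs) stands for the sum of the Sq^k (X h) with h in hs, where k is
    determined by degrees.  It certifies w when its terms that are not smaller
    than w cancel down to w alone; the terms below w need not be computed with. *)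
Definition certifies n (c : word * seq word) : bool :=
  let: (w, hs) := c in
  let d := degw w in
  let s := (2 ^ size w)%N in
  [&& all (fun h => let k := d - degw h in [&& 0 < k, k < s & wf n h])%N hs,
      wf n w &
      if foldr toggle [::]
           [seq t <- flatten [seq sqw (d - degw h)%N h | h <- hs] | ~~ ltw t w]
      is [:: t] then eqw t w else false].

Lemma evs_toggle n t l : evs (@vars n) (toggle t l) = evw (@vars n) t + evs (@vars n) l.
Proof.
elim: l => [|u l IH] /=; first by rewrite /evs big_seq1 big_nil addr0.
case: ifP => [/(evw_eqw (@vars n))->|_]; last by rewrite !evs_cons IH addrCA.
by rewrite evs_cons addrA char2_mpoly add0r.
Qed.

Lemma certifies_reducible n c : certifies n c -> reducible_by n (size c.1) c.1.
Proof.
case: c => w hs; rewrite /certifies => /and3P[hsP ww].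
set l := [seq t <- _ | _]; case E: (foldr _ _ _) => [|t []] // /(evw_eqw (@vars n)) tw.
exists [seq (degw w - degw h, h)%N | h <- hs].
  by rewrite all_map; apply: sub_all hsP => h /= /and3P[-> -> ->].
exists [seq t <- flatten [seq sqw (degw w - degw h)%N h | h <- hs] | ltw t w].
  apply/allP=> u; rewrite mem_filter => /andP[-> /flatten_mapP[h hs_h u_in]].
  by rewrite (wf_sqw _ u_in) //; have /and3P[] := allP hsP h hs_h.
transitivity (evs (@vars n) (flatten [seq sqw (degw w - degw h)%N h | h <- hs])).
  rewrite evs_flatten !big_map big_seq [RHS]big_seq; apply: eq_bigr => h hs_h.
  by rewrite Sq_evw //; have /and3P[] := allP hsP h hs_h.
transitivity (evs (@vars n) l + evs (@vars n)
    [seq t <- flatten [seq sqw (degw w - degw h)%N h | h <- hs] | ltw t w]).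
  by rewrite /evs !big_filter addrC [LHS](bigID (fun t => ltw t w)).
congr (_ + _); rewrite -tw.
have -> : evs (@vars n) l = evs (@vars n) (foldr toggle [::] l).
  by elim: (l) => //= u m IH; rewrite evs_toggle evs_cons IH.
by rewrite E /evs big_seq1.
Qed.
(** * The order on words is well-founded *)

Section Ranking.

(** The columns read as the digits of a number in base b, the first one leading. *)
Fixpoint key (f : column -> nat) (b L : nat) (w : word) : nat :=
  if L is L'.+1 then (f (head [::] w) * b ^ L' + key f b L' (behead w))%N else 0%N.

(** A numerical form of ltw; it turns induction on words into induction on
    numbers. *)
Definition rank n L w : nat :=
  (key weight (2 ^ n) L w * (2 ^ n) ^ L + key code (2 ^ n) L w)%N.

Variables (n : nat) (f : column -> nat).
Hypothesis f_lt : forall A, (size A <= n)%N -> (f A < 2 ^ n)%N.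

Lemma wf_head w : wf n w -> (size (head [::] w) <= n)%N /\ wf n (behead w).
Proof. by case: w => [|A w] //= /andP. Qed.

Lemma key_lt_exp L w : wf n w -> (key f (2 ^ n) L w < (2 ^ n) ^ L)%N.
Proof.
elim: L w => [|L IH] w /wf_head[sA ww] //=; rewrite expnS.
apply: (@leq_trans (f (head [::] w) * (2 ^ n) ^ L + (2 ^ n) ^ L)%N).
  by rewrite ltn_add2l IH.
by rewrite addnC -mulSn leq_mul2r f_lt ?orbT.
Qed.

Lemma key_lexlt L t w : wf n t -> (size w <= L)%N -> lexlt f t w ->
  (key f (2 ^ n) L t < key f (2 ^ n) L w)%N.
Proof.
elim: w L t => //= A w IH [|L] t // /wf_head[sA wt] le_w /=.
case: ltnP => [lt_f _|_].
  apply: (@leq_trans (f (head [::] t) * (2 ^ n) ^ L + (2 ^ n) ^ L)%N).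
    by rewrite ltn_add2l key_lt_exp.
  by rewrite addnC -mulSn (leq_trans _ (leq_addr _ _)) // leq_mul2r lt_f orbT.
by case: eqP => // -> /IH; rewrite ltn_add2l; apply.
Qed.

End Ranking.

Lemma key_nul f b L w : (forall A, nul A -> f A = 0%N) -> all nul w -> key f b L w = 0%N.
Proof.
move=> f0; elim: L w => [|L IH] w w0 //=; rewrite IH; last by case: w w0 => //= A w /andP[].
by case: w w0 => [|A w] /= => [_|/andP[/f0->]]; rewrite ?f0.
Qed.

Lemma key_lexeq f b L t w : (forall A, nul A -> f A = 0%N) -> (size w <= L)%N ->
  lexeq f t w -> key f b L t = key f b L w.
Proof.
move=> f0; elim: w L t => [|A w IH] L t /=.
  by move=> _ t0; rewrite !key_nul.
by case: L => // L le_w /=; case: eqP => // -> /IH->.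
Qed.

Lemma weight_nul A : nul A -> weight A = 0%N.
Proof. by rewrite nul_weight => /eqP. Qed.

Lemma rank_ltw n L t w : wf n t -> (size w <= L)%N -> ltw t w -> (rank n L t < rank n L w)%N.
Proof.
move=> wt le_w; rewrite /ltw /rank.
case: ifP => [/(key_lexlt (@weight_lt n) wt le_w) lt_k _|_].
  apply: (@leq_trans (key weight (2 ^ n) L t * (2 ^ n) ^ L + (2 ^ n) ^ L)%N).
    by rewrite ltn_add2l (key_lt_exp (@code_lt n)).
  by rewrite addnC -mulSn (leq_trans _ (leq_addr _ _)) // leq_mul2r lt_k orbT.
case: ifP => // /(key_lexeq (2 ^ n) weight_nul le_w)-> /(key_lexlt (@code_lt n) wt le_w).
by rewrite ltn_add2l.
Qed.

(** The normal form of a word: L columns of exactly n bits. *)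
Fixpoint pad (n L : nat) (w : word) : word :=
  if L is L'.+1 then
    let A := head [::] w in (A ++ nseq (n - size A) false) :: pad n L' (behead w)
  else [::].

Lemma weight_pad A k : weight (A ++ nseq k false) = weight A.
Proof. by elim: A => [|a A /= ->] //; elim: k. Qed.

Lemma code_pad A k : code (A ++ nseq k false) = code A.
Proof. by elim: A => [|a A /= ->] //; elim: k => //= k ->. Qed.

Lemma mon_pad (R : comNzRingType) (xs : seq R) A k : mon xs (A ++ nseq k false) = mon xs A.
Proof.
have nul_nseq : nul (nseq k false) by elim: k.
elim: A xs => [|a A IH] xs; first by rewrite cat0s mon_nul // mon_nil.
by case: xs => //= x xs; rewrite IH.
Qed.

Lemma rank_pad n L w : rank n L (pad n L w) = rank n L w.
Proof.
rewrite /rank; congr (_ * _ + _)%N; elim: L w => //= L IH w.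
  by rewrite weight_pad IH.
by rewrite code_pad IH.
Qed.

Lemma size_pad n L w : size (pad n L w) = L.
Proof. by elim: L w => //= L IH w; rewrite IH. Qed.

Lemma pad_full n L w : wf n w -> full n (pad n L w).
Proof.
elim: L w => //= L IH w /wf_head[sA ww]; rewrite IH // andbT.
by rewrite size_cat size_nseq subnKC.
Qed.

Lemma degw_eq0 w : degw w = 0%N -> all nul w.
Proof.
elim: w => //= A w IH /eqP; rewrite addn_eq0 double_eq0 => /andP[wA /eqP/IH->].
by rewrite nul_weight wA.
Qed.

Lemma degw_behead L w : (degw w < 2 ^ L.+1)%N -> (degw (behead w) < 2 ^ L)%N.
Proof.
case: w => [|A w] /=; first by rewrite !expn_gt0.
rewrite expnS mul2n => lt_w; rewrite -ltn_double.
exact: leq_ltn_trans (leq_addl _ _) lt_w.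
Qed.

Lemma degw_pad n L w : (degw w < 2 ^ L)%N -> degw (pad n L w) = degw w.
Proof.
elim: L w => [|L IH] w /=; first by rewrite ltnS leqn0 => /eqP->.
by move/degw_behead/IH->; rewrite weight_pad; case: w.
Qed.

Lemma evw_pad (R : comNzRingType) (xs : seq R) n L w :
  (degw w < 2 ^ L)%N -> evw xs (pad n L w) = evw xs w.
Proof.
elim: L w => [|L IH] w /=.
  by rewrite ltnS leqn0 => /eqP/degw_eq0/(evw_nul xs)->.
move/degw_behead/IH->; rewrite mon_pad.
by case: w => [|A w] //=; rewrite mon_nil expr1n mul1r.
Qed.

(** * Every monomial is a word *)

Section WordOfMonomial.

Variable n : nat.
Local Notation P := {mpoly 'F_2[n]}.
Local Notation X := (evw (@vars n)).

Fixpoint word_of L (m : 'I_n -> nat) : word :=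
  if L is L'.+1 then
    [seq odd (m i) | i <- enum 'I_n] :: word_of L' (fun i => (m i)./2)
  else [::].

Lemma word_of_full L m : full n (word_of L m).
Proof. by elim: L m => //= L IH m; rewrite IH size_map size_enum_ord eqxx. Qed.

Lemma size_word_of L m : size (word_of L m) = L.
Proof. by elim: L m => //= L IH m; rewrite IH. Qed.

Lemma mon_map (R : comNzRingType) (I : Type) (r : seq I) (x : I -> R) (b : I -> bool) :
  mon (map x r) (map b r) = \prod_(i <- r) x i ^+ b i.
Proof.
elim: r => [|i r IH] /=; first by rewrite big_nil.
by rewrite big_cons IH; case: (b i).
Qed.

Lemma half_lt_exp2 L k : (k < 2 ^ L.+1)%N -> (k./2 < 2 ^ L)%N.
Proof.
rewrite expnS mul2n -[(k./2 < _)%N]ltn_double; apply: leq_ltn_trans.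
by rewrite -[leqRHS]odd_double_half leq_addl.
Qed.

Lemma evw_word_of L m : (forall i, (m i < 2 ^ L)%N) ->
  X (word_of L m) = \prod_(i < n) 'X_i ^+ m i.
Proof.
elim: L m => [|L IH] m lt_m /=.
  by rewrite big1 // => i _; have:= lt_m i; rewrite ltnS leqn0 => /eqP->.
rewrite IH => [|i]; last exact: half_lt_exp2.
rewrite /vars mon_map big_enum /= -prodrXl -big_split; apply: eq_bigr => i _ /=.
by rewrite -exprM muln2 -exprD odd_double_half.
Qed.

Lemma degw_word_of L m : (forall i, (m i < 2 ^ L)%N) ->
  degw (word_of L m) = (\sum_(i < n) m i)%N.
Proof.
elim: L m => [|L IH] m lt_m /=.
  by rewrite big1 // => i _; have:= lt_m i; rewrite ltnS leqn0 => /eqP->.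
have -> (s : seq 'I_n) : weight [seq odd (m i) | i <- s] = (\sum_(i <- s) odd (m i))%N.
  by elim: s => [|i s IHs] /=; rewrite ?big_nil ?big_cons // IHs; case: odd.
rewrite IH => [|i]; last exact: half_lt_exp2.
rewrite big_enum /= -mul2n big_distrr /= -big_split; apply: eq_bigr => i _ /=.
by rewrite mul2n odd_double_half.
Qed.

Lemma mpolyX_word L (m : 'X_{1..n}) : (mdeg m < 2 ^ L)%N ->
  exists2 w, [/\ full n w, size w = L & degw w = mdeg m] & X w = 'X_[m].
Proof.
move=> lt_m; have lt_i i : (m i < 2 ^ L)%N.
  by apply: leq_ltn_trans lt_m; rewrite mdegE (bigD1 i) //= leq_addr.
exists (word_of L m); last by rewrite evw_word_of // -mpolyXE_id.
split; [exact: word_of_full | exact: size_word_of |].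
by rewrite degw_word_of // mdegE.
Qed.

Lemma mon_homog xs A : {in xs, forall x : P, x \is 1.-homog} -> (size A <= size xs)%N ->
  mon xs A \is (weight A).-homog.
Proof.
elim: A xs => [|a A IH] [|x xs] //= xsP; rewrite ?dhomog1 // ltnS => le_A.
have {}IH : mon xs A \is (weight A).-homog.
  by apply: IH => // y xs_y; apply: xsP; rewrite inE xs_y orbT.
case: a; last by rewrite mul1r.
have h : x * mon xs A \is (1 + weight A).-homog by apply: dhomogM; rewrite ?xsP ?mem_head.
exact: h.
Qed.

Lemma evw_homog w : wf n w -> X w \is (degw w).-homog.
Proof.
elim: w => [|A w IH] /=; first by rewrite dhomog1.
case/andP=> sA /IH Xw; apply: dhomogM.
  apply: mon_homog; rewrite ?size_vars // => _ /mapP[i _ ->].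
  by rewrite dhomogX; apply/eqP/mdeg1.
by rewrite -addnn expr2 dhomogM.
Qed.

End WordOfMonomial.
(** * The search for irreducible words *)

Section Search.

(** A set of certificates indexed by the bits of their windows. *)
Inductive trie := Leaf | Node of option (word * seq word) & trie & trie.

Fixpoint insert (s : bitseq) c (tr : trie) : trie :=
  let: (o, l, r) := if tr is Node o l r then (o, l, r) else (None, Leaf, Leaf) in
  match s with
  | [::] => Node (Some c) l r
  | b :: s' => if b then Node o (insert s' c l) r else Node o l (insert s' c r)
  end.

(** The search builds words from left to right and keeps them reversed, hence the
    reversal: a window that has just been completed is a prefix. *)
Definition trie_of (cs : seq (word * seq word)) : trie :=
  foldr (fun c => insert (flatten (rev c.1)) c) Leaf cs.

Fixpoint lookup (tr : trie) (s : bitseq) : option (word * seq word) :=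
  if tr is Node o l r then
    if o is Some c then Some c else
    if s is b :: s' then lookup (if b then l else r) s' else None
  else None.

Fixpoint trie_all (p : pred (word * seq word)) (tr : trie) : bool :=
  if tr is Node o l r then
    [&& if o is Some c then p c else true, trie_all p l & trie_all p r]
  else true.

Lemma lookup_all p tr s c : trie_all p tr -> lookup tr s = Some c -> p c.
Proof.
elim: tr s => //= o l IHl r IHr s /and3P[po /IHl pl /IHr pr].
by case: o po => [c'|_] => [pc' [<-]|] //; case: s => // -[] s; [apply: pl | apply: pr].
Qed.

Fixpoint columns n : seq column :=
  if n is n'.+1 then
    let r := columns n' in [seq false :: A | A <- r] ++ [seq true :: A | A <- r]
  else [:: [::]].

Lemma mem_columns n A : size A = n -> A \in columns n.
Proof.
by elim: A n => [|a A IH] [|n] //= [/IH An]; rewrite mem_cat; case: a; rewrite map_f ?orbT.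
Qed.

(** Comparing the window that was found with x spares a proof that lookup follows
    the bits of its windows. *)
Definition forbidden (tr : trie) (x : word) : bool :=
  if lookup tr (flatten x) is Some c then prefix (rev c.1) x else false.

(** Words of L columns and degree d, continuing the reversed word x, in which no
    window of the trie is completed.  The parity of what remains of the degree
    determines that of the weight of the next column. *)
Fixpoint search (tr : trie) (cols : seq column) (L d : nat) (x : word) : seq word :=
  if L is L'.+1 then
    flatten [seq if (weight A <= d)%N then
                   let e := (d - weight A)%N in
                   if odd e then [::] else
                   if forbidden tr (A :: x) then [::] else
                   search tr cols L' e./2 (A :: x)
                 else [::]
            | A <- cols]
  else if d is 0 then [:: rev x] else [::].

Lemma search_complete p tr cols L d x w : trie_all p tr ->
    size w = L -> {subset w <= cols} -> degw w = d ->
  rev x ++ w \in search tr cols L d x \/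
  exists2 c, p c & exists u y, rev x ++ w = u ++ c.1 ++ y.
Proof.
move=> tr_p; elim: w L d x => [|A w IH] [|L] d x //=.
  by move=> _ _ <-; left; rewrite cats0 inE.
case=> sw w_cols <-; case bad: (forbidden tr (A :: x)).
  right; move: bad; rewrite /forbidden; case E: lookup => [c|] // /prefixP[s sE].
  exists c; first exact: lookup_all E.
  (* The reversed window is a prefix of A :: x, so it ends just before w. *)
  exists (rev s), w; rewrite -cat_rcons -rev_cons sE rev_cat revK.
  by rewrite catA.
have wcols : {subset w <= cols} by move=> B Bw; apply: w_cols; rewrite inE Bw orbT.
have [found|] := IH L _ (A :: x) sw wcols (erefl _); last first.
  by case=> c pc [u [y E]]; right; exists c => //; exists u, y; rewrite -cat_rcons -rev_cons.
left; apply/flatten_mapP; exists A; first by apply: w_cols; rewrite mem_head.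
by rewrite leq_addr addKn odd_double bad doubleK -cat_rcons -rev_cons.
Qed.

End Search.

(** * Irreducible words span the quotient *)

Section UpperBound.

Variables (n L d : nat).
Hypothesis lt_d : (d < 2 ^ L)%N.
Local Notation V := (dhomog n.+1 'F_2 d).
Local Notation P := {mpoly 'F_2[n.+1]}.
Local Notation X := (evw (@vars n.+1)).

Variable survivors : seq word.
Hypothesis reduction : forall w, size w = L -> full n.+1 w ->
  degw w = d -> w \in survivors \/ exists s, reducible_by n.+1 s w.

Let U : {vspace V} := (hits + <<[seq indhomog d (X w) | w <- survivors]>>)%VS.

Let in_U (f : P) := exists2 v : V, v \in U & val v = f.

Let in_U0 : in_U 0.
Proof. by exists 0; rewrite ?mem0v. Qed.

Let in_UD f g : in_U f -> in_U g -> in_U (f + g).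
Proof. by case=> v vU <- [w wU <-]; exists (v + w); rewrite ?memvD. Qed.

Let in_U_hit f : hit f -> f \is d.-homog -> in_U f.
Proof.
move=> hf fd; exists (DHomog fd) => //.
by apply: (subvP (addvSl _ _)); apply/hitsP.
Qed.

(** Induction on rank.  The terms of a reduction need not have degree d, so it is
    first projected to that degree, which keeps every Sq^k (X h) or kills it. *)
Lemma monomial_in_span w : wf n.+1 w -> degw w = d -> in_U (X w).
Proof.
have [m] := ubnP (rank n.+1 L w); elim: m w => // m IH w lt_m ww dw.
pose v := pad n.+1 L w.
have lt_w : (degw w < 2 ^ L)%N by rewrite dw.
have Xv : X v = X w by apply: evw_pad.
have dv : degw v = d by rewrite /v degw_pad.
have fv : full n.+1 v by apply: pad_full.
have wv := full_wf fv.
have Xw_d : X w \is d.-homog by rewrite -dw; apply: evw_homog.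
have [v_s|[s [cs csP [ts tsP E]]]] := reduction (size_pad n.+1 L w) fv dv.
  exists (indhomog d (X v)).
    apply: (subvP (addvSr _ _)); apply: memv_span.
    exact: (map_f (fun u => indhomog d (X u))).
  by rewrite Xv /indhomog insubdK.
have pE : X w = pihomog mdeg d (\sum_(c <- cs) Sq c.1 (X c.2)) +
                \sum_(t <- ts) pihomog mdeg d (X t).
  rewrite E Xv linearD /= -raddf_sum /= -addrA char2_mpoly addr0.
  by rewrite pihomog_dE.
rewrite pE raddf_sum /=; apply: in_UD.
  rewrite big_seq; apply: (big_ind in_U) => // -[k h] /(allP csP) /= /andP[/andP[k_gt0 _] wh].
  have Sd : Sq k (X h) \is (k + degw h).-homog by apply/Sq_homog/evw_homog.
  have [kE|ne] := eqVneq (k + degw h)%N d; last by rewrite (pihomog_ne0 ne).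
  by rewrite kE in Sd; rewrite pihomog_dE //; apply: in_U_hit => //; apply: hit_Sq.
rewrite big_seq; apply: (big_ind in_U) => // t /(allP tsP)/andP[wt lt_t].
have td := evw_homog wt.
have [tE|ne] := eqVneq (degw t) d; last by rewrite (pihomog_ne0 ne).
rewrite pihomog_dE -?tE //; apply: IH => //.
rewrite -ltnS; apply: leq_trans lt_m; rewrite ltnS -(rank_pad n.+1 L w).
by apply: rank_ltw => //; rewrite size_pad.
Qed.

Lemma dim_quotient_le : (\dim {: quotv (hits : {vspace V})} <= size survivors)%N.
Proof.
rewrite dim_quotv leq_subLR.
have -> : (fullv : {vspace V}) = U.
  apply/esym/vspaceP => v; rewrite memvf.
  have [u uU uE] : in_U (val v).
    rewrite [val v]mpolyE big_seq; apply: (big_ind in_U) => // m vm.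
    have md : mdeg m = d by apply: (dhomogP _ _ _ (dhomog_is_dhomog v)).
    have [|w [fw _ dw] Xw] := @mpolyX_word n.+1 L m; first by rewrite md.
    rewrite -Xw; have [u uU <-] : in_U (X w) by apply: monomial_in_span; rewrite ?full_wf ?dw.
    by exists ((val v)@_m *: u); rewrite ?memvZ.
  by rewrite -(val_inj uE).
apply: leq_trans (dimv_add_leqif _ _).1 _; rewrite leq_add2l.
by apply: leq_trans (dim_span _) _; rewrite size_map.
Qed.

End UpperBound.
(** * Combinatorics of the functionals *)

Local Open Scope nat_scope.

(** The sets B minus one common element of g and B. *)
Fixpoint picks (g B : column) : seq column :=
  match g, B with
  | a :: g', b :: B' =>
      let r := [seq b :: t | t <- picks g' B'] in
      if a then if b then (false :: B') :: r else r else r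
  | _, _ => [::]
  end.

(** The permanent, hence modulo two the determinant, of the submatrix of G with
    rows in A and columns in B, expanded along the first row in A. *)
Fixpoint minor (G : seq bitseq) (B A : column) : bool :=
  match G, A with
  | g :: G', a :: A' =>
      if a then foldr (fun t x => if minor G' t A' then ~~ x else x) false (picks g B)
      else minor G' B A'
  | _, _ => nul B
  end.

Fixpoint subc (B A : column) : bool :=
  match B, A with
  | b :: B', a :: A' => if b then if a then subc B' A' else false else subc B' A'
  | _, _ => true
  end.

Fixpoint diffc (A B : column) : column :=
  match A, B with
  | a :: A', b :: B' => (if a then ~~ b else false) :: diffc A' B'
  | _, _ => [::]
  end.

(** The word of e / X_U by subtraction with borrow, if X_U divides e. *)
Fixpoint subw (U : column) (e : word) : option word :=
  if nul U then Some e else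
  if e is B :: e' then
    if subw (diffc U B) e' is Some t then Some (xorc B U :: t) else None
  else None.

(** The coefficient of the monomial e in the total square of the monomial b. *)
Fixpoint sqcoef (b e : word) : bool :=
  match b, e with
  | A :: b', B :: e' =>
      if subc B A then
        if subw (diffc A B) e' is Some t then sqcoef b' t else false
      else false
  | [::], [::] => true
  | _, _ => false
  end.

(** All the words b of L columns for which e occurs in the total square of b. *)
Fixpoint sources_aux (n L : nat) (e : word) : seq word :=
  match L, e with
  | L'.+1, B :: e' =>
      flatten [seq if subc B A then
                     if subw (diffc A B) e' is Some t then
                       [seq A :: b | b <- sources_aux n L' t]
                     else [::]
                   else [::]
              | A <- columns n]
  | 0, [::] => [:: [::]]
  | _, _ => [::]
  end.

Definition parity (I : Type) (p : I -> bool) (r : seq I) : bool :=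
  foldr (fun i x => if p i then ~~ x else x) false r.

(** The sum of the coefficients at E vanishes on Sq^k b for all k > 0 and all
    monomials b.  Only the monomials b of degree less than d whose total square
    meets E have to be examined. *)
Definition unhittable (n L d : nat) (E : seq word) : bool :=
  all (fun b => (d <= degw b) || ~~ parity (sqcoef b) E)
      (flatten [seq sources_aux n L e | e <- E]).

(** The condition under which minors computes the coefficient: comparing column
    by column, the weights of w and e agree until possibly w has a smaller one.
    In that case the
    coefficient is zero; a larger weight in w would allow carries. *)
Fixpoint tame (e w : word) : bool :=
  match e, w with
  | B :: e', A :: w' =>
      if weight A < weight B then true else
      if weight A == weight B then tame e' w' else false
  | [::], [::] => true
  | _, _ => false
  end.

Fixpoint minors (G : seq bitseq) (e w : word) : bool :=
  match e, w with
  | B :: e', A :: w' => if minor G B A then minors G e' w' else false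
  | _, _ => true
  end.

Local Open Scope ring_scope.

Lemma size_diffc A B : size (diffc A B) = minn (size A) (size B).
Proof. by elim: A B => [|a A IH] [|b B] //=; rewrite IH minnSS. Qed.

(** * Functionals that vanish on hit polynomials *)

Section Coefficients.

Variable n : nat.
Local Notation P := {mpoly 'F_2[n]}.
Local Notation X := (evw (@vars n)).
Local Notation Xs := (evs (@vars n)).
Implicit Types (A B U : column) (b e w : word) (f g : P).

Definition mcol A : 'X_{1..n} := [multinom nth false A i : nat | i < n].

Fixpoint mword w : 'X_{1..n} := if w is A :: w' then (mcol A + mword w' *+ 2)%MM else 0%MM.

Lemma mcolE A i : mcol A i = nth false A i.
Proof. by rewrite mnmE. Qed.

Lemma mon_vars A : size A = n -> mon (@vars n) A = 'X_[mcol A].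
Proof.
move=> sA; have {1}-> : A = [seq nth false A i | i : 'I_n <- enum 'I_n].
  by rewrite -[LHS](mkseq_nth false) sA /mkseq -val_enum_ord -map_comp.
rewrite /vars mon_map big_enum /= mpolyXE_id.
by apply: eq_bigr => i _; rewrite mcolE.
Qed.

Lemma evw_vars w : full n w -> X w = 'X_[mword w].
Proof.
elim: w => [|A w IH] /=; first by rewrite mpolyX0.
by case/andP=> /eqP/mon_vars-> /IH->; rewrite mpolyXD mpolyXn.
Qed.

Lemma mdeg_mcol A : size A = n -> mdeg (mcol A) = weight A.
Proof.
move=> sA; have := mon_homog (A := A) (xs := @vars n) _ _.
rewrite mon_vars // dhomogX => /(_ _ _)/eqP; apply; last by rewrite size_vars sA.
by move=> _ /mapP[i _ ->]; rewrite dhomogX; apply/eqP/mdeg1.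
Qed.

Lemma mdeg_mword w : full n w -> mdeg (mword w) = degw w.
Proof.
move=> fw; apply/eqP; rewrite -(dhomogX 'F_2) -evw_vars //.
exact/evw_homog/full_wf.
Qed.

(** If u is the only exponent of f that differs from u + 2 m by an even vector, then
    the square has to contribute exactly 2 m. *)
Lemma mcoeff_mul_sqr f g u m : (forall v v', v \in msupp f ->
    (v + v' *+ 2 = u + m *+ 2)%MM -> v = u) ->
  (f * g ^+ 2)@_(u + m *+ 2) = f@_u * g@_m.
Proof.
move=> fP; have sqF (c : 'F_2) : c ^+ 2 = c by case: c => -[|[|//]] i; apply: val_inj.
have -> : g ^+ 2 = \sum_(v <- msupp g) g@_v *: 'X_[v *+ 2].
  rewrite {1}[g]mpolyE sqr_sum2; last exact: char2_mpoly.
  by apply: eq_bigr => v _; rewrite exprZn sqF mpolyXn.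
rewrite {1}[f]mpolyE mulr_suml raddf_sum /=.
have muln2I (v v' : 'X_{1..n}) : (v *+ 2 = v' *+ 2)%MM -> v = v'.
  move=> E; apply/mnmP => i; have /mnmP/(_ i) := E.
  by rewrite !mulmnE !mulnS !muln0 !addn0 !addnn => /double_inj.
transitivity (\sum_(v <- msupp f) \sum_(v' <- msupp g)
    f@_v * g@_v' * ((v == u) && (v' == m))%:R).
  rewrite big_seq [RHS]big_seq; apply: eq_bigr => v vf.
  rewrite mulr_sumr raddf_sum /=; apply: eq_bigr => v' _.
  rewrite -scalerAl -scalerAr scalerA mcoeffZ -mpolyXD mcoeffX; congr (_ * _%:R).
  congr nat_of_bool; apply/eqP/andP => [E|[/eqP-> /eqP->] //].
  have vu := fP _ _ vf E; split; first exact/eqP.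
  by apply/eqP/muln2I/(@addmI _ u); rewrite -E vu.
have pick (h : P) k : \sum_(v <- msupp h) h@_v * (v == k)%:R = h@_k.
  rewrite {3}[h]mpolyE raddf_sum; apply: eq_bigr => v _ /=.
  by rewrite mcoeffZ mcoeffX.
rewrite -[in RHS](pick f) -[in RHS](pick g) mulr_suml; apply: eq_bigr => v _.
rewrite mulr_sumr; apply: eq_bigr => v' _.
by rewrite -mulnb natrM mulrACA.
Qed.

Lemma parity_split A B v v' m : (v + v' *+ 2 = mcol B + m *+ 2)%MM ->
  forall i, odd (v i) = nth false B i.
Proof.
move=> E i; have /mnmP/(_ i) := E.
rewrite mnmDE mulmnE [RHS]mnmDE mulmnE mcolE => /(congr1 odd).
by rewrite !oddD !oddM !andbF !addbF oddb.
Qed.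

Lemma mcol_inj A B : size A = n -> size B = n -> (mcol A == mcol B) = (A == B).
Proof.
move=> sA sB; apply/eqP/eqP => [E|-> //].
apply: (@eq_from_nth _ false); rewrite sA // => i lt_i.
have /mnmP/(_ (Ordinal lt_i)) := E; rewrite !mcolE /=.
by case: nth; case: nth.
Qed.

Lemma mcoeff_mon_sqr A B g m : size A = n -> size B = n ->
  (mon (@vars n) A * g ^+ 2)@_(mcol B + m *+ 2) = (A == B)%:R * g@_m.
Proof.
move=> sA sB; rewrite mon_vars // mcoeff_mul_sqr.
  by rewrite mcoeffX mcol_inj.
move=> v v'; rewrite msuppX inE => /eqP-> /(parity_split A) E.
apply/mnmP => i; rewrite !mcolE -E mcolE; by case: nth.
Qed.

(** The factor f has to supply all the odd exponents of the target, and its degree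
    leaves no room for anything else. *)
Lemma mcoeff_homog_sqr f A B g m : size B = n -> (weight A <= weight B)%N ->
  f \is (weight A).-homog ->
  (f * g ^+ 2)@_(mcol B + m *+ 2) = f@_(mcol B) * g@_m.
Proof.
move=> sB le_AB fA; apply: mcoeff_mul_sqr => v v' vf /(parity_split A) E.
have le_Bv i : (mcol B i <= v i)%N by rewrite mcolE -E; case: (v i) => [|k] //=; case: odd.
have: (mdeg v <= mdeg (mcol B))%N by rewrite (dhomogP _ _ _ fA v vf) mdeg_mcol.
rewrite !mdegE leqNgt => /negP vB; apply/mnmP => i; apply/eqP.
rewrite eqn_leq le_Bv andbT leqNgt; apply/negP => lt_i; case: vB.
by rewrite (bigD1 i) // [X in (_ < X)%N](bigD1 i) //= -addSn leq_add // leq_sum.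
Qed.

Lemma mcoeff_mulX u f m : ('X_[u] * f)@_m = if (u <= m)%MM then f@_(m - u) else 0.
Proof.
case: ifP => [le_um|lt_um].
  by rewrite -{1}(submK le_um) addmC mulrC mcoeffMX.
rewrite [f]mpolyE mulr_sumr raddf_sum big1 //= => v _.
rewrite -scalerAr mcoeffZ -mpolyXD mcoeffX.
case: eqP => [E|_]; last by rewrite mulr0.
by rewrite -E lem_addr in lt_um.
Qed.

Lemma subw_full U e t : size U = n -> full n e -> subw U e = Some t ->
  full n t /\ size t = size e.
Proof.
elim: e U t => [|B e IH] U t sU /=; first by case: ifP => // _ _ [<-].
case/andP=> /eqP sB fe; case: ifP => [_ [<-]|_]; first by rewrite /= sB eqxx fe.
case E: (subw _ _) => [t'|] // [<-] /=.
have [|-> ->] := IH _ _ _ fe E; first by rewrite size_diffc sU sB minnn.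
by rewrite size_xorc sU sB maxnn eqxx.
Qed.

Lemma mcol_nul A : nul A -> mcol A = 0%MM.
Proof.
move=> A0; apply/mnmP => i; rewrite mcolE mnm0E.
by elim: A (val i) A0 => [|[] A IH] [|k] //=; apply: IH.
Qed.

Lemma mcol_borrow A B : size A = n -> size B = n ->
  (mcol (xorc B A) + mcol A = mcol B + mcol (diffc A B) *+ 2)%MM.
Proof.
move=> sA sB; apply/mnmP => i; rewrite mnmDE [RHS]mnmDE mulmnE !mcolE.
have: (i < size A)%N /\ (i < size B)%N by rewrite sA sB ltn_ord.
elim: A B (val i) {sA sB} => [|a A IH] [|b B] [|k] /=; rewrite ?ltn0 ?ltnS; try by case.
  by case: a; case: b.
exact: IH.
Qed.

Lemma subw_Some U e t : size U = n -> full n e -> subw U e = Some t ->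
  mword e = (mcol U + mword t)%MM.
Proof.
elim: e U t => [|B e IH] U t sU /=.
  by case: ifP => // /mcol_nul-> _ [<-]; rewrite add0m.
case/andP=> /eqP sB fe; case: ifP => [/mcol_nul-> [<-]|_]; first by rewrite add0m.
case E: (subw _ _) => [t'|] // [<-] /=.
have sd : size (diffc U B) = n by rewrite size_diffc sU sB minnn.
have mD (x y : 'X_{1..n}) : ((x + y) *+ 2 = x *+ 2 + y *+ 2)%MM.
  by apply/mnmP => i; rewrite mulmnE mnmDE [RHS]mnmDE !mulmnE mulnDl.
by rewrite (IH _ _ sd fe E) mD [LHS]addmA -mcol_borrow // [RHS]addmA [in RHS](addmC (mcol U)).
Qed.

Lemma subw_None U e : size U = n -> full n e -> subw U e = None ->
  ~~ (mcol U <= mword e)%MM.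
Proof.
have nulP A : size A = n -> ~~ nul A -> exists i : 'I_n, nth false A i.
  move=> sA A0; suff [i lt_i Ai] : exists2 i, (i < size A)%N & nth false A i.
    by rewrite sA in lt_i; exists (Ordinal lt_i).
  elim: A {sA} A0 => [|[] A IH] //= => [_|/IH[i lt_i Ai]]; first by exists 0%N.
  by exists i.+1.
elim: e U => [|B e IH] U sU /=.
  case: ifP => // /negbT/(nulP _ sU)[i Ui] _ _.
  by apply/negP => /mnm_lepP/(_ i); rewrite mcolE Ui mnm0E.
case/andP=> /eqP sB fe; case: ifP => // _; case E: (subw _ _) => [|] // _.
have sd : size (diffc U B) = n by rewrite size_diffc sU sB minnn.
apply: contra (IH _ sd fe E) => /mnm_lepP le_U; apply/mnm_lepP => i.
have := le_U i; rewrite mnmDE mulmnE !mcolE.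
have: (i < size U)%N /\ (i < size B)%N by rewrite sU sB ltn_ord.
elim: U B (val i) {sU sB sd le_U E} => [|u U IHU] [|b B] [|k] /=; rewrite ?ltn0 ?ltnS; try by case.
  by case: u; case: b; case: (mword e i).
exact: IHU.
Qed.

Lemma mcoeff_mon_mul U f e : size U = n -> full n e ->
  (mon (@vars n) U * f)@_(mword e) = if subw U e is Some t then f@_(mword t) else 0.
Proof.
move=> sU fe; rewrite mon_vars // mcoeff_mulX; case E: (subw U e) => [t|].
  by rewrite (subw_Some sU fe E) lem_addr addmC addmK.
by rewrite (negbTE (subw_None sU fe E)).
Qed.

(** Summing all the squares gives a ring morphism, so that coefficients can be
    computed without keeping track of k. *)
Definition Sq_total (f : P) : P := (total_Sq f).[1].

(** On homogeneous polynomials the degree tells which square has contributed. *)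
Lemma mcoeff_Sq k d f m : f \is d.-homog -> mdeg m = (k + d)%N ->
  (Sq k f)@_m = (Sq_total f)@_m.
Proof.
move=> fd mE; rewrite /Sq_total horner_coef raddf_sum /=.
have Sq0 i : i != k -> (Sq i f)@_m = 0.
  move=> ne_ik; apply/eqP; rewrite mcoeff_eq0; apply/negP => /(dhomogP _ _ _ (Sq_homog i fd)) /=.
  by rewrite mE => /eqP; rewrite eqn_add2r eq_sym (negbTE ne_ik).
under eq_bigr => i _ do rewrite expr1n mulr1 -/(Sq i f).
have [lt_k|le_k] := ltnP k (size (total_Sq f)).
  by rewrite (bigD1 (Ordinal lt_k)) //= big1 ?addr0 // => i; apply: Sq0.
rewrite big1 => [|i _]; first by rewrite /Sq nth_default // mcoeff0.
by apply: Sq0; apply: contraTneq (ltn_ord i) => ->; rewrite -leqNgt.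
Qed.

Lemma Sq_total_mon_sqr A f : size A = n ->
  Sq_total (mon (@vars n) A * f ^+ 2) =
    \sum_(p <- splits A) mon (@vars n) p.2 * (mon (@vars n) p.1 * Sq_total f) ^+ 2.
Proof.
move=> sA; rewrite /Sq_total rmorphM rmorphXn /= hornerM horner_exp.
rewrite total_Sq_mon ?size_vars ?sA //; last exact: vars_linear.
rewrite horner_sum mulr_suml; apply: eq_bigr => p _.
by rewrite hornerZ hornerXn expr1n mulr1 exprMn -mulrA.
Qed.

(** The complement of U in A determines U. *)
Lemma sum_splits (V : nmodType) A B (F : column -> V) : size A = size B ->
  \sum_(p <- splits A) (if p.2 == B then F p.1 else 0) =
    if subc B A then F (diffc A B) else 0.
Proof.
elim: A B F => [|a A IH] [|b B] F //=; first by rewrite big_seq1.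
case=> sAB; case: a; rewrite ?big_cat ?big_map /=; last first.
  case: b; first by rewrite big1.
  by rewrite -(IH B (fun U => F (false :: U))).
case: b.
  rewrite addrC big1 // add0r.
  by rewrite -(IH B (fun U => F (false :: U))).
rewrite big1 // add0r.
by rewrite -(IH B (fun U => F (true :: U))).
Qed.

Lemma mcoeff_Sq_total b e : full n b -> full n e -> size b = size e ->
  (Sq_total (X b))@_(mword e) = (sqcoef b e)%:R.
Proof.
elim: b e => [|A b IH] [|B e] //=.
  by move=> _ _ _; rewrite /Sq_total rmorph1 hornerC mcoeff1 eqxx.
case/andP=> /eqP sA fb /andP[/eqP sB fe] [sbe].
rewrite Sq_total_mon_sqr // raddf_sum /=.
transitivity (\sum_(p <- splits A) if p.2 == B then
    (mon (@vars n) p.1 * Sq_total (X b))@_(mword e) else 0).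
  rewrite big_seq [RHS]big_seq; apply: eq_bigr => p /size_splits[_ s2].
  by rewrite mcoeff_mon_sqr ?s2 //; case: ifP; rewrite ?mul1r ?mul0r.
rewrite (sum_splits (fun U => (mon (@vars n) U * Sq_total (X b))@_(mword e))) ?sA //.
case: ifP => // _; have sd : size (diffc A B) = n by rewrite size_diffc sA sB minnn.
rewrite mcoeff_mon_mul //; case E: (subw _ _) => [t|] //.
by have [ft st] := subw_full sd fe E; rewrite IH // st.
Qed.

Lemma sourcesP b e L : full n b -> size b = L -> sqcoef b e -> b \in sources_aux n L e.
Proof.
elim: b e L => [|A b IH] [|B e] [|L] //=.
case/andP=> /eqP sA fb [sb]; case: ifP => // sBA; case E: (subw _ _) => [t|] // be.
apply/flatten_mapP; exists A; first exact: mem_columns.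
by rewrite sBA E map_f // IH.
Qed.

Lemma natr_parity (I : Type) (p : I -> bool) (r : seq I) :
  \sum_(i <- r) (p i)%:R = (parity p r)%:R :> 'F_2.
Proof.
elim: r => [|i r IH] /=; first by rewrite big_nil.
by rewrite big_cons IH; case: (p i); case: parity => //; apply: val_inj.
Qed.

Lemma unhittable_Sq L d E k f : (d < 2 ^ L)%N ->
    all (fun e => [&& full n e, size e == L & degw e == d]) E ->
    unhittable n L d E -> (0 < k)%N ->
  \sum_(e <- E) (Sq k f)@_(mword e) = 0.
Proof.
move=> lt_d EP unE k_gt0; rewrite [f]mpolyE raddf_sum /=.
under eq_bigr => e _ do rewrite raddf_sum /=.
rewrite exchange_big big1 //= => m _.
under eq_bigr => e _ do rewrite linearZ mcoeffZ.
rewrite -mulr_sumr; apply/eqP; rewrite mulf_eq0; apply/orP; right; apply/eqP.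
have hX : ('X_[m] : P) \is (mdeg m).-homog by rewrite dhomogX.
have degE e : e \in E -> [/\ full n e, size e = L & mdeg (mword e) = d].
  by move/(allP EP)/and3P=> [fe /eqP-> /eqP dE]; rewrite mdeg_mword.
(* In any other degree the coefficients vanish for lack of homogeneity. *)
have [kd|ne_kd] := eqVneq (k + mdeg m)%N d; last first.
  rewrite big_seq big1 // => e /degE[_ _ de]; apply/eqP; rewrite mcoeff_eq0.
  apply/negP => /(dhomogP _ _ _ (Sq_homog k hX)) /= /eqP.
  by rewrite de eq_sym (negbTE ne_kd).
have lt_m : (mdeg m < d)%N by rewrite -kd -[X in (X < _)%N]add0n ltn_add2r.
have [|w [fw sw dw] <-] := @mpolyX_word n L m; first exact: ltn_trans lt_d.
rewrite big_seq; under eq_bigr => e eE.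
  have [fe se de] := degE e eE.
  rewrite (mcoeff_Sq (evw_homog (full_wf fw))) ?dw ?de //.
  rewrite mcoeff_Sq_total // ?sw //.
  over.
rewrite -big_seq natr_parity.
suff -> : parity (sqcoef w) E = false by [].
apply/negP => odd_w; have [e eE we] : exists2 e, e \in E & sqcoef w e.
  apply/hasP; apply: contraLR odd_w => /hasPn noE.
  by elim: (E) noE => //= e r IHr noE; rewrite (negbTE (noE e _)) ?mem_head // IHr // => x xr; apply: noE; rewrite inE xr orbT.
have w_src : w \in flatten [seq sources_aux n L e | e <- E].
  by apply/flatten_mapP; exists e; rewrite ?sourcesP.
by have := allP unE w w_src; rewrite dw leqNgt lt_m odd_w.
Qed.
Lemma F2_cases (c : 'F_2) : c = 0 \/ c = 1.
Proof. by case: c => -[|[|//]] i; [left | right]; apply: val_inj. Qed.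

Lemma rmorph_mpoly_eq (S : nzRingType) (h k : {rmorphism P -> S}) :
  (forall i, h 'X_i = k 'X_i) -> h =1 k.
Proof.
move=> hk f; rewrite [f]mpolyE !rmorph_sum /=; apply: eq_bigr => m _.
rewrite -mul_mpolyC !rmorphM /=; congr (_ * _).
  by case: (F2_cases f@_m) => ->; rewrite ?mpolyC0 ?mpolyC1 ?rmorph0 ?rmorph1.
rewrite mpolyXE_id !rmorph_prod /=; apply: eq_bigr => i _.
by rewrite !rmorphXn hk.
Qed.

Definition lin (g : bitseq) : P := \sum_(i < n) (nth false g i)%:R *: 'X_i.

Lemma lin_homog (g : bitseq) : lin g \is 1.-homog.
Proof. by apply: rpred_sum => i _; rewrite rpredZ // dhomogX; apply/eqP/mdeg1. Qed.

(** In characteristic two x + x^2 T is additive in x. *)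
Lemma lin_linear (g : bitseq) : steenrod_linear (lin g).
Proof.
rewrite /lin; elim/big_rec: _ => [|i x _ xP]; rewrite /steenrod_linear.
  by rewrite rmorph0 expr0n /= scale0r addr0.
rewrite rmorphD /= xP sqrD2; last exact: char2_mpoly.
case: (nth _ _ _); last by rewrite scale0r rmorph0 expr0n /= !add0r.
rewrite !scale1r total_SqX polyCD scalerDl.
by rewrite addrACA.
Qed.

Definition substitution (G : seq bitseq) : P -> P :=
  mmap (@mpolyC n 'F_2) (fun i => lin (nth [::] G i)).

HB.instance Definition _ G := GRing.RMorphism.on (substitution G).

Lemma substitutionX G i : substitution G 'X_i = lin (nth [::] G i).
Proof. by rewrite /substitution mmapX mmap1U. Qed.

Lemma substitution_evw G w : size G = n ->
  substitution G (X w) = evw (map lin G) w.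
Proof.
move=> sG; rewrite rmorph_evw; congr evw; rewrite -map_comp.
rewrite -[in RHS](mkseq_nth [::] G) sG /mkseq -val_enum_ord -!map_comp.
by apply: eq_map => i /=; rewrite substitutionX.
Qed.

(** Linear forms behave as variables under the total square, and ring morphisms
    are determined by their values on the variables. *)
Lemma Sq_substitution G k f : Sq k (substitution G f) = substitution G (Sq k f).
Proof.
have h : @total_Sq n \o substitution G =1 map_poly (substitution G) \o @total_Sq n.
  apply: rmorph_mpoly_eq => i /=.
  rewrite substitutionX lin_linear total_SqX rmorphD /= map_polyC /=.
  by rewrite map_polyZ /= map_polyX rmorphXn /= substitutionX.
by rewrite /Sq [total_Sq _]h /= coef_map.
Qed.

Lemma substitutionZ G c f : substitution G (c *: f) = c *: substitution G f.
Proof. by rewrite /substitution mmapZ mul_mpolyC. Qed.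

Lemma big_picks (V : nmodType) (g B : column) (F : column -> V) : size B = n ->
  \sum_(t <- picks g B) F t =
    \sum_(i < n) if nth false g i && nth false B i then F (set_nth false B i false) else 0.
Proof.
move=> <-; elim: g B F => [|a g IH] [|b B] F /=; rewrite ?big_nil ?big_ord0 //.
  by rewrite big1 // => i _; rewrite nth_nil.
rewrite big_ord_recl /= -(IH B (fun t => F (b :: t))).
by case: a; case: b; rewrite ?big_cons ?big_map ?add0r.
Qed.

Lemma mcoeff_lin_mul (g : bitseq) f B : size B = n ->
  (lin g * f)@_(mcol B) = \sum_(t <- picks g B) f@_(mcol t).
Proof.
move=> sB; rewrite big_picks // mulr_suml raddf_sum; apply: eq_bigr => i _ /=.
rewrite -scalerAl mcoeffZ; case: (nth false g i); last by rewrite mul0r.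
rewrite mul1r mcoeff_mulX /=; case Bi : (nth false B i).
  have -> : mcol B = (U_(i) + mcol (set_nth false B i false))%MM.
    apply/mnmP => j; rewrite mnmDE mnm1E !mcolE nth_set_nth /= -val_eqE /= eq_sym.
    by case: eqP => [->|_]; rewrite ?Bi.
  by rewrite lem_addr addmC addmK.
rewrite (_ : (_ <= _)%MM = false) //; apply/negP => /mnm_lepP/(_ i).
by rewrite mnm1E eqxx mcolE Bi.
Qed.

Lemma size_picks (g : bitseq) B t : t \in picks g B -> size t = size B.
Proof.
elim: g B t => [|a g IH] [|b B] t //=.
have r u : u \in [seq b :: t | t <- picks g B] -> size u = (size B).+1.
  by case/mapP=> v /IH <- ->.
case: a; case: b r => r; rewrite ?inE; try exact: r.
by case/orP=> [/eqP->|/r].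
Qed.

Lemma mcoeff_minor G B A : size B = n -> size A = size G ->
  (mon (map lin G) A)@_(mcol B) = (minor G B A)%:R.
Proof.
elim: G B A => [|g G IH] B [|a A] //= sB.
  rewrite mcoeff1 (_ : (_ == _) = nul B) //; apply/eqP/idP => [E|/mcol_nul//].
  have {E} B0 i : nth false B i = false.
    have [lt_i|] := ltnP i (size B); last exact: nth_default.
    rewrite sB in lt_i; have /mnmP/(_ (Ordinal lt_i)) := E.
    by rewrite mcolE mnm0E /=; case: nth.
  by elim: B {sB} B0 => //= b B IHB B0; rewrite (B0 0%N : b = false); apply: IHB => i; apply: (B0 i.+1).
case=> sA; case: a; last by rewrite mul1r IH.
rewrite mcoeff_lin_mul // -natr_parity /parity.
rewrite big_seq [RHS]big_seq; apply: eq_bigr => t /size_picks st.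
by rewrite IH // st.
Qed.

(** The first column of w is replaced by a product of linear forms, whose
    coefficient at the first column of e is a minor; the rest is a square. *)
Lemma mcoeff_substitution G e w : size G = n -> full n e -> full n w -> tame e w ->
  (substitution G (X w))@_(mword e) = (minors G e w)%:R.
Proof.
move=> sG + fw; rewrite substitution_evw //.
elim: w e fw => [|A w IH] [|B e] //=; first by rewrite mcoeff1 eqxx.
case/andP=> /eqP sA fw /andP[/eqP sB fe] tm.
have homA : mon (map lin G) A \is (weight A).-homog.
  apply: mon_homog; last by rewrite size_map sA sG.
  by move=> _ /mapP[g _ ->]; apply: lin_homog.
have le_AB : (weight A <= weight B)%N by move: tm; case: ltngtP.
rewrite (mcoeff_homog_sqr _ _ sB le_AB homA) mcoeff_minor ?sA ?sG //.
move: tm; case: ltngtP le_AB => // [lt_AB|eqAB] _ tm.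
  have: (mon (map lin G) A)@_(mcol B) = 0.
    apply/eqP; rewrite mcoeff_eq0; apply/negP => /(dhomogP _ _ _ homA) /= /eqP.
    by rewrite mdeg_mcol // gtn_eqF.
  by rewrite mcoeff_minor ?sA ?sG //; case: minor; rewrite // mul0r.
by rewrite IH //; case: minor; rewrite ?mul1r ?mul0r.
Qed.

End Coefficients.
(** * Independence by Gaussian elimination *)

Local Open Scope nat_scope.

(** Values of minors are tabulated, since each is used for many tests. *)
Inductive table := Value of bool | Branch of table & table.

Fixpoint tabulate n (p : column -> bool) : table :=
  if n is n'.+1 then
    Branch (tabulate n' (fun A => p (true :: A))) (tabulate n' (fun A => p (false :: A)))
  else Value (p [::]).

Fixpoint read (t : table) (A : column) : bool :=
  match t, A with
  | Value b, _ => b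
  | Branch l r, a :: A' => read (if a then l else r) A'
  | Branch _ _, [::] => false
  end.

Fixpoint read_word (ts : seq table) (w : word) : bool :=
  match ts, w with
  | t :: ts', A :: w' => if read t A then read_word ts' w' else false
  | _, _ => true
  end.

Definition tables n (E : seq word) (G : seq bitseq) : seq (seq table) :=
  [seq [seq tabulate n (minor G B) | B <- e] | e <- E].

Definition tables_value (T : seq (seq table)) (p : seq word) : bool :=
  parity (fun w => parity (fun ts => read_word ts w) T) p.

Definition value (E : seq word) (G : seq bitseq) (p : seq word) : bool :=
  parity (fun w => parity (fun e => minors G e w) E) p.

Fixpoint xor_row (s t : bitseq) : bitseq :=
  match s, t with
  | a :: s', b :: t' => (if a then ~~ b else b) :: xor_row s' t'
  | _, _ => [::]
  end.

Fixpoint pivot (rows : seq bitseq) : option (bitseq * seq bitseq) :=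
  if rows is r :: rows' then
    if head false r then Some (behead r, rows') else
    if pivot rows' is Some (p, q) then Some (p, r :: q) else None
  else None.

(** Gaussian elimination modulo two on k columns, one column at a time: a row with
    a leading one is removed and added to the others that have one. *)
Fixpoint row_rank (k : nat) (rows : seq bitseq) : nat :=
  if k is k'.+1 then
    if pivot rows is Some (p, q) then
      (row_rank k' [seq if head false r then xor_row (behead r) p else behead r
                   | r <- q]).+1
    else row_rank k' [seq behead r | r <- rows]
  else 0.

(** The functionals of a block share the set of target monomials and differ by the
    substitutions; a test is a sum of words. *)
Record block := Block {
  patterns : seq word;
  substitutions : seq (seq bitseq);
  tests : seq (seq word)
}.

Definition block_rank n (b : block) : nat :=
  row_rank (size (tests b))
    [seq [seq tables_value T p | p <- tests b]
    | T <- [seq tables n (patterns b) G | G <- substitutions b]].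

(** The tests of the earlier blocks are accumulated in old. *)
Fixpoint blocks_ok (n L d : nat) (old : seq (seq word)) (bs : seq block) : bool :=
  if bs is b :: bs' then
    let new := tests b ++ old in
    [&& all (fun e => [&& full n e, size e == L & degw e == d]) (patterns b),
        unhittable n L d (patterns b),
        all (fun G => size G == n) (substitutions b),
        all (all (fun w => [&& full n w, degw w == d & all (fun e => tame e w) (patterns b)])) new,
        all (fun T => all (fun p => ~~ tables_value T p) old)
            [seq tables n (patterns b) G | G <- substitutions b] &
        blocks_ok n L d new bs']
  else true.

Lemma read_tabulate n p A : size A = n -> read (tabulate n p) A = p A.
Proof. by elim: A n p => [|[] A IH] [|n] p //= [/IH->]. Qed.

Lemma read_word_minors n G e w : full n w ->
  read_word [seq tabulate n (minor G B) | B <- e] w = minors G e w.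
Proof.
elim: e w => [|B e IH] [|A w] //= /andP[/eqP sA fw].
by rewrite read_tabulate // IH.
Qed.

Lemma tables_valueE n E G p : all (full n) p -> tables_value (tables n E G) p = value E G p.
Proof.
rewrite /tables_value /value; elim: p => //= w p IH /andP[fw /IH->].
congr (if _ then _ else _); elim: E {IH} => //= e E IH.
by rewrite read_word_minors // IH.
Qed.

Local Open Scope ring_scope.

Lemma pivotP (I : eqType) (row : I -> bitseq) (fs : seq I) p q :
  pivot (map row fs) = Some (p, q) ->
  exists2 f, f \in fs & row f = true :: p /\
    exists2 fs', {subset fs' <= fs} & q = map row fs'.
Proof.
elim: fs p q => //= f fs IH p q; case E: (row f) => [|[] r] /=; last 1 first.
- case: pivot IH => [[p' q']|] // IH [<- <-].
  have [g g_fs [gE [fs' sub ->]]] := IH _ _ (erefl _).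
  exists g; first by rewrite inE g_fs orbT.
  split=> //; exists (f :: fs') => [h|]; rewrite /= ?E //.
  by rewrite !inE => /orP[->|/sub->]; rewrite ?orbT.
- case: pivot IH => [[p' q']|] // IH [<- <-].
  have [g g_fs [gE [fs' sub ->]]] := IH _ _ (erefl _).
  exists g; first by rewrite inE g_fs orbT.
  split=> //; exists (f :: fs') => [h|]; rewrite /= ?E //.
  by rewrite !inE => /orP[->|/sub->]; rewrite ?orbT.
case=> <- <-; exists f; rewrite ?mem_head // E; split=> //.
by exists fs => // g; rewrite inE => ->; rewrite orbT.
Qed.

Definition values (V : vectType 'F_2) (ts : seq V) (f : 'Hom(V, ('F_2)^o)) : bitseq :=
  [seq f t != 0 | t <- ts].

(** Each pivot is a functional that vanishes on U and not on the next vector t.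
    The reduced functionals vanish on U and t, and t has enlarged U by one
    dimension. *)
Lemma row_rank_le (V : vectType 'F_2) (U : {vspace V}) (fs : seq 'Hom(V, ('F_2)^o)) (ts : seq V) :
    (forall f v, f \in fs -> v \in U -> f v = 0) ->
  (\dim U + row_rank (size ts) (map (values ts) fs)
     <= \dim (U + <<ts>>))%N.
Proof.
elim: ts U fs => [|t ts IH] U fs fsU /=; first by rewrite addn0 dimvS ?addvSl.
case E: pivot => [[p q]|]; last first.
  rewrite -map_comp; apply: leq_trans (IH U fs fsU) _.
  by rewrite dimvS // span_cons addvS // addvSr.
have [f f_fs [[ft pE] [fs' sub ->]]] := pivotP E.
have t_U : t \notin U by apply: contraL ft => tU; rewrite (fsU f t f_fs tU) eqxx.
(* This is the row operation performed by row_rank. *)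
pose reduce (g : 'Hom(V, ('F_2)^o)) := if g t != 0 then g + f else g.
have -> : [seq if head false r then xor_row (behead r) p else behead r
          | r <- map (values (t :: ts)) fs'] = map (values ts) (map reduce fs').
  rewrite -!map_comp; apply: eq_map => g /=; rewrite /reduce -pE.
  case: ifP => // _; elim: (ts) => //= u us ->; congr (_ :: _).
  rewrite add_lfunE; case: (F2_cases (g u)) => ->; case: (F2_cases (f u)) => -> //=.
rewrite addnS -addSn span_cons addvA.
have -> : (\dim U).+1 = \dim (U + <[t]>).
  rewrite dimv_disjoint_sum ?dim_vline; last first.
    apply/eqP; rewrite -subv0; apply/subvP => v; rewrite memv_cap => /andP[vU].
    case/vlineP=> c vE; rewrite {v}vE in vU *; case: (F2_cases c) vU => ->.
      by rewrite scale0r memv0.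
    by rewrite scale1r (negbTE t_U).
  by rewrite (_ : t != 0) ?addn1 //; apply: contraNneq t_U => ->; apply: mem0v.
apply: IH => _ v /mapP[g /sub g_fs ->] /memv_addP[u uU [_ /vlineP[c ->] ->]].
rewrite linearD linearZ /= /reduce.
have [gt0|gt1] := F2_cases (g t).
  by rewrite gt0 eqxx /= gt0 scaler0 addr0 (fsU g).
have f1 : f t = 1 by case: (F2_cases (f t)) ft => ->; rewrite ?eqxx.
rewrite gt1 /= !add_lfunE (fsU g) // (fsU f) // gt1 f1 addr0 add0r.
by rewrite (_ : 1 + 1 = 0) ?scaler0 //; apply: val_inj.
Qed.

(** * Independent functionals bound the quotient from below *)

Section LowerBound.

Variables (n L d : nat).
Hypothesis lt_d : (d < 2 ^ L)%N.
Local Notation V := (dhomog n.+1 'F_2 d).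
Local Notation P := {mpoly 'F_2[n.+1]}.
Local Notation Xs := (evs (@vars n.+1)).

Definition pairing E G (f : P) : 'F_2 := \sum_(e <- E) (substitution G f)@_(mword n.+1 e).

Definition form_fun E G (v : V) : ('F_2)^o := pairing E G (val v).

Lemma form_fun_linear E G : linear (form_fun E G).
Proof.
move=> c u v; rewrite /form_fun /pairing scaler_sumr -big_split; apply: eq_bigr => e _ /=.
by rewrite raddfD /= substitutionZ mcoeffD mcoeffZ.
Qed.

HB.instance Definition _ E G :=
  GRing.isLinear.Build 'F_2 V ('F_2)^o _ (form_fun E G) (form_fun_linear E G).

Definition form E G : 'Hom(V, ('F_2)^o) := linfun (form_fun E G).

Lemma pairing_hit E G f :
    all (fun e => [&& full n.+1 e, size e == L & degw e == d]) E ->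
    unhittable n.+1 L d E -> hit f ->
  pairing E G f = 0.
Proof.
move=> EP unE [s sP ->]; rewrite /pairing (rmorph_sum (substitution G)).
under eq_bigr => e _ do rewrite (raddf_sum (mcoeff _)).
rewrite exchange_big big_seq big1 //= => -[w g] /(allP sP) /= w_gt0.
have [k [h k_gt0 ->]] := Sq_seq_gt0 g w_gt0.
under eq_bigr => e _ do rewrite -Sq_substitution.
exact: unhittable_Sq lt_d EP unE k_gt0.
Qed.

Lemma pairing_evs E G p : size G = n.+1 -> all (full n.+1) E ->
    all (fun w => full n.+1 w && all (fun e => tame e w) E) p ->
  pairing E G (Xs p) = (value E G p)%:R.
Proof.
move=> sG fE pP; rewrite /pairing /value -natr_parity /evs (rmorph_sum (substitution G)).
under eq_bigr => e _ do rewrite (raddf_sum (mcoeff _)).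
rewrite exchange_big big_seq [RHS]big_seq; apply: eq_bigr => w /(allP pP)/andP[fw tm].
rewrite -natr_parity big_seq [RHS]big_seq; apply: eq_bigr => e e_E /=.
by rewrite mcoeff_substitution // ?(allP fE) ?(allP tm).
Qed.

Definition test_vector p : V := indhomog d (Xs p).

Lemma test_vectorE p : all (fun w => full n.+1 w && (degw w == d)) p ->
  val (test_vector p) = Xs p.
Proof.
move=> pP; have Xp : Xs p \is d.-homog.
  rewrite /evs big_seq; apply: rpred_sum => w /(allP pP)/andP[fw /eqP <-].
  exact/evw_homog/full_wf.
by rewrite /test_vector /indhomog insubdK.
Qed.

Lemma form_test E G p : size G = n.+1 -> all (full n.+1) E ->
    all (fun w => [&& full n.+1 w, degw w == d & all (fun e => tame e w) E]) p ->
  form E G (test_vector p) = (value E G p)%:R.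
Proof.
move=> sG fE pP; rewrite lfunE /= /form_fun test_vectorE; last first.
  by apply: sub_all pP => w /and3P[-> ->].
by rewrite pairing_evs //; apply: sub_all pP => w /and3P[-> _ ->].
Qed.

(** The functionals of a block vanish on hit polynomials and on the earlier tests,
    so its own tests enlarge the span by at least the rank of the block. *)
Lemma blocks_rank_le (old : seq (seq word)) bs : blocks_ok n.+1 L d old bs ->
  (\dim ((hits : {vspace V}) + <<map test_vector old>>) + sumn (map (block_rank n.+1) bs)
     <= \dim {: V})%N.
Proof.
elim: bs old => [|b bs IH] old /=; first by rewrite addn0 dimvS ?subvf.
case/and5P=> EP unE /allP sG /allP newP /andP[+ /IH].
rewrite all_map => /allP vanish; apply: leq_trans.
have fE : all (full n.+1) (patterns b) by apply: sub_all EP => e /and3P[].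
have fullp p : p \in tests b ++ old -> all (full n.+1) p.
  by move/newP; apply: sub_all => w /and3P[].
rewrite addnA leq_add2r map_cat span_cat [(<<map _ (tests b)>> + _)%VS]addvC addvA.
have -> : block_rank n.+1 b = row_rank (size (map test_vector (tests b)))
    [seq values (map test_vector (tests b)) f
    | f <- [seq form (patterns b) G | G <- substitutions b]].
  rewrite /block_rank size_map -!map_comp; congr row_rank.
  apply/eq_in_map => G /sG/eqP sz /=; rewrite /values -map_comp; apply/eq_in_map => p p_in /=.
  have p_new : p \in tests b ++ old by rewrite mem_cat p_in.
  rewrite form_test ?newP // tables_valueE ?fullp //.
  by case: value.
apply: row_rank_le => _ v /mapP[G G_b ->] /memv_addP[h h_hit [o o_old ->]].
have sz := eqP (sG G G_b); rewrite linearD /=.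
have -> : form (patterns b) G h = 0.
  by rewrite lfunE /=; apply: pairing_hit => //; apply/hitsP.
rewrite add0r; apply/eqP; rewrite -memv_ker; apply: subvP o_old.
apply/span_subvP => _ /mapP[p p_old ->]; rewrite memv_ker.
have p_new : p \in tests b ++ old by rewrite mem_cat p_old orbT.
rewrite form_test ?newP //.
have /allP/(_ p p_old) := vanish G G_b.
by rewrite tables_valueE ?fullp // => /negbTE->.
Qed.

Lemma dim_quotient_ge bs : blocks_ok n.+1 L d [::] bs ->
  (sumn (map (block_rank n.+1) bs) <= \dim {: quotv (hits : {vspace V})})%N.
Proof.
move/blocks_rank_le; rewrite span_nil addv0 dim_quotv => le_dim.
by rewrite leq_subRL // (leq_trans (leq_addr _ _) le_dim).
Qed.

End LowerBound.
(** * Reductions in five variables and degree 62 *)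

Local Open Scope nat_scope.

Fixpoint bits_of_pos (p : positive) : bitseq :=
  match p with
  | xH => [:: true]
  | xO q => false :: bits_of_pos q
  | xI q => true :: bits_of_pos q
  end.

(** Words are written as numerals with one byte for each column, the first column
    in the lowest byte and the variable of index i in bit i. *)
Fixpoint columns_of_bits (k : nat) (s : bitseq) : word :=
  if k is k'.+1 then
    if s is [::] then [::] else
    take 5 (s ++ nseq 5 false) :: columns_of_bits k' (drop 8 s)
  else [::].

Definition decode (x : N) : word :=
  if x is Npos p then columns_of_bits 8 (bits_of_pos p) else [::].

(** Each entry is a window followed by the monomials h of its reduction.  The
    reductions were found by linear algebra on the squares of monomials. *)
Definition certificates : seq (N * seq N) := [::
  (0x100, [:: 0x1]); (0x200, [:: 0x2]); (0x400, [:: 0x4]); (0x700, [:: 0x304]); (0x800, [:: 0x8]);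
  (0xb00, [:: 0x308]); (0xd00, [:: 0x508]); (0xe00, [:: 0x608]); (0x1000, [:: 0x10]); (0x1300, [::
  0x310]); (0x1500, [:: 0x510]); (0x1600, [:: 0x610]); (0x1900, [:: 0x910]); (0x1a00, [:: 0xa10]);
  (0x1c00, [:: 0xc10]); (0x1f00, [:: 0xf10]); (0x301, [:: 0x103]); (0x501, [:: 0x105]); (0x601,
  [:: 0x7; 0x403; 0x205]); (0x901, [:: 0x109]); (0xa01, [:: 0xb; 0x803; 0x209]); (0xc01, [:: 0xd;
  0x805; 0x409]); (0xf01, [:: 0x709]); (0x1101, [:: 0x111]); (0x1201, [:: 0x13; 0x1003; 0x211]);
  (0x1401, [:: 0x15; 0x1005; 0x411]); (0x1701, [:: 0x711]); (0x1801, [:: 0x19; 0x1009; 0x811]);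
  (0x1b01, [:: 0xb11]); (0x1d01, [:: 0xd11]); (0x302, [:: 0x203]); (0x502, [:: 0x403]); (0x602,
  [:: 0x206]); (0x902, [:: 0x803]); (0xa02, [:: 0x20a]); (0xc02, [:: 0xe; 0x806; 0x40a]); (0xf02,
  [:: 0x70a]); (0x1102, [:: 0x1003]); (0x1202, [:: 0x212]); (0x1402, [:: 0x16; 0x1006; 0x412]);
  (0x1702, [:: 0x712]); (0x1802, [:: 0x1a; 0x100a; 0x812]); (0x1b02, [:: 0xb12]); (0x1d02, [::
  0x1c03]); (0x1e02, [:: 0xe12]); (0xf03, [:: 0x70b]); (0x1703, [:: 0x713]); (0x1b03, [:: 0xb13]);
  (0x304, [:: 0x205]); (0x504, [:: 0x405]); (0x604, [:: 0x406]); (0x904, [:: 0x805]); (0xa04, [::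
  0x806]); (0xc04, [:: 0x40c]); (0xf04, [:: 0x70c]); (0x1104, [:: 0x1005]); (0x1204, [:: 0x1006]);
  (0x1404, [:: 0x414]); (0x1704, [:: 0x714]); (0x1804, [:: 0x1c; 0x100c; 0x814]); (0x1b04, [::
  0x1a05]); (0x1d04, [:: 0xd14]); (0x1e04, [:: 0xe14]); (0x305, [:: 0x107]); (0xf05, [:: 0x70d]);
  (0x1705, [:: 0x715]); (0x1b05, [:: 0x1907]); (0x1d05, [:: 0xd15]); (0x306, [:: 0x207]); (0x506,
  [:: 0x407]); (0x906, [:: 0x807]); (0xf06, [:: 0x70e]); (0x1106, [:: 0x1007]); (0x1706, [::
  0x716]); (0x1b06, [:: 0x1a07]); (0x1d06, [:: 0x1c07]); (0x1e06, [:: 0xe16]); (0x1f07, [::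
  0xf17]); (0x308, [:: 0x209]); (0x508, [:: 0x409]); (0x608, [:: 0x40a]); (0x908, [:: 0x809]);
  (0xa08, [:: 0x80a]); (0xc08, [:: 0x80c]); (0xf08, [:: 0xb0c]); (0x1108, [:: 0x1009]); (0x1208,
  [:: 0x100a]); (0x1408, [:: 0x100c]); (0x1708, [:: 0x1609]); (0x1808, [:: 0x818]); (0x1b08, [::
  0xb18]); (0x1d08, [:: 0xd18]); (0x1e08, [:: 0xe18]); (0x309, [:: 0x10b]); (0x509, [:: 0x10d]);
  (0x609, [:: 0xf; 0x40b; 0x20d]); (0xf09, [:: 0xb0d]); (0x1709, [:: 0x150b]); (0x1b09, [::
  0xb19]); (0x1d09, [:: 0xd19]); (0x30a, [:: 0x20b]); (0x50a, [:: 0x40b]); (0x60a, [:: 0x20e]);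
  (0x90a, [:: 0x80b]); (0xf0a, [:: 0xb0e]); (0x110a, [:: 0x100b]); (0x170a, [:: 0x160b]); (0x1b0a,
  [:: 0xb1a]); (0x1d0a, [:: 0x1c0b]); (0x1e0a, [:: 0xe1a]); (0x70b, [:: 0x30f]); (0x1f0b, [::
  0xf1b]); (0x30c, [:: 0x20d]); (0x50c, [:: 0x40d]); (0x60c, [:: 0x40e]); (0x90c, [:: 0x80d]);
  (0xa0c, [:: 0x80e]); (0xf0c, [:: 0xd0e]); (0x110c, [:: 0x100d]); (0x120c, [:: 0x100e]); (0x170c,
  [:: 0x160d]); (0x1b0c, [:: 0x1a0d]); (0x1d0c, [:: 0xd1c]); (0x1e0c, [:: 0xe1c]); (0x70d, [::
  0x50f]); (0xb0d, [:: 0x90f]); (0x130d, [:: 0x110f]); (0x1f0d, [:: 0xf1d]); (0x10e, [:: 0xf]);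
  (0x70e, [:: 0x60f]); (0xb0e, [:: 0xa0f]); (0xd0e, [:: 0xc0f]); (0x130e, [:: 0x120f]); (0x150e,
  [:: 0x140f]); (0x190e, [:: 0x180f]); (0x1f0e, [:: 0xf1e]); (0x1f0f, [:: 0xf1f]); (0x310, [::
  0x211]); (0x510, [:: 0x411]); (0x610, [:: 0x412]); (0x910, [:: 0x811]); (0xa10, [:: 0x812]);
  (0xc10, [:: 0x814]); (0xf10, [:: 0xe11]); (0x1110, [:: 0x1011]); (0x1210, [:: 0x1012]); (0x1410,
  [:: 0x1014]); (0x1710, [:: 0x1314]); (0x1810, [:: 0x1018]); (0x1b10, [:: 0x1318]); (0x1d10, [::
  0x1518]); (0x1e10, [:: 0x1618]); (0x311, [:: 0x113]); (0x511, [:: 0x115]); (0x611, [:: 0x17;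
  0x413; 0x215]); (0x911, [:: 0x119]); (0xa11, [:: 0x1b; 0x813; 0x219]); (0xc11, [:: 0x1d; 0x815;
  0x419]); (0xf11, [:: 0xd13]); (0x1711, [:: 0x1315]); (0x1b11, [:: 0x1319]); (0x1d11, [::
  0x1519]); (0x312, [:: 0x213]); (0x512, [:: 0x413]); (0x612, [:: 0x216]); (0x912, [:: 0x813]);
  (0xa12, [:: 0x21a]); (0xc12, [:: 0x1e; 0x816; 0x41a]); (0xf12, [:: 0xe13]); (0x1112, [::
  0x1013]); (0x1712, [:: 0x1316]); (0x1b12, [:: 0x131a]); (0x1d12, [:: 0x1c13]); (0x1e12, [::
  0x161a]); (0x713, [:: 0x317]); (0xb13, [:: 0x31b]); (0x1f13, [:: 0x171b]); (0x314, [:: 0x215]);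
  (0x514, [:: 0x415]); (0x614, [:: 0x416]); (0x914, [:: 0x815]); (0xa14, [:: 0x816]); (0xc14, [::
  0x41c]); (0xf14, [:: 0xe15]); (0x1114, [:: 0x1015]); (0x1214, [:: 0x1016]); (0x1714, [::
  0x1516]); (0x1b14, [:: 0x1a15]); (0x1d14, [:: 0x151c]); (0x1e14, [:: 0x161c]); (0x715, [::
  0x517]); (0xb15, [:: 0x917]); (0xd15, [:: 0x51d]); (0x1315, [:: 0x1117]); (0x1f15, [:: 0x171d]);
  (0x116, [:: 0x17]); (0x716, [:: 0x617]); (0xb16, [:: 0xa17]); (0xd16, [:: 0xc17]); (0xe16, [::
  0x61e]); (0x1316, [:: 0x1217]); (0x1516, [:: 0x1417]); (0x1916, [:: 0x1817]); (0x1f16, [::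
  0x171e]); (0x1f17, [:: 0x171f]); (0x318, [:: 0x219]); (0x518, [:: 0x419]); (0x618, [:: 0x41a]);
  (0x918, [:: 0x819]); (0xa18, [:: 0x81a]); (0xc18, [:: 0x81c]); (0xf18, [:: 0xe19]); (0x1118, [::
  0x1019]); (0x1218, [:: 0x101a]); (0x1418, [:: 0x101c]); (0x1718, [:: 0x1619]); (0x1b18, [::
  0x191a]); (0x1d18, [:: 0x191c]); (0x1e18, [:: 0x1a1c]); (0x719, [:: 0x51b]); (0xb19, [::
  0x91b]); (0xd19, [:: 0x91d]); (0x1319, [:: 0x111b]); (0x1519, [:: 0x111d]); (0x1f19, [::
  0x1b1d]); (0x11a, [:: 0x1b]); (0x71a, [:: 0x61b]); (0xb1a, [:: 0xa1b]); (0xd1a, [:: 0xc1b]);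
  (0xe1a, [:: 0xa1e]); (0x131a, [:: 0x121b]); (0x151a, [:: 0x141b]); (0x161a, [:: 0x121e]);
  (0x191a, [:: 0x181b]); (0x1f1a, [:: 0x1b1e]); (0x71b, [:: 0x31f]); (0x1f1b, [:: 0x1b1f]);
  (0x11c, [:: 0x1d]); (0x21c, [:: 0x1e]); (0x71c, [:: 0x61d]); (0xb1c, [:: 0xa1d]); (0xd1c, [::
  0xc1d]); (0xe1c, [:: 0xc1e]); (0x131c, [:: 0x121d]); (0x151c, [:: 0x141d]); (0x161c, [::
  0x141e]); (0x191c, [:: 0x181d]); (0x1a1c, [:: 0x181e]); (0x1f1c, [:: 0x1d1e]); (0x71d, [::
  0x51f]); (0xb1d, [:: 0x91f]); (0x131d, [:: 0x111f]); (0x1f1d, [:: 0x1d1f]); (0x11e, [:: 0x1f]);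
  (0x71e, [:: 0x61f]); (0xb1e, [:: 0xa1f]); (0xd1e, [:: 0xc1f]); (0x131e, [:: 0x121f]); (0x151e,
  [:: 0x141f]); (0x191e, [:: 0x181f]); (0x1f1e, [:: 0x1e1f]); (0x1d0303, [:: 0x190703; 0x1b0107;
  0xb1305]); (0x1e0303, [:: 0x1a0703; 0x1b0207; 0xb1306]); (0x50503, [:: 0x50107; 0x10705;
  0x10707]); (0x1e0503, [:: 0x160d03; 0x17040b; 0x71609; 0x7150a]); (0x60603, [:: 0x60207;
  0x20706; 0x20707]); (0x90903, [:: 0x9010b; 0x10b09; 0x10b0b]); (0x1e0903, [:: 0x1a0d03;
  0x1b0807; 0xb1a05; 0xb1906]); (0xa0a03, [:: 0xa020b; 0x20b0a; 0x20b0b]); (0x111103, [::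
  0x110113; 0x11311; 0x11313]); (0x1e1103, [:: 0x1a1503; 0x1b1007; 0x131a05; 0x131906]);
  (0x121203, [:: 0x120213; 0x21312; 0x21313]); (0xd1d03, [:: 0x91d07; 0x91f05; 0xb150d]);
  (0x151d03, [:: 0x111d07; 0x111f05; 0x130d15]); (0x191d03, [:: 0x111d0b; 0x111f09; 0x130d19]);
  (0xe1e03, [:: 0xa1e07; 0xa1f06; 0xb0e16]); (0x161e03, [:: 0x121e07; 0x121f06; 0x130e16]);
  (0x1a1e03, [:: 0xa1e13; 0xa1f12; 0xb161a]); (0x1e0505, [:: 0x1c0705; 0x1d0407; 0xd1506]);
  (0x60605, [:: 0x60407; 0x40706; 0x40707]); (0xa0605, [:: 0x80607; 0x80706; 0x80707]); (0x120605,
  [:: 0x100607; 0x100706; 0x100707]); (0x90905, [:: 0x9010d; 0x10d09; 0x10d0d]); (0xa0905, [::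
  0xc0f; 0x80e05; 0x40e09; 0x20c0d; 0xc010e; 0x20d0c; 0xc010b; 0xf09; 0xa010d; 0x20d0d; 0x10e09]);
  (0x1e0905, [:: 0x1c0b05; 0x1d0807; 0xd1906]); (0xa0a05, [:: 0xa000f; 0xa040b; 0x80b06; 0x20b0c;
  0xc010b; 0xf09; 0x40b0b; 0xa010d; 0x10a0e; 0x10e0a; 0x10e09]); (0xc0c05, [:: 0xc040d; 0x40d0c;
  0x40d0d]); (0x111105, [:: 0x110115; 0x11511; 0x11515]); (0x121105, [:: 0x1417; 0x140215;
  0x101506; 0x41512; 0x140113; 0x1711; 0x120115; 0x21515; 0x110416; 0x51016; 0x11614; 0x11611]);
  (0x1e1105, [:: 0x1c1305; 0x1d1007; 0x151906]); (0x121205, [:: 0x1217; 0x140213; 0x61013;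
  0x21611; 0x41312; 0x120116; 0x140113; 0x1711; 0x41313; 0x120115; 0x11611]); (0x141405, [::
  0x140415; 0x41514; 0x41515]); (0x21e05, [:: 0x41a07; 0x21c07; 0x10070e; 0x1f06; 0x80716;
  0x10e16]); (0xe1e05, [:: 0x61e0d; 0x61f0c; 0x70e1c]); (0x161e05, [:: 0x141e07; 0x141f06;
  0x150e16]); (0x1a1e05, [:: 0x181e07; 0x181f06; 0x190e16]); (0x1c1e05, [:: 0x141e0d; 0x141f0c;
  0x151c0e]); (0xa0a06, [:: 0xa020e; 0x20e0a; 0x20e0e]); (0xc0c06, [:: 0xc040e; 0x40e0c;
  0x40e0e]); (0x121206, [:: 0x120216; 0x21612; 0x21616]); (0x141406, [:: 0x140416; 0x41614;
  0x41616]); (0x1e0107, [:: 0x160907; 0x17000f; 0x7140b; 0x7120d; 0x7110e]); (0xb0b07, [::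
  0xb030f; 0x30f0b; 0x30f0f]); (0xd0d07, [:: 0xd050f; 0x50f0d; 0x50f0f]); (0xe0e07, [:: 0xe060f;
  0x60f0e; 0x60f0f]); (0xd1307, [:: 0x11f07; 0x31d07; 0x100170f]); (0xe1307, [:: 0x21f07;
  0x2000f17; 0x31e07]); (0x131307, [:: 0x130317; 0x31713; 0x31717]); (0xe1507, [:: 0x41f07;
  0x4000f17; 0x51e07]); (0x151507, [:: 0x150517; 0x51715; 0x51717]); (0x161607, [:: 0x160617;
  0x61716; 0x61717]); (0xe1907, [:: 0x81f07; 0x8000f17; 0x91e07]); (0x161907, [:: 0x101f07;
  0x10000f17; 0x111e07]); (0x1e0909, [:: 0x1c0b09; 0x1d080b; 0xd190a]); (0xa0a09, [:: 0xa080b;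
  0x80b0a; 0x80b0b]); (0x120a09, [:: 0x100a0b; 0x100b0a; 0x100b0b]); (0xc0c09, [:: 0xc080d;
  0x80d0c; 0x80d0d]); (0x140c09, [:: 0x100c0d; 0x100d0c; 0x100d0d]); (0x111109, [:: 0x110119;
  0x11911; 0x11919]); (0x121109, [:: 0x181b; 0x101a09; 0x81a11; 0x21819; 0x18011a; 0x21918;
  0x180113; 0x1b11; 0x120119; 0x21919; 0x11a11]); (0x141109, [:: 0x18001d; 0x180419; 0x10190c;
  0x81914; 0x180115; 0x1d11; 0x140119; 0x41919; 0x11081c; 0x9101c; 0x11c18; 0x11c11]); (0x1e1109,
  [:: 0x1c1309; 0x1d100b; 0x15190a]); (0x121209, [:: 0x81213; 0x12001b; 0x21a11; 0x81312;
  0x12011a; 0x180113; 0x1b11; 0x81313; 0x120119; 0x11a11]); (0x141409, [:: 0x141d; 0x180415;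
  0xc1015; 0x41c11; 0x81514; 0x14011c; 0x180115; 0x1d11; 0x81515; 0x140119; 0x11c11]); (0x181809,
  [:: 0x180819; 0x81918; 0x81919]); (0x21e09, [:: 0x8160b; 0x21c0b; 0x100b0e; 0x1f0a; 0x40b1a;
  0x10e1a]); (0x41e09, [:: 0x8160d; 0x41a0d; 0x100d0e; 0x1f0c; 0x20d1c; 0x10e1c]); (0xe1e09, [::
  0xa1e0d; 0xa1f0c; 0xb1c0e]); (0x161e09, [:: 0x141e0b; 0x141f0a; 0x150e1a]); (0x1a1e09, [::
  0x181e0b; 0x181f0a; 0x191a0e]); (0x1c1e09, [:: 0xc1e19; 0xc1f18; 0xd1a1c]); (0xc0c0a, [::
  0xc080e; 0x80e0c; 0x80e0e]); (0x140c0a, [:: 0x100c0e; 0x100e0c; 0x100e0e]); (0x12120a, [::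
  0x12021a; 0x21a12; 0x21a1a]); (0x14120a, [:: 0x181e; 0x10180e; 0x180816; 0x1e18; 0x100e18;
  0x81618; 0x180216; 0x1e12; 0x14021a; 0x41a1a; 0x21c12]); (0x14140a, [:: 0x81416; 0x14001e;
  0x41c12; 0x81614; 0x14021c; 0x180216; 0x1e12; 0x81616; 0x14021a; 0x21c12]); (0x18180a, [::
  0x18081a; 0x81a18; 0x81a1a]); (0x1e010b, [:: 0x1a050b; 0x1b000f; 0xb120d; 0xb110e]); (0xd0d0b,
  [:: 0xd090f; 0x90f0d; 0x90f0f]); (0x150d0b, [:: 0x110d0f; 0x110f0d; 0x110f0f]); (0xe0e0b, [::
  0xe0a0f; 0xa0f0e; 0xa0f0f]); (0x160e0b, [:: 0x1a060f; 0x160a0f; 0x120f0e; 0x120f0f]); (0xd130b,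
  [:: 0x9170b; 0x3190f; 0x31b0d]); (0xe130b, [:: 0xa170b; 0x31a0f; 0x31b0e]); (0x13130b, [::
  0x13031b; 0x31b13; 0x31b1b]); (0x15130b, [:: 0x91917; 0x91d13; 0xd111b; 0x110b1d; 0x111b0d;
  0x110f19; 0x51b19; 0x110f13; 0x91713; 0x15031b; 0x51b1b; 0x31917; 0x31b15]); (0x16130b, [::
  0x1a0a17; 0xa1e13; 0xe121b; 0x120b1e; 0x121b0e; 0x120f1a; 0x61b1a; 0x120f13; 0xa1713; 0x16031b;
  0x61b1b; 0x31a17; 0x31b16]); (0xe150b, [:: 0x41f0b; 0x4001b0f; 0x51e0b]); (0x15150b, [::
  0x190517; 0x15110f; 0x110f15; 0x5131d; 0x51719; 0x190317; 0x110f13; 0x91717; 0x51b13; 0x31d15;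
  0x3151b; 0x31719]); (0x16160b, [:: 0x1a0617; 0x16120f; 0x120f16; 0x6131e; 0x6171a; 0x120f13;
  0xa1713; 0xa1717; 0x16031b; 0x31e16; 0x31a17; 0x31b16]); (0xe190b, [:: 0x8001b0f; 0x81f0b;
  0x91e0b]); (0x16190b, [:: 0x101f0b; 0x10000f1b; 0x111e0b]); (0x19190b, [:: 0x19091b; 0x91b19;
  0x91b1b]); (0x1a1a0b, [:: 0x1a0a1b; 0xa1b1a; 0xa1b1b]); (0x14140c, [:: 0x14041c; 0x41c14;
  0x41c1c]); (0x18180c, [:: 0x18081c; 0x81c18; 0x81c1c]); (0x1e010d, [:: 0x1c030d; 0x1d000f;
  0xd110e]); (0x20e0d, [:: 0x8060f; 0x40a0f; 0x20c0f; 0xf0e; 0xf0f]); (0xe0e0d, [:: 0xe0c0f;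
  0xc0f0e; 0xc0f0f]); (0x160e0d, [:: 0x140e0f; 0x140f0e; 0x140f0f]); (0x1a0e0d, [:: 0x180e0f;
  0x180f0e; 0x180f0f]); (0xe150d, [:: 0xc170d; 0x51c0f; 0x51d0e]); (0x15150d, [:: 0x15051d;
  0x51d15; 0x51d1d]); (0x16150d, [:: 0x1c0c17; 0xc1e15; 0xe141d; 0x140d1e; 0x141d0e; 0x140f1c;
  0x61d1c; 0x140f15; 0xc1715; 0x16051d; 0x61d1d; 0x51c17; 0x51d16]); (0x16160d, [:: 0x1c0617;
  0x16140f; 0x140f16; 0x6151e; 0x6171c; 0x1c0517; 0x140f15; 0xc1717; 0x61d15; 0x51e16; 0x5161d;
  0x5171c]); (0xe190d, [:: 0xc1b0d; 0x91c0f; 0x91d0e]); (0x16190d, [:: 0x141b0d; 0x111c0f;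
  0x111d0e]); (0x19190d, [:: 0x19091d; 0x91d19; 0x91d1d]); (0x1a190d, [:: 0x1c180f; 0x181e0d;
  0x1a0c1d; 0xc191e; 0xc1d1a; 0xc1b1c; 0xa1d1c; 0x1c091b; 0x8001b1d; 0x81f19; 0x1a091d; 0xa1d1d;
  0x91e19]); (0x1a1a0d, [:: 0x1c0a1b; 0x1a180f; 0x180f1a; 0xa191e; 0xa1b1c; 0x180f19; 0xc1b19;
  0xc1b1b; 0x1a091d; 0x91e1a; 0x91c1b; 0x91d1a]); (0x1c1c0d, [:: 0x1c0c1d; 0xc1d1c; 0xc1d1d]);
  (0x16160e, [:: 0x16061e; 0x61e16; 0x61e1e]); (0x1a1a0e, [:: 0x1a0a1e; 0xa1e1a; 0xa1e1e]);
  (0x1c1c0e, [:: 0x1c0c1e; 0xc1e1c; 0xc1e1e]); (0x1e010f, [:: 0xe110f; 0xb0c17; 0xf001f; 0x70c1b;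
  0x70a1d; 0x7091e]); (0xd130f, [:: 0x11f0f; 0x31d0f; 0x1000f1f]); (0xe130f, [:: 0x21f0f;
  0x2000f1f; 0x31e0f]); (0xe150f, [:: 0x41f0f; 0x4000f1f; 0x51e0f]); (0xe190f, [:: 0x81f0f;
  0x8000f1f; 0x91e0f]); (0x16190f, [:: 0x101f0f; 0x10000f1f; 0x111e0f]); (0x1e1111, [:: 0x1c1311;
  0x1d1013; 0x151912]); (0x121211, [:: 0x121013; 0x101312; 0x101313]); (0x141411, [:: 0x141015;
  0x101514; 0x101515]); (0x181811, [:: 0x181019; 0x101918; 0x101919]); (0x21e11, [:: 0x100e13;
  0x21c13; 0x81316; 0x1f12; 0x4131a; 0x1161a]); (0x41e11, [:: 0x100e15; 0x41a15; 0x81516; 0x1f14;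
  0x2151c; 0x1161c]); (0x81e11, [:: 0x100e19; 0x81619; 0x4191a; 0x1f18; 0x2191c; 0x11a1c]);
  (0xe1e11, [:: 0xc1e13; 0xc1f12; 0xd1a16]); (0x161e11, [:: 0x161c13; 0x121d16; 0x121f14]);
  (0x1a1e11, [:: 0x181e13; 0x181f12; 0x19161a]); (0x1c1e11, [:: 0x181e15; 0x181f14; 0x191c16]);
  (0x141412, [:: 0x141016; 0x101614; 0x101616]); (0x181812, [:: 0x18101a; 0x101a18; 0x101a1a]);
  (0x1e0113, [:: 0x1a0513; 0x1b0017; 0xb1215; 0xb1116]); (0xd1313, [:: 0x91713; 0x31917;
  0x31b15]); (0xe1313, [:: 0xa1713; 0x31a17; 0x31b16]); (0xe1513, [:: 0x41f13; 0x4001b17;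
  0x51e13]); (0x151513, [:: 0x151117; 0x111715; 0x111717]); (0x161613, [:: 0x161217; 0x121716;
  0x121717]); (0xe1913, [:: 0x81f13; 0x800171b; 0x91e13]); (0x161913, [:: 0x1000171b; 0x101f13;
  0x111e13]); (0x191913, [:: 0x19111b; 0x111b19; 0x111b1b]); (0x1a1a13, [:: 0x1a121b; 0x121b1a;
  0x121b1b]); (0x181814, [:: 0x18101c; 0x101c18; 0x101c1c]); (0x1e0115, [:: 0x1c0315; 0x1d0017;
  0xd1116]); (0xe1515, [:: 0x61d15; 0x5161d; 0x5171c]); (0x21615, [:: 0x100617; 0x41217; 0x21417;
  0x1716; 0x1717]); (0x161615, [:: 0x161417; 0x141716; 0x141717]); (0x1a1615, [:: 0x181617;
  0x181716; 0x181717]); (0xe1915, [:: 0xc1b15; 0x91c17; 0x91d16]); (0x161915, [:: 0x141b15;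
  0x111c17; 0x111d16]); (0x191915, [:: 0x19111d; 0x111d19; 0x111d1d]); (0x1a1915, [:: 0x141c1b;
  0x141e19; 0x16181d; 0x18151e; 0x181d16; 0x18171c; 0x121d1c; 0x181719; 0x141b19; 0x1a111d;
  0x121d1d; 0x111c1b; 0x111d1a]); (0x1a1a15, [:: 0x1c121b; 0x1a1817; 0x18171a; 0x12191e; 0x121b1c;
  0x1c111b; 0x181719; 0x141b1b; 0x121d19; 0x111e1a; 0x111a1d; 0x111b1c]); (0x1c1c15, [:: 0x1c141d;
  0x141d1c; 0x141d1d]); (0x1a1a16, [:: 0x1a121e; 0x121e1a; 0x121e1e]); (0x1c1c16, [:: 0x1c141e;
  0x141e1c; 0x141e1e]); (0x1e0117, [:: 0x160917; 0x17001f; 0x7141b; 0x7121d; 0x7111e]); (0xd1317,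
  [:: 0x11f17; 0x31d17; 0x100171f]); (0xe1317, [:: 0x21f17; 0x200171f; 0x31e17]); (0xe1517, [::
  0x41f17; 0x400171f; 0x51e17]); (0xe1917, [:: 0x81f17; 0x800171f; 0x91e17]); (0x161917, [::
  0x1000171f; 0x101f17; 0x111e17]); (0x1e0119, [:: 0x1c0319; 0x1d001b; 0xd111a]); (0xe1919, [::
  0xc1b19; 0x91c1b; 0x91d1a]); (0x161919, [:: 0x141b19; 0x111c1b; 0x111d1a]); (0x21a19, [::
  0x100a1b; 0x8121b; 0x2181b; 0x1b1a; 0x1b1b]); (0x1a1a19, [:: 0x1a181b; 0x181b1a; 0x181b1b]);
  (0x41c19, [:: 0x100c1d; 0x8141d; 0x4181d; 0x1d1c; 0x1d1d]); (0x1c1c19, [:: 0x1c181d; 0x181d1c;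
  0x181d1d]); (0x41c1a, [:: 0x100c1e; 0x8141e; 0x4181e; 0x1e1c; 0x1e1e]); (0x1c1c1a, [:: 0x1c181e;
  0x181e1c; 0x181e1e]); (0x1e011b, [:: 0x1a051b; 0x1b001f; 0xb121d; 0xb111e]); (0xd131b, [::
  0x9171b; 0x3191f; 0x31b1d]); (0xe131b, [:: 0xa171b; 0x31a1f; 0x31b1e]); (0xe151b, [:: 0x41f1b;
  0x4001b1f; 0x51e1b]); (0xe191b, [:: 0x8001b1f; 0x81f1b; 0x91e1b]); (0x16191b, [:: 0x10001b1f;
  0x101f1b; 0x111e1b]); (0x1e011d, [:: 0x1c031d; 0x1d001f; 0xd111e]); (0xe151d, [:: 0xc171d;
  0x51c1f; 0x51d1e]); (0xe191d, [:: 0xc1b1d; 0x91c1f; 0x91d1e]); (0x16191d, [:: 0x141b1d;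
  0x111c1f; 0x111d1e]); (0xc0c0303, [:: 0xc000f03; 0xc020d03; 0x80d0603; 0x40d0a03; 0xa050107;
  0x20d0d03; 0x609010b; 0xa010705; 0x6010b09; 0xa010707; 0x6010b0b; 0x9040e03; 0x5080e03;
  0x10e0c03]); (0x14140303, [:: 0x141703; 0x10160503; 0x4161103; 0x2141503; 0x14011603; 0x2151403;
  0x12050107; 0x2151503; 0x6110113; 0x12010705; 0x6011311; 0x12010707; 0x6011313]); (0x18180303,
  [:: 0x18001b03; 0x18021903; 0x10190a03; 0x8191203; 0x1209010b; 0x2191903; 0xa110113; 0x12010b09;
  0xa011311; 0x12010b0b; 0xa011313; 0x11081a03; 0x9101a03; 0x11a1803]); (0xc060503, [:: 0xc060107;
  0xc020705; 0xc020703; 0x8070605; 0x8070607; 0x8070706; 0xc030107; 0x8070705; 0x8070707]);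
  (0x14060503, [:: 0x14060107; 0x14020705; 0x14020703; 0x10070605; 0x14030207; 0x12050407;
  0x10070706; 0x14030107; 0x10070705; 0x10070707]); (0xc090503, [:: 0xc0c0107; 0xc040d03;
  0xc080705; 0xc080707; 0x80d0606; 0x40d0c03; 0x80d0605; 0xc090107; 0x40d0d03; 0x80d0705;
  0x80d0707]); (0x120a0503, [:: 0x18040703; 0x14080703; 0x140a0107; 0x18020705; 0x100e0305;
  0x18020703; 0x18020707; 0x12080705; 0x12080703; 0x12080707; 0x100b0606; 0x100d0603; 0x100b0605;
  0x100b0603; 0x14010b03; 0x100f0107; 0x10070d03; 0x100b0705; 0x100b0703; 0x100b0707;
  0x11040e03]); (0x140c0503, [:: 0x140c0107; 0x18040705; 0x14080705; 0x18040707; 0x14080707;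
  0x100d0606; 0x100d0605; 0x14090107; 0x100d0705; 0x100d0707]); (0x14110503, [:: 0x14140107;
  0x14041503; 0x14100705; 0x14100707; 0x10150606; 0x4151403; 0x10150605; 0x14110107; 0x4151503;
  0x10150705; 0x10150707]); (0x18180503, [:: 0x18001d03; 0x18041903; 0x10190c03; 0x8191403;
  0x1409010b; 0x4191903; 0xc110113; 0x14010b09; 0xc011311; 0x14010b0b; 0xc011313; 0x11081c03;
  0x9101c03; 0x11c1803]); (0xc0a0603, [:: 0xc0c0207; 0xc040e03; 0x40e0c03; 0xc0a0207; 0x40e0e03;
  0xc080706; 0x80e0506; 0x80e0706; 0xc080707; 0x80e0505; 0x80e0707]); (0x140c0603, [:: 0x140c0207;
  0x140a0207; 0x18040706; 0x14080706; 0x100e0506; 0x100e0706; 0x18040707; 0x14080707; 0x100e0505;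
  0x14020b0b; 0x12040d0d; 0x10070e0e]); (0x14120603, [:: 0x14140207; 0x14041603; 0x4161403;
  0x14120207; 0x4161603; 0x14100706; 0x10160506; 0x10160706; 0x14100707; 0x10160505; 0x10160707]);
  (0x18180603, [:: 0x18001e03; 0x18041a03; 0x101a0c03; 0x81a1403; 0x14020a0b; 0x41a1a03;
  0xc021213; 0x2181c03; 0x21c1803; 0x14020b0a; 0xc021312; 0x14020b0b; 0xc021313]); (0xc0a0903, [::
  0xc0a010b; 0xc020b09; 0xc020b0b; 0x6080b09; 0x6080b0b; 0x40b0a0a; 0x40b0a09; 0xc01030b;
  0x40b0b09; 0x40b0b0b]); (0x140a0903, [:: 0x180a0107; 0x100e0903; 0x18020b05; 0x12080d03;
  0x100b0a05; 0x18030207; 0x12090807; 0x100b0b06; 0x18030107; 0x100b0b05; 0x100b0703; 0x10070b0b;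
  0x1209010d; 0x12010d09; 0x110a020e; 0x11020e0a]); (0x180a0903, [:: 0x180a010b; 0x100a0b09;
  0x18020b0b; 0x12080b0b; 0x100b0a0a; 0x100b0a09; 0x1801030b; 0x100b0b09; 0x100b0b0b]);
  (0x180c0903, [:: 0x180c010b; 0x18040b09; 0x14080b09; 0x18040b0b; 0x14080b0b; 0x100d0a0a;
  0x100d0a09; 0x1805010b; 0x100d0b09; 0x100d0b0b]); (0x18110903, [:: 0x1818010b; 0x18081903;
  0x18100b09; 0x18100b0b; 0x10190a0a; 0x8191803; 0x10190a09; 0x1811010b; 0x8191903; 0x10190b09;
  0x10190b0b]); (0x14120903, [:: 0x14001b03; 0x18120107; 0x1e1103; 0x8161103; 0x18021305;
  0xa101503; 0x21c1103; 0x14011a03; 0x8131205; 0x18030207; 0xa111007; 0x8131306; 0x18030107;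
  0x8131305; 0x8130703; 0x8071313; 0xa110115; 0xa011511; 0x9120216; 0x9021612]); (0x180c0a03, [::
  0x180c020b; 0x1806020b; 0x18060207; 0x18040b0a; 0x14080b0a; 0x100e090a; 0x18020706; 0x100e0b0a;
  0x18040b0b; 0x14080b0b; 0x100e0909; 0x12080d0d; 0x100b0e0e]); (0x18120a03, [:: 0x1818020b;
  0x18081a03; 0x81a1803; 0x1812020b; 0x81a1a03; 0x18100b0a; 0x101a090a; 0x101a0b0a; 0x18100b0b;
  0x101a0909; 0x101a0b0b]); (0xc0c0c03, [:: 0xc0c0f; 0xc080e05; 0xc040e09; 0xc0a040d; 0xc06080d;
  0xc0c010e; 0xc020d0c; 0xc080707; 0x80e0505; 0xa040d0d; 0x80d0606; 0x8070c0c; 0x9040e0e]);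
  (0x140c0c03, [:: 0x140c000f; 0x140c020d; 0x14080d06; 0x14040d0a; 0x18040707; 0x14080707;
  0x100e0505; 0x12040d0d; 0x1409040e; 0x1405080e; 0x14010e0c; 0x100d0606; 0x10070c0c;
  0x11040e0e]); (0x180c0c03, [:: 0x18000c0f; 0x180c0807; 0x18040c0b; 0x18000f0c; 0x818070c;
  0x18040b0c; 0x18040b0b; 0x14080b0b; 0x100e0909; 0x12080d0d; 0x100d0a0a; 0x100b0c0c;
  0x11080e0e]); (0x14121103, [:: 0x14120113; 0x14021311; 0x14020313; 0x14021303; 0x4131211;
  0x6111013; 0x4131312; 0x14030113; 0x4131311; 0x4131313]); (0x18121103, [:: 0x18120113;
  0x18021311; 0x18021303; 0xa101113; 0x8131211; 0x18030213; 0x8131312; 0x18010313; 0x8131311;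
  0x8131313]); (0x18141103, [:: 0x18140113; 0x18041311; 0xc101311; 0x18041313; 0xc101313;
  0x8151212; 0x8151211; 0x18050113; 0x8151311; 0x8151313]); (0x18141203, [:: 0x101c1203;
  0x14180213; 0x140a0213; 0x14081312; 0xc101312; 0x41a1112; 0x14020b12; 0x6101912; 0x140a0113;
  0x14020b11; 0x41a1313; 0x6101911; 0x4191212; 0x4131a12; 0x14090213; 0x41b1013; 0x4131a11;
  0x4191312]); (0x14141403, [:: 0x14140017; 0x14101605; 0x14041611; 0x14120415; 0x14061015;
  0x14140116; 0x14021514; 0x14100707; 0x10160505; 0x12041515; 0x10150606; 0x10071414;
  0x11041616]); (0x18141403, [:: 0x18041413; 0x18041611; 0x18061015; 0x10180516; 0x10181506;
  0x18100714; 0x18021514; 0x18041313; 0xc101313; 0x8161111; 0xa101515; 0x8151212; 0x8131414;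
  0x9101616]); (0x18181803, [:: 0x1800181b; 0x10181a09; 0x8181a11; 0x18120819; 0x180a1019;
  0x1818011a; 0x18021918; 0x18100b0b; 0x101a0909; 0x12081919; 0x10190a0a; 0x100b1818;
  0x11081a1a]); (0x20e1d03, [:: 0x8061f03; 0x40a1f03; 0x20c1f03; 0xf1e03; 0x1f070b; 0xf1f03]);
  (0x40e1d03, [:: 0x40c1f03; 0x21c070d; 0x20c1f05; 0x20e150d; 0x8051e07; 0x40d1a07; 0x40b1c07;
  0xf1e05; 0xd1f06; 0x419070e; 0x10e1c07; 0x11c070e; 0x10d160e]); (0x80e1d03, [:: 0x8160d0b;
  0x80e150b; 0x41a0d0b; 0x40e190b; 0x8061f09; 0x40a1f09; 0x21c0b0d; 0x20c1f09; 0x20e190d; 0xf1e09;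
  0x10c1e0b; 0x10c1f0a; 0x10d0e1a]); (0xe0e1d03, [:: 0xe0c1f03; 0xc0f1e03; 0xc1f070b; 0xc0f1f03]);
  (0x160e1d03, [:: 0x1c061f03; 0x160c1f03; 0x140f1e03; 0x141f070b; 0x140f1f03]); (0x1a0e1d03, [::
  0x1c0a1f03; 0x1a0c1f03; 0x180f1e03; 0x181f0b07; 0x180f1f03]); (0x1c0e1d03, [:: 0x1c160d0b;
  0x1c0e150b; 0x140e1f09; 0x161c0b0d; 0x160e0d19; 0x140f1e09; 0x150e1c0b; 0x150a1d0e;
  0x150a1f0c]); (0x2161d03, [:: 0x10061f03; 0x4121f03; 0x2141f03; 0x171e03; 0x1f1307; 0x171f03]);
  (0x4161d03, [:: 0x4161907; 0x1016070d; 0x10061f05; 0x100e0715; 0x4121f05; 0x41a0715; 0x21c1507;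
  0x2141f05; 0x216150d; 0x171e05; 0x1141e07; 0x1141f06; 0x1150e16]); (0x8161d03, [:: 0x4181f03;
  0x1e1d03; 0x21c1907; 0x2181f05; 0x21a150d; 0x10190e07; 0x100d1a07; 0x8151a07; 0x1d1e03;
  0x2191c07; 0x191f06; 0x8190716; 0x1b1d06; 0x11c1a07; 0x1190e16]); (0x10161d03, [:: 0x10141f03;
  0x21c1513; 0x2141f11; 0x2161915; 0x10150e13; 0x100d1613; 0x4111e13; 0x10071c13; 0x171e11;
  0x151f12; 0x11c1613; 0x1161c13; 0x1151a16]); (0x16161d03, [:: 0x16141f03; 0x14171e03;
  0x14171f03; 0x141f0713]); (0x1a161d03, [:: 0x1c121f03; 0x1a141f03; 0x18171e03; 0x18171f03;
  0x181f0713]); (0x1c161d03, [:: 0x1c161907; 0x1c121f05; 0x1c1a0715; 0x1c13160d; 0x14131f0c;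
  0x141b170c; 0x14171b0c; 0x16130d1c; 0x15131c0e]); (0x21a1d03, [:: 0x100a1f03; 0x8121f03;
  0x2181f03; 0x1b1e03; 0x1b1f03; 0x1f0b13]); (0x41a1d03, [:: 0x8141f03; 0x1e1d03; 0x21c150b;
  0x2141f09; 0x2160d19; 0x100d160b; 0x1d1e03; 0x419160b; 0x10071c0b; 0x4131c0b; 0x171e09;
  0x10150b0e; 0x151f0a; 0x4150b1a; 0x11c160b; 0x1161c0b; 0x1150e1a]); (0x81a1d03, [:: 0x101a0d0b;
  0x81a150b; 0x100e190b; 0x100a1f09; 0x8121f09; 0x8160b19; 0x2181f09; 0x21c0b19; 0x21a190d;
  0x1b1e09; 0x1181e0b; 0x1181f0a; 0x1190e1a]); (0x101a1d03, [:: 0x10181f03; 0x21c1913; 0x2181f11;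
  0x21a1915; 0x10190e13; 0x8111e13; 0x100b1c13; 0x1b1e11; 0x191f12; 0x100d131a; 0x1181e13;
  0x1191a16]); (0x1a1a1d03, [:: 0x1a181f03; 0x181b1e03; 0x181b1f03; 0x181f0b13]); (0x1c1a1d03, [::
  0x181e1d03; 0x1a0c1d13; 0x1a0c1f11; 0x1a0e1519; 0x180d1f12; 0x181d0f12; 0x1c0d131a; 0x180f1d12;
  0x190d161a]); (0x41c1d03, [:: 0x41c1907; 0x101c070d; 0x100c1f05; 0x8141f05; 0x81c0715;
  0x4181f05; 0x100e150d; 0x8160d15; 0x41a150d; 0x1d1e05; 0x1141e0d; 0x1141f0c; 0x1150e1c]);
  (0x81c1d03, [:: 0x101c0d0b; 0x81c150b; 0x100c1f09; 0x8141f09; 0x4181f09; 0x41c0b19; 0x100e0d19;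
  0x8160d19; 0x41a0d19; 0x1d1e09; 0x1181e0d; 0x1181f0c; 0x1190e1c]); (0x101c1d03, [:: 0x101c0d13;
  0x81c1513; 0x41c1913; 0x100c1f11; 0x8141f11; 0x4181f11; 0x8161915; 0x100e1519; 0x41a1915;
  0x1d1e11; 0x11c1a15; 0x1141b1c; 0x1141f18]); (0x1c1c1d03, [:: 0x1c1c1907; 0x1c181f05;
  0x1c1a0d15; 0x181d1e05; 0x1c191907; 0x181d1f05; 0x181f150d]); (0x41c1e03, [:: 0x41c1a07;
  0x101c070e; 0x100c1f06; 0x8141f06; 0x81c0716; 0x4181f06; 0x1e1d06; 0x21c150e; 0x2141f0c;
  0x2160d1c; 0x100d0e16; 0x8150e16; 0x4190e16; 0x2150e1c]); (0x81c1e03, [:: 0x81c160b; 0x21a1c0d;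
  0x101c0b0e; 0x100c1f0a; 0x8141f0a; 0x4181f0a; 0x41c0b1a; 0x1e1d0a; 0x21c190e; 0x2181f0c;
  0x100d1a0e; 0x8150e1a; 0x4191a0e; 0x2191c0e]); (0x101c1e03, [:: 0x100c1e13; 0x8161c13;
  0x41a1c13; 0x1e1e11; 0x2181e15; 0x81c1316; 0x1c1f12; 0x41c131a; 0x2181f14; 0x100d1a16;
  0x8151a16; 0x419161a; 0x2191c16]); (0x1c1c1e03, [:: 0x1c1c1a07; 0x1c1a1a07; 0x1c181f06;
  0x181e1d06; 0x181e1f06; 0x1c19160e; 0x181f160e]); (0x120a0505, [:: 0x18020707; 0x12080707;
  0x100b0606; 0x100b0707; 0x10070b03]); (0x18180505, [:: 0x18001d05; 0x18041905; 0x10190c05;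
  0x8191405; 0x1409010d; 0x4191905; 0xc110115; 0x14010d09; 0xc011511; 0x14010d0d; 0xc011515;
  0x11081c05; 0x9101c05; 0x11c1805]); (0x18180605, [:: 0x181e05; 0x10180e05; 0x18081605; 0x1e1805;
  0x100e1805; 0x8161805; 0x12040c0d; 0x21c1c05; 0xa041415; 0x12040d0c; 0xa041514; 0x12040d0d;
  0xa041515]); (0x180c0905, [:: 0x180c010d; 0x100c0d09; 0x18040d0d; 0x14080d0d; 0x100d0c0c;
  0x100d0c09; 0x1801050d; 0x100d0d09; 0x100d0d0d]); (0x18110905, [:: 0x1818010d; 0x18081905;
  0x18100d09; 0x18100d0d; 0x10190c0c; 0x8191805; 0x10190c09; 0x1811010d; 0x8191905; 0x10190d09;
  0x10190d0d]); (0x14120905, [:: 0x18040507; 0xc101107; 0xc101305; 0x18040707; 0xc100707;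
  0x121d05; 0x10160905; 0x1e1105; 0x8161105; 0x41a1105; 0x8150606; 0x12011c05; 0x8151506;
  0x9041416; 0x9041614; 0x9041616]); (0x18120905, [:: 0x1818000f; 0x1814040b; 0x1818020d;
  0x18100e05; 0x1814020d; 0x1812040d; 0x18081906; 0x18100d0a; 0x101c090a; 0x1804150a; 0x1408190a;
  0x1810070c; 0x18080b05; 0x18100709; 0x101c0b09; 0x1812010d; 0x101a0d0d; 0x8191806; 0x10190c0a;
  0x101d080e; 0x100d1c0a; 0x10190e0c; 0x18090807; 0x1811040b; 0x101d080b; 0x8191906; 0x10190d0a]);
  (0x180c0a05, [:: 0x18080e05; 0x18040e05; 0x180a040d; 0x1806040d; 0x18020d0c; 0x100e090c;
  0x100e0d0c; 0x12080d0c; 0x18040707; 0x14080b0b; 0x18020d0d; 0x100e0909; 0x12080d0d;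
  0x100d0e0e]); (0x18120a05, [:: 0x1818040b; 0x1814080b; 0x18100e09; 0x1814020b; 0x101a0c09;
  0x1812000f; 0x101e080b; 0x101a0e09; 0x18100d0a; 0x101c0b0a; 0x1812010e; 0x18100709; 0x101c0b09;
  0x101c0b0b; 0x1812010d; 0x10190c0a; 0x1811040b; 0x101d080b; 0x10190d0a]); (0x18140c05, [::
  0x1818040d; 0x18081c05; 0x81c1805; 0x1814040d; 0x81c1c05; 0x18100d0c; 0x101c090c; 0x101c0d0c;
  0x18100d0d; 0x101c0909; 0x101c0d0d]); (0x18141105, [:: 0x18140115; 0x18041511; 0x18041515;
  0xc101511; 0xc101515; 0x8151414; 0x8151411; 0x18050115; 0x8151511; 0x8151515]); (0x18141205, [::
  0x1414001b; 0x101c1205; 0x101c1605; 0x14101609; 0x14001e11; 0x14081611; 0x101c0617; 0x14081217;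
  0x10161409; 0x14021c11; 0x100e1417; 0x1412001b; 0x10161609; 0x100e1605; 0x14021a11; 0x12041c05;
  0x1414011a; 0x101c0716; 0x14081316; 0x100e1516; 0x1412011a]); (0x18181805, [:: 0x1818001d;
  0x18101c09; 0x8181c11; 0x18140819; 0x180c1019; 0x1818011c; 0x18041918; 0x18100d0d; 0x101c0909;
  0x14081919; 0x10190c0c; 0x100d1818; 0x11081c1c]); (0x18180606, [:: 0x10180e06; 0x18001e06;
  0x8181606; 0x1e1806; 0x100e1806; 0x8161806; 0x14020a0e; 0x41a1a06; 0xc021216; 0x14020e0a;
  0xc021612; 0x14020e0e; 0xc021616]); (0x180c0a06, [:: 0x180c020e; 0x18040e0a; 0x18040e06;
  0x100e0c0a; 0x1806040e; 0x140a080e; 0x100e0e0c; 0x1806020e; 0x100e0e0a; 0x100e0e0e]);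
  (0x18120a06, [:: 0x1818020e; 0x18081a06; 0x18100e0a; 0x18100e0e; 0x101a0c0c; 0x81a1806;
  0x101a0c0a; 0x1812020e; 0x81a1a06; 0x101a0e0a; 0x101a0e0e]); (0x18140c06, [:: 0x1818040e;
  0x18081c06; 0x81c1806; 0x1814040e; 0x81c1c06; 0x18100e0c; 0x101c0a0c; 0x101c0e0c; 0x18100e0e;
  0x101c0a0a; 0x101c0e0e]); (0x18141206, [:: 0x18140216; 0x18041612; 0x18041606; 0xc101216;
  0x8161412; 0x18060416; 0x8161614; 0x18020616; 0x8161612; 0x8161616]); (0x18181806, [::
  0x1818001e; 0x10181c0a; 0x8181c12; 0x1814081a; 0x180c101a; 0x1818021c; 0x18041a18; 0x18100e0e;
  0x101c0a0a; 0x14081a1a; 0x101a0c0c; 0x100e1818; 0x12081c1c]); (0x14120909, [:: 0x1418020b;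
  0x14080a0b; 0x1412080b; 0x18021609; 0x1e1209; 0x14021a09; 0x41a1a09; 0x6081819; 0x21c1209;
  0x14100b0a; 0x14080b0a; 0x6081918; 0x14100b0b; 0x14080b0b; 0x41a0909; 0x6081919]); (0x18141209,
  [:: 0x18180017; 0x18140017; 0x18140413; 0x18001e11; 0x18100e11; 0x18081611; 0x101c1a09;
  0x18140215; 0x101c0e09; 0x18041611; 0x101a0c1d; 0x1802141d; 0x100e181d; 0x18180116; 0x101a0d1c;
  0x1802151c; 0x100e191c]); (0x40e0d0b, [:: 0x80e050f; 0x40e090f; 0x8060f0d; 0x40a0f0d; 0x40a0f0b;
  0xf0e0d; 0x807060f; 0x40b0a0f; 0x20d0c0f; 0xf0f0e; 0x807050f; 0x40b090f; 0xf0f0d; 0xf0f0f]);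
  (0x2160d0b, [:: 0x160f0b; 0x170e0b; 0x11a060f; 0x1160a0f; 0x1120f0e; 0x1120f0f]); (0x4160d0b,
  [:: 0x816050f; 0x416090f; 0x10060f0d; 0x1e070d; 0x4120f0d; 0x10060f0f; 0x4120f0f; 0x2140f0d;
  0x2140f0f; 0x170e0e; 0x170e0d; 0x1f050f; 0xf1d07; 0x413090f; 0x170f0d; 0x170f07; 0x170f0f]);
  (0x21a0d0b, [:: 0x100c0f0b; 0x8140f0b; 0x4180f0b; 0x81a050f; 0x41a090f; 0x100a0f0d; 0x8120f0d;
  0x1e0b0d; 0x100a0f0b; 0x8120f0b; 0x100a0f0f; 0x8120f0f; 0x2180f0d; 0x2180f0b; 0x2180f0f;
  0x1b0e0e; 0x1d0e0b; 0x1b0e0d; 0x1b0e0b; 0x1d0f0b; 0x813050f; 0x1f090f; 0x1b0f0d; 0x1b0f0b;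
  0x1b0f0f]); (0x41c0d0b, [:: 0x81c050f; 0x41c090f; 0x100c0f0d; 0x8140f0d; 0x4180f0d; 0x100c0f0f;
  0x8140f0f; 0x4180f0f; 0x1d0e0e; 0x1d0e0d; 0x815050f; 0x419090f; 0x1d0f0d; 0x1d0f0f]);
  (0x41c0e0b, [:: 0x81c060f; 0x41c0a0f; 0x816060f; 0x41a0a0f; 0x100c0f0e; 0x8140f0e; 0x4180f0e;
  0x1e0d0e; 0x1e0f0e; 0x100c0f0f; 0x8140f0f; 0x4180f0f; 0x1e0d0d; 0x1e0f0f]); (0x416150b, [::
  0x1016050f; 0x416110f; 0x1006170d; 0x412170d; 0x412170b; 0x17160d; 0x1007060f; 0x413120f;
  0x215140f; 0x17170e; 0x1007050f; 0x413110f; 0x17170d; 0x170f07; 0xf1717; 0x4031b1b; 0x215051d;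
  0x2051d15; 0x116061e; 0x1061e16]); (0x41a190b, [:: 0x101a090f; 0x81a110f; 0x1e190b; 0x100a1b0d;
  0x8121b0d; 0x2181d0b; 0x1b1a0d; 0x100b0a0f; 0x813120f; 0x219180f; 0x1b1b0e; 0x100b090f;
  0x813110f; 0x1b1b0d; 0x1b0f0b; 0x8031717; 0xf1b1b; 0x219091d; 0x2091d19; 0x11a0a1e; 0x10a1e1a]);
  (0x41c1c0b, [:: 0x101c0c0f; 0x81c140f; 0x41c180f; 0x100c1e0d; 0x8141e0d; 0x4181e0d; 0x1e1c0d;
  0x21c0c1d; 0x100c1d0e; 0x8141d0e; 0x4181d0e; 0x20c1d1c; 0x100c0f0f; 0x8140f0f; 0x4180f0f;
  0x1e0d0d; 0x20c1d1d; 0x1d1c0e; 0x1d0e0e; 0x11c0c1e; 0x10c1e1c; 0x10c1e1e]); (0x2160d0d, [::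
  0x160f0d; 0x170e0d; 0x1d0f07; 0x1f050f; 0x170f0d]); (0x21a0d0d, [:: 0x100a0f0f; 0x8120f0f;
  0x2180f0f; 0x1b0e0e; 0x1b0f0f; 0xf1b0b]); (0x21a150d, [:: 0x100a170d; 0x812170d; 0x218170d;
  0x1b160d; 0x1d1b07; 0x1f110f; 0x171d0b; 0x1b170d]); (0x1a160d0f, [:: 0x1c021f0f; 0x1c0a170f;
  0x1a041f0f; 0x1a0c0f17; 0xe18170f; 0xe180f17; 0xe1c031f; 0x160c0f1b; 0xe140f1b; 0xa1e150f;
  0xa1e0d17; 0x61e0d1b; 0x180f0e17; 0x1c031e0f; 0xc1b160f; 0xc1b0e17; 0x140f0e1b; 0xc170e1b;
  0x1a051e0f; 0x8001d170f; 0x8001d0f17; 0x1c09170f; 0x1c090f17; 0x1c0d031f; 0xc1d071b; 0x81f150f;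
  0x81f0d17; 0x140f0d1b; 0xc170d1b; 0x81f130f; 0x800171b0f; 0x81f0717; 0x180f0717; 0x180f0f17;
  0x800170f17; 0x1c0b031f; 0x1c030f1b; 0x1c03170f; 0x1c030f17; 0xc1b0717; 0xc1b170f; 0x41f0b1b;
  0x140f0b1b; 0xc170b1b; 0x41f130f; 0x140f130f; 0x1c07031f; 0xc1f031f; 0xc0f1b17; 0x140f0f1b;
  0xc170f1b; 0x4001b0f1b; 0x400171b0f; 0x1a051d0f; 0xe091d17; 0x1a011f0f; 0x1a05170f; 0x16091b0f;
  0xe111b0f; 0xe11170f; 0x1a031d0f; 0x120f190f; 0xa17190f; 0xa17150f; 0xd0a1e17; 0x150c0f1b;
  0xd140f1b; 0x91e150f; 0x91e0d17; 0x91e130f; 0x15021f0f; 0x51e130f; 0x1b000f1f; 0x31c1f0f;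
  0x130c0f1f; 0xb140f1f; 0x17000f1f; 0x7180f1f; 0x31e0d1d; 0x31e190f; 0x31d0e1e; 0x51d0e1b;
  0x15031e0f; 0x31d1e0f]); (0x1313130f, [:: 0x1313031f; 0x13031b17; 0x13030b1f; 0x31b1317;
  0x31b1b17; 0x313171b; 0x13030f1b; 0x3130f17; 0x3130f1f; 0x3131f0f; 0x317131b; 0x317131f;
  0x3171b0f; 0x31f031f; 0x317171b]); (0x1515150f, [:: 0x1515051f; 0x15051d17; 0x51d1517;
  0x150d051f; 0x51d1d17; 0x1505171d; 0x15050f1d; 0x15050f17; 0x5151f0f; 0x15050f1f; 0x401110f1f;
  0x517151d; 0x1507051f; 0x5171d0f; 0x517171d; 0x104140f1f]); (0x1616160f, [:: 0x1616061f;
  0x16061e17; 0x61e1617; 0x160e061f; 0x61e1e17; 0x1606171e; 0x16060f1e; 0x16060f17; 0x6161f0f;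
  0x16060f1f; 0x402120f1f; 0x204140f1f; 0x617161e; 0x1607061f; 0x6171e0f; 0x617171e]);
  (0x1919190f, [:: 0x1909191f; 0x9191d1b; 0x9190d1f; 0x91d191b; 0x91d1d1b; 0x19091b1d; 0x19090f1d;
  0x19090b1f; 0x19090f1b; 0x9190f1f; 0x9191f0f; 0x91b191d; 0x91b0d1f; 0x91b1d0f; 0x91b1b1d]);
  (0x1a1a1a0f, [:: 0x1a1a0a1f; 0x1a0a1e1b; 0xa1e1a1b; 0x1a0e0a1f; 0xa1e1e1b; 0x1a0a1b1e;
  0x1a0a0f1e; 0x1a0a0f1b; 0xa1a1f0f; 0x1a0a0f1f; 0x802120f1f; 0x208180f1f; 0xa1b1a1e; 0x1a0b0a1f;
  0xa1b1e0f; 0xa1b1b1e]); (0x1c1c1c0f, [:: 0x1c1c0c1f; 0x1c0c1e1d; 0xc1e1c1d; 0x1c0e0c1f;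
  0xc1e1e1d; 0x1c0c1d1e; 0x1c0c0f1e; 0x1c0c0f1d; 0xc1c1f0f; 0x1c0c0f1f; 0x804140f1f; 0x408180f1f;
  0xc1e1d0f; 0xc1d1c1e; 0x1c0d0c1f; 0xc1d1d1e]); (0x4161513, [:: 0x10160517; 0x4161117;
  0x10061715; 0x4121715; 0x4121713; 0x171615; 0x10070617; 0x4131217; 0x2151417; 0x171716;
  0x10070517; 0x4131117; 0x171715; 0x171717]); (0x21a1513, [:: 0x100c1713; 0x8141713; 0x4181713;
  0x101a0517; 0x41a1117; 0x100a1715; 0x8121715; 0x1e1315; 0x100a1713; 0x8121713; 0x100a1717;
  0x8121717; 0x2181715; 0x2181713; 0x2181717; 0x1b1616; 0x1d1613; 0x1b1615; 0x1b1613; 0x1d1713;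
  0x100b0517; 0x1f1117; 0x1b1715; 0x1b1713; 0x1b1717]); (0x41c1513, [:: 0x101c0517; 0x41c1117;
  0x100c1715; 0x8141715; 0x4181715; 0x100c1717; 0x8141717; 0x4181717; 0x1d1616; 0x1d1615;
  0x100d0517; 0x4191117; 0x1d1715; 0x1d1717]); (0x41c1613, [:: 0x101c0617; 0x41c1217; 0x100e0617;
  0x41a1217; 0x100c1716; 0x8141716; 0x4181716; 0x1e1516; 0x1e1716; 0x100c1717; 0x8141717;
  0x4181717; 0x1e1515; 0x1e1717]); (0x41a1913, [:: 0x101a0917; 0x81a1117; 0x1e1913; 0x100a1b15;
  0x8121b15; 0x2181d13; 0x1b1a15; 0x100b0a17; 0x8131217; 0x2191817; 0x1b1b16; 0x100b0917;
  0x8131117; 0x1b1b15; 0x1b1713; 0x171b1b; 0x219111d; 0x2111d19; 0x11a121e; 0x1121e1a]);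
  (0x81a1913, [:: 0x101a091b; 0x81a111b; 0x100a1b19; 0x8121b19; 0x8121b13; 0x1b1a19; 0x100b0a1b;
  0x813121b; 0x219181b; 0x1b1b1a; 0x100b091b; 0x813111b; 0x1b1b19; 0x1b1b1b]); (0x81c1913, [::
  0x101c091b; 0x81c111b; 0x100c1b19; 0x8141b19; 0x4181b19; 0x100c1b1b; 0x8141b1b; 0x4181b1b;
  0x1d1a1a; 0x1d1a19; 0x100d091b; 0x815111b; 0x1d1b19; 0x1d1b1b]); (0x81c1a13, [:: 0x101c0a1b;
  0x81c121b; 0x100e0a1b; 0x816121b; 0x100c1b1a; 0x8141b1a; 0x4181b1a; 0x1e191a; 0x1e1b1a;
  0x8181717; 0x4181b1b; 0x100a1d1d; 0x8121d1d; 0x1e1919; 0x1e1b1b; 0x10091e1e; 0x8111e1e]);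
  (0x41c1c13, [:: 0x41c141b; 0x4141e19; 0x416181d; 0x418151e; 0x4181d16; 0x418171c; 0x4121d1c;
  0x101c0517; 0x10140f15; 0x8141717; 0x4181717; 0x10061d15; 0x1e1515; 0x2141d1d; 0x10051e1e;
  0x1d1616; 0x171c1c; 0x1005161d; 0x1005171c; 0x1141e1e]); (0x81c1c13, [:: 0x8141c1b; 0x8141e19;
  0x816181d; 0x818151e; 0x8181d16; 0x818171c; 0x8121d1c; 0x101c091b; 0x100c1b19; 0x8141b1b;
  0x4181b1b; 0x1e1919; 0x2181d1d; 0x10091e1e; 0x1d1a1a; 0x1b1c1c; 0x10091a1d; 0x10091e19;
  0x10091b1c; 0x1181e1e]); (0x21a1515, [:: 0x100a1717; 0x8121717; 0x2181717; 0x1b1616; 0x1b1713;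
  0x1b1717]); (0x81c1915, [:: 0x101c091d; 0x81c111d; 0x1c1d19; 0x100c1d1d; 0x8141d1d; 0x4181d1d;
  0x1d1c1c; 0x1d1c19; 0x100d091d; 0x815111d; 0x1d1d19; 0x1d1d1d]); (0x81c1a15, [:: 0x81c1417;
  0x41c181b; 0x8181e15; 0x4181a1d; 0x4181e19; 0x101a0c1d; 0x81a141d; 0x100e0c1d; 0x8141d16;
  0x418191e; 0x4181d1a; 0x100c0f1c; 0x100a1d1c; 0x8121d1c; 0x1e191c; 0x2181d1c; 0x100a1d1d;
  0x8121d1d; 0x1e1919; 0x1e1d1d; 0x2181d1d; 0x815141e; 0x1d1e1c]); (0x81c1a16, [:: 0x101c0a1e;
  0x81c121e; 0x100c1e1a; 0x8141e1a; 0x8141e16; 0x1e1c1a; 0x100e0c1e; 0x816141e; 0x41a181e;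
  0x1e1e1c; 0x100e0a1e; 0x816121e; 0x1e1e1a; 0x1e1e1e]); (0x19190717, [:: 0x19091717; 0x91d1317;
  0xd111b17; 0x111b0d17; 0x19031d17; 0x9171917; 0x1513031f; 0x15031b17; 0x51b1317; 0x150b031f;
  0x51b1b17; 0x1503171b; 0x15030f1b; 0x517131b; 0x5170b1b; 0x13091d17; 0x31d1917; 0x1305171f;
  0x3151f17; 0x3151f0f; 0x13050f1f; 0x31d170f; 0x711171f; 0x7110f1f; 0x317151d; 0x3170d1d;
  0x3171d17; 0x10214171f; 0x102140f1f]); (0x1a1a0717, [:: 0x1a021f17; 0x121e0b17; 0xa1e1317;
  0x160a1b17; 0xe121b17; 0x208101f17; 0x1a031e17; 0x61b1a17; 0x1613031f; 0x16031b17; 0x61b1317;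
  0x160b031f; 0x61b1b17; 0x1603171b; 0x16030f1b; 0x617131b; 0x6170b1b; 0x13060f17; 0x3161f0f;
  0x13060f1f; 0x31e170f; 0x7121b17; 0x712171b; 0x7120f1f; 0x201140f1f; 0x3170e1e; 0x1307061f;
  0x713121f; 0x317171e]); (0x1c1c0717, [:: 0x1c140f17; 0x141e0d17; 0x160c1d17; 0x1c051e17;
  0xc1d1617; 0x140f1c17; 0x1615051f; 0x16051d17; 0x61d1517; 0x160d051f; 0x61d1d17; 0x1605171d;
  0x16050f1d; 0x617151d; 0x6170d1d; 0xd141e17; 0x51e1c17; 0x1506171f; 0x5161f17; 0x5161f0f;
  0x15060f1f; 0x51e170f; 0x40112171f; 0x401120f1f; 0x714171f; 0x7140f1f; 0x517161e; 0x5170e1e;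
  0x5171e17]); (0xb0b0b17, [:: 0xb0b031f; 0xb030f1b; 0x30f0b1b; 0xb07031f; 0x30f0f1b]);
  (0xd0b0b17, [:: 0x90f0d17; 0xd0b051f; 0xd030f1d; 0x50f0b1d; 0x90f0f17; 0x50f0b1f; 0x50f0f1b]);
  (0xe0b0b17, [:: 0xa070f17; 0x60b0b1f; 0x60b0f1b; 0x60f0b1b; 0xb07061f; 0x30f0f1e]); (0x130b0b17,
  [:: 0x13030b1f; 0x13030f1b; 0x3130f1f; 0x3131f0f; 0x3171b0f; 0x31f031f]); (0x150b0b17, [::
  0x150b031f; 0x15030f1b; 0x5170b1b; 0x3151f0f; 0x13050f1f; 0x31d170f; 0x7110f1f; 0x3170d1d;
  0x102140f1f]); (0x160b0b17, [:: 0x160b031f; 0x16030f1b; 0x6170b1b; 0x3161f0f; 0x13060f1f;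
  0x31e170f; 0x7120f1f; 0x201140f1f; 0x3170e1e]); (0x190b0b17, [:: 0x91b0b17; 0xb19031f;
  0x3190f1b; 0x3191f0f; 0x13090f1f; 0xb110f1f; 0x31d1b0f; 0x31b0d1d; 0x31b0d1b; 0x102180f1f]);
  (0x1a0b0b17, [:: 0x1a0b031f; 0xa1b071b; 0x31a0f1b; 0x31a1f0f; 0x130a0f1f; 0xb120f1f; 0x31e1b0f;
  0x201180f1f; 0x31b0e1e; 0x31b0e1b]); (0x1c0b0b17, [:: 0x1c0b031f; 0x1c030f1b; 0x41f0b1b;
  0x140f0b1b; 0xc170b1b; 0x4000f1b1b; 0x31c1f0f; 0x130c0f1f; 0xb140f1f; 0x7180f1f; 0x31e0d1d;
  0x31d0e1e; 0x31d1e0f]); (0x190d0b17, [:: 0x1915091f; 0x190d111f; 0x91d1917; 0x19051d1b;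
  0x19050d1f; 0x91d1d17; 0x19110f1d; 0x1909171d; 0x91d071d; 0x15090f1d; 0xd110f1d; 0x51d0b1d;
  0x19110f1b; 0x1909171b; 0x11191f0f; 0x1001090f1f; 0x19110f1f; 0x1909171f; 0x9191f17;
  0x80111171f; 0x5191f0f; 0x15090f1f; 0xd110f1f; 0x51d0b1b; 0x1903191f; 0x91b1917; 0x111b1d0f;
  0x91b1d17; 0x51b1d0f; 0x19031b1d; 0x91b1b17; 0x110180f1f; 0x10818171f; 0x104180f1f]);
  (0x1a0e0b17, [:: 0x1a160a1f; 0x1a0e121f; 0xa1e1a17; 0x1a061e1b; 0x1a0e061f; 0xa1e1e17;
  0x1a120f1e; 0xa1a171e; 0xa1e071e; 0x61a0f1e; 0x61e0b1e; 0x121a0f1b; 0x1a0a171b; 0x121a1f0f;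
  0x10020a0f1f; 0x1a120f1f; 0x1a0a171f; 0xa1a1f17; 0x80212171f; 0x121e1b0f; 0x61a1f0f; 0x160a0f1f;
  0xe120f1f; 0x61e0b1b; 0x61e1b0f; 0x210180f1f; 0x20818171f; 0x204180f1f; 0x1a031a1f; 0xa1b1a17;
  0xa1b1e17; 0x1a031b1e; 0xa1b1b17]); (0x19130b17, [:: 0x1913031f; 0x111b071b; 0x19031717;
  0x110f1317; 0x15031b17; 0x319171b; 0x13091717; 0x31d131b; 0x31d131f; 0x31d171b; 0x31b151b;
  0x31b1517; 0x130b051f; 0x31b1d17; 0x31b171d]); (0x1a130b17, [:: 0x121b0b17; 0x1a031717;
  0x120f1317; 0x16031b17; 0x131a031f; 0x31a171b; 0x31a1717; 0x130a171f; 0x31a1f17; 0xb12171f;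
  0x20118171f; 0x31b161e; 0x31b161b; 0x31b1617; 0x31b1e17]); (0x16150b17, [:: 0x10001b0f17;
  0x101f0b17; 0x14170b17; 0x41f1317; 0xc171317; 0x400171b17; 0x1a110f17; 0x1a051717; 0x1a050f17;
  0x16091b17; 0x16090f17; 0xe111717; 0x61d1317; 0x1a13051f; 0x120f1517; 0x120f0d17; 0x1603191f;
  0x16031d1b; 0x61b1517; 0x617191b; 0x1a03171d; 0x12170b1d; 0x120f131d; 0x111e0b17; 0x15021f17;
  0x1700171f; 0x13061d1f; 0x130e051f; 0x7121d1f; 0x13061b1d; 0x3161f1d; 0x13060f1d; 0x31e171d;
  0x201141d1f; 0x3171c1e; 0x15031e17; 0x3171a1d]); (0x1c1c0b17, [:: 0x1c0c1b17; 0x180e1d17;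
  0x181e0d17; 0x1c0a0f17; 0x1c0e031f; 0xc1e071b; 0x1a0c0f17; 0x160c0f1b; 0xe140f1b; 0x1a0e051f;
  0x160e091f; 0xe16091f; 0xa1e071d; 0x160a0f1d; 0xe120f1d; 0xc1d1a17; 0x180f1c17; 0x180f0e17;
  0x61d0e1b; 0x61b0e1d; 0x8001b171b; 0x101f0b1b; 0x10000f1b1b; 0x81f131b; 0x180f0f17; 0x141b0b1b;
  0xc1b131b; 0x1a15091f; 0x1a0d111f; 0xa1d1917; 0x1a051d1b; 0xa1d1d17; 0x1a110f1d; 0x1a09171d;
  0x1a19031f; 0x1a011f1b; 0xe110f17; 0x61d1b0f; 0xe15031f; 0x61d0f1b; 0x121b0d1d; 0xa1b151d;
  0x1a031d1b; 0xe13051f; 0x61f091f; 0x61b0f1d; 0xd181e17; 0x91e1c17; 0x111a1f0f; 0x10010a0f1f;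
  0x19120f1f; 0x190a171f; 0x91a1f17; 0x80112171f; 0x111e1b0f; 0x1b001b1f; 0x13180f1f; 0xb18171f;
  0x111b0e1e; 0x91b161e; 0x91b1e17]); (0xd0d0d17, [:: 0xd0d051f; 0xd050f1d; 0x50f0d1d; 0xd07051f;
  0x50f0f1d]); (0xe0d0d17, [:: 0xc0f0e17; 0xe0d061f; 0xe050f1e; 0x60f0d1e; 0xc0f0f17; 0x60f0d1f;
  0x60f0f1d]); (0x150d0d17, [:: 0x150d051f; 0x15050f1d; 0x5151f0f; 0x15050f1f; 0x401110f1f;
  0x5171d0f; 0x104140f1f]); (0x160d0d17, [:: 0x160d051f; 0x16050f1d; 0x6170d1d; 0x5161f0f;
  0x15060f1f; 0x51e170f; 0x401120f1f; 0x7140f1f; 0x5170e1e]); (0x190d0d17, [:: 0x19050d1f;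
  0x91d071d; 0x5190f1d; 0x51d0b1d; 0x5191f0f; 0x15090f1f; 0xd110f1f; 0x51d0b1b; 0x51b1d0f;
  0x104180f1f]); (0x1a0d0d17, [:: 0x8001d0f17; 0x81f0d17; 0xc1b0d17; 0x1c07031f; 0xc17071b;
  0xe15031f; 0x91e0d17; 0xd1a051f; 0x150e091f; 0xd16091f; 0x51e0d1b; 0x150a0f1d; 0xd120f1d;
  0xd120f17; 0x51e0f1b; 0x51b0e1d; 0x51b0e1f; 0x51b1e0f; 0x51b0f1e]); (0x1c0d0d17, [:: 0xc1d0d17;
  0xd1c051f; 0x51c0f1d; 0x51c1f0f; 0x150c0f1f; 0xd140f1f; 0x401180f1f; 0x51e1d0f; 0x51d0e1e;
  0x51d0e1d]); (0x1c0e0d17, [:: 0x1c160c1f; 0x1c0e141f; 0xc1e1c17; 0x1c061e1d; 0x1c0e061f;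
  0xc1e1e17; 0x1c140f1e; 0xc1c171e; 0xc1e071e; 0x61c0f1e; 0x61e0d1e; 0x141c0f1d; 0x1c0c171d;
  0x141c1f0f; 0x10040c0f1f; 0x1c140f1f; 0x1c0c171f; 0xc1c1f17; 0x80414171f; 0x410180f1f;
  0x40818171f; 0x61c1f0f; 0x160c0f1f; 0xe140f1f; 0x402180f1f; 0x61e0d1d; 0x61e1d0f; 0x1c051c1f;
  0xc1d1c17; 0x141d1e0f; 0xc1d1e17; 0x1c051d1e; 0xc1d1d17]); (0x19150d17, [:: 0x111d0d17;
  0x15091d17; 0x1515091f; 0x150d111f; 0x15051d1b; 0x15051b1d; 0x15011f17; 0x15051b1f; 0x150d031f;
  0x5151f1b; 0x401111b1f; 0x15031d17; 0x5171d1b; 0x100141f17; 0x104141b1f]); (0x1a150d17, [::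
  0x10001d0f17; 0x1c15031f; 0x1c05171b; 0x101f0d17; 0x14170d1b; 0x140f151b; 0x41f1317; 0xc171317;
  0x4001b1717; 0x16091d17; 0x1615091f; 0x160d111f; 0x16051b1d; 0x16011f17; 0x617191d; 0x16031d17;
  0x111e0d17; 0x15061d1b; 0x15061b1f; 0x150e031f; 0x5161f1b; 0x15060f1b; 0x51e171b; 0x401121b1f;
  0x1700171f; 0x7141b1f; 0x5171a1e; 0x5171c1b]); (0x1c150d17, [:: 0x141d0d17; 0x4001d1717;
  0x41f1517; 0xc171517; 0x16051d17; 0x151c051f; 0x51c171d; 0x150c171f; 0x51c1f17; 0xd14171f;
  0x40118171f; 0x51e1517; 0x51d161e; 0x51d161d; 0x51d1e17]); (0x1a160d17, [:: 0x1c120f17;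
  0x1c16031f; 0x1c06171b; 0x16180f17; 0x121e0d17; 0x141b0e17; 0x41f161b; 0x400171e1b; 0x61d161b;
  0x10001d0f17; 0x1c15031f; 0x1c05171b; 0x4001d171b; 0x101f0d17; 0x41f151b; 0x141b0f17;
  0x14171b0f; 0x141f031f; 0x1c07031f; 0x140f171b; 0xc17171b; 0x111e0d17; 0x51e151b]); (0x1c190d17,
  [:: 0x1c1c031f; 0x1c0c171b; 0x141e0d1b; 0x1c061d1b; 0x160c1d1b; 0xc1d161b; 0x140f1c1b;
  0x1c091d17; 0x1c15091f; 0x1c0d111f; 0x1c051d1b; 0x1c110f1d; 0x1c09171d; 0x1c011f17; 0x1c15031f;
  0x1c051b1f; 0x1c0d031f; 0x41d1f1b; 0x1c050f1b; 0xc1d171b; 0x410091b1f; 0x408111b1f; 0x4001d1b1f;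
  0x1c031d1d; 0x4001b1d1d; 0x1c031d17; 0x140f1d1b; 0x4001b1d1b; 0x150c1e1b; 0xd141e1b; 0x1d00171f;
  0x51c1f1b]); (0xe0e0e17, [:: 0xe0e061f; 0xe060f1e; 0x60f0e1e; 0xe07061f; 0x60f0f1e]);
  (0x160e0e17, [:: 0x160e061f; 0x16060f1e; 0x61e0f17; 0x6170e1e; 0x6171e0f; 0x61f061f;
  0x6170f1e]); (0x1a0e0e17, [:: 0x1a0e061f; 0xa1e071e; 0x61a0f1e; 0x61e0b1e; 0x61a1f0f;
  0x160a0f1f; 0xe120f1f; 0x61e0b1b; 0x61e1b0f; 0x204180f1f]); (0x1c0e0e17, [:: 0x1c0e061f;
  0xc1e071e; 0x61c0f1e; 0x61e0d1e; 0x61c1f0f; 0x160c0f1f; 0xe140f1f; 0x402180f1f; 0x61e0d1d;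
  0x61e1d0f]); (0x1a160e17, [:: 0x1a16061f; 0x121e071e; 0x160a171e; 0xe12171e; 0x61e131e;
  0x16021f17; 0x160a171f; 0x61a1f17; 0xe12171f; 0x61e131b; 0x61e1317; 0x200141f17; 0x20418171f;
  0x16031e17; 0x61b1e17]); (0x1c160e17, [:: 0x1c16061f; 0x141e071e; 0x160c171e; 0xe14171e;
  0x61e151e; 0x410021f17; 0x16041f17; 0x160c171f; 0x61c1f17; 0xe14171f; 0x40218171f; 0x61e151d;
  0x61e1517; 0x16051e17; 0x61d1e17]); (0x1c1a0e17, [:: 0x1c0a1e17; 0x1c160a1f; 0x1c0e121f;
  0x1c061e1b; 0x1c120f1e; 0x1c0a171e; 0x1c1c031f; 0x1c041f1b; 0x408101f1b; 0x141e0d1b; 0xc1e151b;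
  0x1c021f17; 0x1c0a1717; 0x1c16031f; 0x1c061b17; 0x1c061b1f; 0x1c0e031f; 0x41e1f1b; 0x4100a1b1f;
  0x408121b1f; 0x4001e1b1b; 0x4001e1b1f; 0x1e00171f; 0x61c1f1b; 0x1c031e1e; 0x4001b1e1e;
  0x1c051e1b; 0x140f1e1b; 0xc171e1b]); (0x19191917, [:: 0x1119191f; 0x11191d1b; 0x111d191b;
  0x1915111f; 0x111d1d1b; 0x19111b1d; 0x1119171d; 0x1911171b; 0x1119171f; 0x11191f17; 0x111b191d;
  0x111b191f; 0x111b1d17; 0x1117191f; 0x111b1b1d]); (0x1a1a1a17, [:: 0x1a1a121f; 0x1a121e1b;
  0x121e1a1b; 0x1a16121f; 0x121e1e1b; 0x1a121b1e; 0x1a12171e; 0x1a12171b; 0x10020a171f;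
  0x121a1f17; 0x1a12171f; 0x121e1b17; 0x21018171f; 0x121b1a1e; 0x1a13121f; 0x121b1b1e]);
  (0x1c1c1c17, [:: 0x1c1c141f; 0x141c1e1d; 0x1c14161f; 0x141e1c1d; 0x141e1e1d; 0x141c1d1e;
  0x141c171e; 0x1c14151f; 0x141c171d; 0x141c171f; 0x141c1f17; 0x141d1c1e; 0x141d161f; 0x141d1e17;
  0x141d1d1e]); (0x16150b1b, [:: 0x1a1a051f; 0xa1a171d; 0xa1e131d; 0xe121b1d; 0x121b0e1d;
  0x1a031e1d; 0x120f1a1d; 0x61b1a1d; 0x16110f1b; 0x16090f1b; 0x1613091f; 0x160b091f; 0x120f131d;
  0xa17131d; 0x16031b1d; 0x61b1b1d; 0x130a1e1d; 0x131a051f; 0x130a171d; 0xb12171d; 0x31b161d]);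
  (0x1c1c0b1b, [:: 0x1c180f1b; 0x181e0d1b; 0x1a0c1d1b; 0x1c091e1b; 0xc1d1a1b; 0xc1b1c1b;
  0xa1d1c1b; 0x181b0b1d; 0x1a09191f; 0x1a091d1b; 0x1a090d1f; 0xa1d191b; 0xa1d1d1b; 0x1a090f1d;
  0xa1b0d1d; 0xd181e1b; 0x190a1b1d; 0x190a0f1b; 0x91a1f0f; 0x190a0f1f; 0x801120f1f; 0xb18191f;
  0xb181d1b; 0xb180f1f; 0x91b0e1e; 0x91b1a1d; 0x190b0a1f; 0x91b1e0f; 0x91b1b1e]); (0xd0d0d1b, [::
  0xd0d091f; 0xd090f1d; 0x90f0d1d; 0xd0b091f; 0x90f0f1d]); (0xe0d0d1b, [:: 0xc0f0e1b; 0xe0d0a1f;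
  0xe090f1e; 0xa0f0d1e; 0xc0f0f1b; 0xa0f0d1f; 0xa0f0f1d]); (0x150d0d1b, [:: 0x19050d1f;
  0x15090d1f; 0x110d0f1d; 0x15090b1f; 0x110f0d1d; 0x1907051f; 0x110f0f1d]); (0x160d0d1b, [::
  0x1a0d051f; 0x160d091f; 0x1a050f1d; 0x16090f1d; 0x120f0d1d; 0x150a0f1b; 0x130c0f1d; 0x110f0e1f;
  0x110f0f1e]); (0x190d0d1b, [:: 0x9190d1f; 0x19090f1d; 0x9190f1f; 0x9191f0f; 0x91b0d1f;
  0x91b1d0f]); (0x1a0d0d1b, [:: 0x1a0d091f; 0x1a090f1d; 0xa1b0d1d; 0x91a1f0f; 0x190a0f1f;
  0x801120f1f; 0x91e1b0f; 0xb180f1f; 0x91b0e1e]); (0x1c0d0d1b, [:: 0x1c090d1f; 0xc1d0b1d;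
  0x91c0f1d; 0x91c1f0f; 0x190c0f1f; 0x801140f1f; 0xd180f1f; 0x91e1d0f; 0x91d0e1e; 0x91d0e1d]);
  (0x1c0e0d1b, [:: 0x1c1a0c1f; 0x1c0e181f; 0xc1e1c1b; 0x1c0a1e1d; 0x1c0e0a1f; 0xc1e1e1b;
  0x1c180f1e; 0xc1c1b1e; 0xc1e0b1e; 0x1a0c0f1e; 0xe180f1e; 0xa1e0d1e; 0x1c180f1d; 0xc1c1b1d;
  0x181c1f0f; 0x10080c0f1f; 0x810140f1f; 0x1c180f1f; 0x1c0c1b1f; 0x804141b1f; 0xc1c1f1b;
  0x408181b1f; 0x181e1d0f; 0xa1c1f0f; 0x1a0c0f1f; 0x802140f1f; 0xe180f1f; 0xa1e0d1d; 0x1c091c1f;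
  0xc1d1c1b; 0xc1d1e1b; 0xa1d1e0f; 0x1c091d1e; 0xc1d1d1b]); (0x19150d1b, [:: 0x11190d1f;
  0x11190f1d; 0x11191f0f; 0x1001090f1f; 0x19110f1f; 0x111d1b0f; 0x110180f1f]); (0x1a150d1b, [::
  0x1a19051f; 0x1a15091f; 0x1a110f1d; 0x121b0d1d; 0x111a1f0f; 0x10010a0f1f; 0x19120f1f;
  0x111e1b0f; 0x13180f1f; 0x111b0e1e]); (0x1c150d1b, [:: 0x141d0d1b; 0x191c051f; 0x151c091f;
  0x111c0f1d; 0x111c1f0f; 0x10010c0f1f; 0x19140f1f; 0x15180f1f; 0x111d0e1e; 0x111d0e1d;
  0x111d1e0f]); (0x2160d1b, [:: 0x10060f1b; 0x4120f1b; 0x2140f1b; 0x170e1b; 0x1b170f; 0x1f031f;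
  0xf1b17; 0x170f1b]); (0x1a160d1b, [:: 0x18160f1b; 0x18170e1b; 0x18171b0f; 0x181f031f;
  0x180f1b17; 0x18170f1b]); (0x1c190d1b, [:: 0x1c19091f; 0x181d0b1d; 0x1c091b1b; 0x180f191b;
  0x1a091d1b; 0x91c1b1d; 0x91c1b1b; 0x190c1b1f; 0x801141b1f; 0x91c1f1b; 0xd181b1f; 0x91d1a1e;
  0x91d1a1d; 0x91d1a1b; 0x91d1e1b]); (0xe0e0e1b, [:: 0xe0e0a1f; 0xe0a0f1e; 0xa0f0e1e; 0xe0b0a1f;
  0xa0f0f1e]); (0x160e0e1b, [:: 0x1a0e061f; 0x160a0e1f; 0x120e0f1e; 0x120f0e1e; 0x1a07061f;
  0x160b0a1f; 0x120f0f1e]); (0x1a0e0e1b, [:: 0x1a0e0a1f; 0x1a0a0f1e; 0xa1a1f0f; 0x1a0a0f1f;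
  0x802120f1f; 0xa1e1b0f; 0x208180f1f]); (0x1c0e0e1b, [:: 0x1c0e0a1f; 0xc1e0b1e; 0xa1c0f1e;
  0xa1e0d1e; 0xa1c1f0f; 0x1a0c0f1f; 0x802140f1f; 0xe180f1f; 0xa1e0d1d; 0xa1d1e0f]); (0x1a160e1b,
  [:: 0x121a0e1f; 0x1a120f1e; 0x121a1f0f; 0x10020a0f1f; 0x1a120f1f; 0x210180f1f; 0x121b1e0f]);
  (0x1c160e1b, [:: 0x1c160a1f; 0x1a1c061f; 0x141e0b1e; 0x1a140f1e; 0x16180f1e; 0x121e0d1e;
  0x121c1f0f; 0x10020c0f1f; 0x1a140f1f; 0x16180f1f; 0x121e0d1d; 0x121d1e0f]); (0x1c1a0e1b, [::
  0x1c0a1a1f; 0x181e0b1e; 0xa1c1b1e; 0xa1e191e; 0x180e1b1b; 0x1a0c1b1f; 0x802141b1f; 0xa1c1f1b;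
  0xe181b1f; 0xa1e191d; 0xa1e191b; 0x180f1a1b; 0xa1d1e1b; 0x190a1e1b]); (0x1c1c131b, [::
  0x10000c1b1f; 0x1c101f1b; 0x181e151b; 0x141e191b; 0x1a141d1b; 0x16181d1b; 0x1c111e1b;
  0x121d1c1b; 0x1a11191f; 0x12191d1b; 0x121d191b; 0x1a15111f; 0x121d1d1b; 0x1a111b1d; 0x1a11171d;
  0x121b191d; 0x121b151d; 0x1912131f; 0x1912171b; 0x10010a171f; 0x111a1f17; 0x1912171f;
  0x111e1b17; 0x13181b1d; 0x1318171f; 0x111b161e; 0x1319181f; 0x111b1b1e]); (0x1515151b, [::
  0x1515111f; 0x1511171d; 0x1117151d; 0x1513111f; 0x1117171d]); (0x1615151b, [:: 0x1215151f;
  0x1215171d; 0x1217151d; 0x1512171b; 0x1513121f; 0x1117171e]); (0x1915151b, [:: 0x1915111f;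
  0x1119171d; 0x1119171f; 0x11191f17; 0x111b1d17; 0x1117191f]); (0x1a15151b, [:: 0x1a15111f;
  0x1a11171d; 0x121b151d; 0x10010a171f; 0x111a1f17; 0x1912171f; 0x1318171f; 0x111b161e;
  0x111b1e17]); (0x1c15151b, [:: 0x141d151b; 0x151c111f; 0x111c171d; 0x10010c171f; 0x111c1f17;
  0x1914171f; 0x1518171f; 0x111e1d17; 0x111d161e; 0x111d161d]); (0x1c16151b, [:: 0x1c1a141f;
  0x1c16181f; 0x141e1c1b; 0x1c121e1d; 0x1c12161f; 0x141e1e1b; 0x1c18171e; 0x141c1b1e; 0x141e131e;
  0x1a14171e; 0x1618171e; 0x121e151e; 0x181c171d; 0x141c1b1d; 0x10080c171f; 0x181c1f17;
  0x81014171f; 0x1c18171f; 0x10040c1b1f; 0x1c141b1f; 0x141c1f1b; 0x410181b1f; 0x10020c171f;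
  0x121c1f17; 0x1a14171f; 0x1618171f; 0x121e151d; 0x1c111c1f; 0x141d1c1b; 0x181d1e17; 0x141d1e1b;
  0x121d1e17; 0x1c111d1e; 0x141d1d1b]); (0x1c19151b, [:: 0x1c19111f; 0x181d131d; 0x18151b1b;
  0x1815171b; 0x1817191b; 0x1a111d1b; 0x111c1b1d; 0x10010c1b1f; 0x19141b1f; 0x111c1f1b;
  0x15181b1f; 0x111e1d1b; 0x111d1a1e; 0x111d1a1d; 0x111d1a1b]); (0x1616161b, [:: 0x1616121f;
  0x1612171e; 0x1217161e; 0x1613121f; 0x1217171e]); (0x1a16161b, [:: 0x1a16121f; 0x1a12171e;
  0x10020a171f; 0x121a1f17; 0x1a12171f; 0x21018171f; 0x121b1e17]); (0x1c16161b, [:: 0x1c16121f;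
  0x141e131e; 0x121c171e; 0x121e151e; 0x10020c171f; 0x121c1f17; 0x1a14171f; 0x1618171f;
  0x121e151d; 0x121e1d17]); (0x1c1a161b, [:: 0x181e161b; 0x1a141e1b; 0x1a121c1f; 0x1a121e1d;
  0x121a1d1e; 0x10000a1b1f; 0x1a101f1b; 0x121a1d1f; 0x121a171d; 0x121a1f1d; 0x121e1b1d;
  0x1a111e1b; 0x1a13141f; 0x121f181f]); (0x1c1c1c1b, [:: 0x1c1c181f; 0x1c181e1d; 0x181e1c1d;
  0x1c1a181f; 0x181e1e1d; 0x1c181d1e; 0x1c181b1e; 0x1c181b1d; 0x10080c1b1f; 0x810141b1f;
  0x181c1f1b; 0x1c181b1f; 0x181d1c1e; 0x1c19181f; 0x181d1e1b; 0x181d1d1e]); (0x2160d1d, [::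
  0x10060f1d; 0x4120f1d; 0x2140f1d; 0x170e1d; 0x1d170f; 0x1d0f17; 0x1f051f; 0x170f1d]);
  (0x1a160d1d, [:: 0x18160f1d; 0x18170e1d; 0x181d170f; 0x181f051f; 0x180f1d17; 0x18170f1d]);
  (0x21a0d1d, [:: 0x1a0f1d; 0x1b0e1d; 0x1d1b0f; 0x1f091f; 0xf1d1b; 0x1b0f1d]); (0x20e0e1d, [::
  0x80e061f; 0x40e0a1f; 0x20c0e1f; 0xe0f1e; 0xe1f0f; 0x1e0f0f; 0x8060f1f; 0x40a0f1f; 0x20c0f1f]);
  (0xe0e0e1d, [:: 0xe0e0c1f; 0xe0c0f1e; 0xc0f0e1e; 0xe0d0c1f; 0xc0f0f1e]); (0x160e0e1d, [::
  0x1c060e1f; 0x160c0e1f; 0x1c060f1e; 0x160c0f1e; 0x140f0e1e; 0x140f0e1f; 0x140f0f1e]);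
  (0x1a0e0e1d, [:: 0x180e0e1f; 0x1c0a0f1e; 0x1a0c0f1e; 0x1a0c0d1f; 0x180f0e1e; 0x1c0b0a1f;
  0x180f0f1e]); (0x1c0e0e1d, [:: 0x1c0e0c1f; 0x1c0c0f1e; 0xc1e0f1d; 0xc1d0e1e; 0xc1d1e0f;
  0xc1f0c1f; 0xc1d0f1e]); (0x2160e1d, [:: 0x816061f; 0x4160a1f; 0x2160c1f; 0x10060f1e; 0x1e071e;
  0x4120f1e; 0x2140f1e; 0x161f0f; 0x10060f1f; 0x4120f1f; 0x2140f1f; 0x171e0f]); (0x1a160e1d, [::
  0x1c160a1f; 0x1a160c1f; 0x181e071e; 0x1c120f1e; 0x1a140f1e; 0x18161f0f; 0x1008060f1f;
  0x181e170f; 0x1c120f1f; 0x1a140f1f]); (0x1c160e1d, [:: 0x1c140e1f; 0x141c0f1e; 0x141c1f0f;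
  0x10040c0f1f; 0x1c140f1f; 0x410180f1f; 0x141d1e0f]); (0x21a0e1d, [:: 0x100a0e1f; 0x8120e1f;
  0x2180e1f; 0x100a0f1e; 0x8120f1e; 0x2180f1e; 0x1a1f0f; 0x100a0f1f; 0x8120f1f; 0x1e1b0f;
  0x2180f1f]); (0x41a0e1d, [:: 0x100c0e1f; 0x81c061f; 0x4180e1f; 0x8160c1f; 0x100c0f1e; 0x8140f1e;
  0x4180f1e; 0x1c1f0f; 0x100c0f1f; 0x8140f1f; 0x4180f1f; 0x1e1d0f]); (0x1c1a0e1d, [:: 0x181c0e1f;
  0x181c0f1e; 0x181c1f0f; 0x10080c0f1f; 0x810140f1f; 0x1c180f1f; 0x181d1e0f]); (0x21a151d, [::
  0x100a171d; 0x812171d; 0x218171d; 0x1b161d; 0x1d1b17; 0x1f111f; 0x171d1b; 0x1b171d]);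
  (0x216161d, [:: 0x1016061f; 0x416121f; 0x216141f; 0x1006171e; 0x412171e; 0x214171e; 0x17161e;
  0x1007061f; 0x413121f; 0x215141f; 0x17171e]); (0x1616161d, [:: 0x1616141f; 0x1614171e;
  0x1417161e; 0x1615141f; 0x1417171e]); (0x1a16161d, [:: 0x1c16121f; 0x1a14161f; 0x1816171e;
  0x1817161e; 0x1c13121f; 0x1a15141f; 0x1817171e]); (0x1c16161d, [:: 0x1c14161f; 0x141c171e;
  0x141c171f; 0x141c1f17; 0x141d161f; 0x141d1e17]); (0x21a161d, [:: 0x101a061f; 0x41a121f;
  0x21a141f; 0x100a171e; 0x812171e; 0x1e131e; 0x218171e; 0x100a171f; 0x1a1f17; 0x812171f;
  0x1e1b17; 0x218171f]); (0x41a161d, [:: 0x101c061f; 0x41c121f; 0x100e141f; 0x816141f; 0x41a141f;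
  0x100c171e; 0x814171e; 0x418171e; 0x100c171f; 0x1c1f17; 0x814171f; 0x418171f; 0x1e1d17]);
  (0x81a161d, [:: 0x101c0c1f; 0x81c141f; 0x41c181f; 0x100c1e1d; 0x8141e1d; 0x4181e1d; 0x1e1c1d;
  0x101a0c1f; 0x81a141f; 0x41a181f; 0x1e1e1d; 0x100c1d1e; 0x8141d1e; 0x4181d1e; 0x100a1d1e;
  0x8121d1e; 0x1e191e; 0x2181d1e; 0x100c1d1f; 0x8141d1f; 0x4181d1f; 0x10081f1d; 0x8101f1d;
  0x8141b1d; 0x1c1f1d; 0x8121d1d; 0x1e191d; 0x100a1d1f; 0x8121d1f; 0x1a1f1d; 0x2181d1f;
  0x10091e1d; 0x1d1e1d; 0x1b1e1d]); (0x1c1a161d, [:: 0x181c161f; 0x1c18171e; 0x10080c171f;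
  0x181c1f17; 0x81014171f; 0x1c18171f; 0x181e1d17]); (0x21a1a1d, [:: 0x100a1a1f; 0x81a121f;
  0x2181a1f; 0x1a1b1e; 0x812131f; 0x1b1a1e; 0x100b0a1f; 0x219181f; 0x1b1b1e]); (0x41a1a1d, [::
  0x101a0c1f; 0x81a141f; 0x41a181f; 0x100a1d1e; 0x8121d1e; 0x1e191e; 0x2181d1e; 0x100a1d1f;
  0x8121d1f; 0x1a1f1d; 0x2181d1f; 0x1b1e1d]); (0x1a1a1a1d, [:: 0x1a1a181f; 0x1a181b1e; 0x181b1a1e;
  0x1a19181f; 0x181b1b1e]); (0x1c1a1a1d, [:: 0x1c1a181f; 0x1c181b1e; 0x10080c1b1f; 0x810141b1f;
  0x181c1f1b; 0x1c181b1f; 0x181d1e1b]); (0x8160d0b17, [:: 0x100c0f0b17; 0x8140f0b17; 0x4180f0b17;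
  0x81a050f17; 0x100e090f17; 0x816090f17; 0x1e0d0b17; 0x100a0f0d17; 0x8120f0d17; 0x100a0f0f17;
  0x8120f0f17; 0x21c090f17; 0x2180f0d17; 0x2180f0f17; 0x1b0e0e17; 0x1d0e0b17; 0x1b0e0d17;
  0x1d0f0b17; 0x813050f17; 0x1f090f17; 0x1b0f0d17; 0x1b17070f; 0x1b0f070f; 0x1f03170f; 0x1f030f17;
  0xf1b0717; 0xf1b170f; 0xf1b0f17; 0x1f07031f; 0xf1f031f; 0x170f0f1b; 0xf170f1b; 0x4031b0b1b;
  0x2091d0d17; 0x2051d0d1b; 0x10a1e0e17; 0x1061e0e1b]); (0x41a0d0b17, [:: 0x4181e0b17;
  0x4181e071b; 0x41c1a031f; 0x100e0c0f17; 0x41a081f17; 0x41a180f17; 0xc02101f17; 0x41a0c1b17;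
  0x41a041f1b; 0x41e001b1f; 0x1e1e0d17; 0x81616051f; 0x41a0a1d17; 0x41a16091f; 0x41a0e111f;
  0x81606171d; 0x4121e0b1d; 0x40a1e131d; 0x4160a1b1d; 0x40e121b1d; 0x10160a0f17; 0x100e120f17;
  0x816120f17; 0x10160e031f; 0x1e160b17; 0x1016060f1b; 0x41a120f17; 0x21c0c1d17; 0x2141e0b17;
  0x21a140f17; 0x216180f17; 0x2121e0d17; 0x100c0f0e17; 0x41a051e1b; 0x80617161d; 0x4061b1a1d;
  0x10120f0e17; 0x100a170e17; 0x812170e17; 0x1006170e1b; 0x4121b0e17; 0x20c1d1c17; 0x218170e17;
  0x2141b0e17; 0x100c0f0d17; 0x100c170b17; 0x100c0f0b17; 0x814170b17; 0x8140f0b17; 0x100c0f0f17;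
  0x14001b0f17; 0x4001f1317; 0x4101f0b17; 0x418170b17; 0x4180f0b17; 0x414170b17; 0x4041f1317;
  0x40c171317; 0x101a050f17; 0x100e110f17; 0x816110f17; 0x10160d031f; 0x100e0d031f; 0x1e0d0b17;
  0x1016050f1b; 0x100e050f1b; 0x1016050f17; 0x816050f17; 0x41a0d031f; 0x41a050f1b; 0x41a051717;
  0x41a050f17; 0x41619031f; 0x41609171b; 0x40e11171b; 0x416110f17; 0x416090f17; 0x40e111717;
  0x4061d131b; 0x4061d1317; 0x100a170d17; 0x812170d17; 0x1006170d1b; 0x10060f0d1b; 0x1006170d17;
  0x81607051f; 0x4120f1917; 0x40a171917; 0x412170d1b; 0x4120f0d1b; 0x412170d17; 0x4120f0d17;
  0x40a171517; 0x41613091f; 0x4160b111f; 0x4160b091f; 0x40e13111f; 0x80617171d; 0x416031b1d;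
  0x4061b1b1d; 0x10120f0f17; 0x10060f0b17; 0x100e07031f; 0x10060f0f1b; 0x41a0b031f; 0x4121b071b;
  0x41a03171b; 0x41a030f1b; 0x4121b0f17; 0x41a031717; 0x4120f131b; 0x4120f0b1b; 0x412170b17;
  0x412171b0f; 0x4120f1317; 0x4121f031f; 0x41a07031f; 0x4120f171b; 0x4120f0f1b; 0x416031b17;
  0x21c0d051f; 0x20c1d1d17; 0x20c1d071d; 0x21c110f17; 0x2141d0b17; 0x21c0d031f; 0x21c050f1b;
  0x21c051717; 0x2141b0d17; 0x214170d1b; 0x2140f0d1b; 0x2140f1517; 0x21417071d; 0x2141b170f;
  0x2141b0f17; 0x2141f031f; 0x2140f0b17; 0x21c07031f; 0x214170f1b; 0x2140f0f1b; 0x21615051f;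
  0x216051d17; 0x1b160e17; 0x17160e1b; 0x170e0e1b; 0x413061e1b; 0x100d0c0f17; 0x1d160b17;
  0x1d0e0b17; 0x100d060f17; 0x4111e0b17; 0x415021f17; 0x4130c171f; 0x4031c1f17; 0x4130c0f17;
  0x40b141717; 0x40b14171f; 0x407181b17; 0x41700171f; 0x40718171f; 0x4031e151d; 0x1b160d17;
  0x17160d1b; 0x170e0d1b; 0x17160d17; 0x4031e1917; 0x4031e1d17; 0x170e0b17; 0x4130a171b;
  0x4130a0f1b; 0x413120f17; 0x4130a1717; 0x4130a0f17; 0x413060f17; 0x2150c0f1d; 0x20d140f1d;
  0x219140f17; 0x215180f17; 0x2051c1f0f; 0x2150c0f1f; 0x20d140f1f; 0x601180f1f; 0x215061d17;
  0x21506171d; 0x215060f17; 0x4031d161e; 0x2051d0e1e; 0x100d0d061f; 0x100d07061f; 0x415031e17;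
  0x413130a1f; 0x4130b0a1f; 0x413031e1b; 0x41313061f; 0x413031e1f; 0x4130b061f; 0x41307061f;
  0x2051d0e1d; 0x2111d0e17; 0x2051d1e0f; 0x601111e1f; 0x205171c17; 0x20517161d; 0x21507061f;
  0x20715141f; 0x100d050f1e; 0x10050f0d1e; 0x10050f0f1e; 0x413031b1e; 0x4031b131e; 0x4031b1b1e;
  0x41303171e; 0x403131f1e; 0x40317131e; 0x403171b1e; 0x40317171e; 0x20517171e; 0x1d170b17;
  0x10050f071b; 0x10050f0f1b; 0x41913031f; 0x4190b031f; 0x41903171b; 0x419030f1b; 0x419031717;
  0x411170b1b; 0x4110f131b; 0x4110f0b1b; 0x411170b17; 0x4110f1317; 0x41907031f; 0x4110f0f1b;
  0x415031b1b; 0x415031b17; 0x170d0d1b; 0x100b050f17; 0x1b1d0717; 0x1f110f17; 0x1007050f1b;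
  0x413090f1b; 0x413110f17; 0x413091717; 0x413090f17; 0x413051b1b; 0x413050f17; 0x1b170d17;
  0x17170d1b; 0x41313091f; 0x4130b091f; 0x41313051f; 0x413031d1f; 0x4130b051f; 0x41307051f;
  0x413031b1d; 0x4031b131d; 0x4031b1b1d; 0x41303171d; 0x403131f1d; 0x413030f1d; 0x4031b171d;
  0x40317131d; 0x40317171d; 0x1b170717; 0x171b070f; 0x1f031717; 0x1f03170f; 0x17171b0f;
  0x171f031f; 0x170f1b17; 0x1f07031f; 0xf170b17; 0x17170f1b; 0x170f0f1b; 0x413031b1b; 0x4031b131b;
  0x4031b1b1b; 0x4031b0b17; 0x2111d0d17; 0x215091d17; 0x601111d1f; 0x2051d0b17; 0x1121e0e17;
  0x1160a1e17; 0x502121e1f; 0x11c0e031f; 0x11c060f1b; 0x1160c0f1b; 0x11616051f; 0x502121d1f;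
  0x11606171d; 0x1061e0b17; 0x1140f0e1b; 0x10617161d; 0x11c07031f; 0x1140f0f1b; 0x116050f17;
  0x11607051f; 0x10617171d]); (0x41c130b17, [:: 0x41817071b; 0x41c13031f; 0x41c031717;
  0x40c171317; 0x1016050f17; 0x41a110f17; 0x41a15031f; 0x416011f17; 0x416110f17; 0x416091717;
  0x40e111717; 0x1006170d17; 0x41a13051f; 0x412170d17; 0x416031d17; 0x4061b1517; 0x41a03171d;
  0x412170b1d; 0x4120f131d; 0x416031b1d; 0x412170b17; 0x41906171b; 0x419061717; 0x419060f17;
  0x4150a1717; 0x4150a0f17; 0x4051e1317; 0x41700171f; 0x407181717; 0x17160d17; 0x413061b1d;
  0x1007060f17; 0x413120f17; 0x215140f17; 0x411170e1b; 0x4110f161b; 0x4110f1617; 0x4110f0e17;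
  0x415031e1b; 0x405171a1b; 0x413051e1b; 0x413051e1f; 0x4130d061f; 0x407111e1f; 0x403171c1d;
  0x41307181f; 0x17170e17; 0x403151f1e; 0x413050f1e; 0x4031d171e; 0x40317191e; 0x411170b17;
  0x1007050f17; 0x413110f17; 0x17170d17; 0x170f0717; 0xf171717; 0x4031b1b17; 0x215051d17;
  0x2051d1517; 0x502141e1f; 0x116061e17; 0x1061e1617]); (0x81c130b17, [:: 0x8001f1317;
  0x8101f0b17; 0x18000f1b17; 0x818170b17; 0x8081f1317; 0x81c13031f; 0x80c1b1317; 0x81c03171b;
  0x8041f131b; 0x8140f131b; 0x80c17131b; 0x10041f0b17; 0x814170b17; 0x8041f1317; 0x80c171317;
  0xc001b171b; 0x14001b0f17; 0xc001b1717; 0x418170b17; 0x81a011f17; 0x8121d0b17; 0x101a050f17;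
  0x81a050f17; 0x100e110f17; 0x816011f17; 0x816091717; 0x816090f17; 0x10061d0b17; 0x1e150b17;
  0x816051b17; 0x81a031d17; 0x100a170d17; 0x812170d17; 0x8120f0d17; 0x1e1b0717; 0x4121b0b17;
  0x2141d0b17; 0x8091e1317; 0x819061717; 0x8150a1b17; 0x80d121b17; 0x80d121717; 0x1d160b17;
  0x8051e1317; 0x81b00171f; 0x8130c171f; 0x8031c1f17; 0x8130c0f17; 0x80b14171f; 0x81700171f;
  0x80718171f; 0x8031e151d; 0x1b160d17; 0x8031e1d17; 0x10070a0f17; 0x1f120f17; 0x171e0b17;
  0x219140f17; 0x8031d161e; 0x809171617; 0x8051b1a17; 0x171b0e17; 0x2111d0e17; 0x1d170b17;
  0x100b050f17; 0x1b1d0717; 0x1f110f17; 0x1b170d17; 0x171b0717; 0x171b070f; 0x171b170f;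
  0x171b0f17; 0x1f03170f; 0x1f030f17; 0xf1b0717; 0x171f031f; 0x1f07031f; 0x170f171b; 0xf17171b;
  0x4031b131b; 0x2111d0d17; 0x2051d151b; 0x1061e161b]); (0x81a190b17, [:: 0x80010041f17;
  0x81c081f17; 0x81c1c031f; 0x81c041f1b; 0xc18001b1f; 0x8181e0d17; 0x80c1e1917; 0x8141e0d1b;
  0x80c1e151b; 0x81c0a0f17; 0x81c0e031f; 0x80c1e071b; 0x81a0c1d17; 0x80e181d17; 0x8160c1d1b;
  0x80e141d1b; 0x81a0c0f17; 0x8160c0f1b; 0x80e140f1b; 0x81a0e051f; 0x8061e0d1b; 0x80a1e071d;
  0x8160a0f1d; 0x80e120f1d; 0x8061e0b1d; 0x81c091e17; 0x81c051e1b; 0x8180f0e17; 0x80a1d1c17;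
  0x8061d1c1b; 0x8061d0e1b; 0x8061b0e1d; 0xc001b1d1b; 0x4081f191b; 0x4180f191b; 0x18001b0f1b;
  0x8001f131b; 0x8101f0b1b; 0x8081f131b; 0x8180f0f17; 0x8141b0b1b; 0x80c1b131b; 0x81c07031f;
  0x100c0f0f1b; 0x8140f0f1b; 0x4081f0b1b; 0x4180f0b1b; 0xc000f1b1b; 0x40c1b0b1b; 0x40c1b1b1b;
  0x81a15091f; 0x81a0d111f; 0x80a1d1917; 0x81a051d1b; 0x80a1d1d17; 0x1e0d0d1b; 0x41a0d091f;
  0x81a110f1d; 0x81a09171d; 0x41a090f1d; 0x81a19031f; 0x81a011f1b; 0x80e110f17; 0x8061d1b0f;
  0x80e15031f; 0x80e05171b; 0x8121b0d1d; 0x80a1b151d; 0x40a1b0d1d; 0x81a031d1b; 0x80e13051f;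
  0x8061f091f; 0x8060f1d1b; 0x8061b0f1d; 0x20c1d1d1b; 0x1d0e0e1b; 0x4091e1e1b; 0xf1c1c1b;
  0x8070c1e1b; 0x4191a091f; 0x4190a1d1b; 0x4091e191b; 0x4190a1b1d; 0x8111a1f0f; 0x18010a0f1f;
  0x819120f1f; 0x8190a171f; 0x8091a1f17; 0x8000112171f; 0x4190a0f1b; 0x4091a1f0f; 0x4190a0f1f;
  0xc01120f1f; 0x81b001b1f; 0x813180f1f; 0x80b18171f; 0x40b180f1f; 0x8111b0e1e; 0x8091b161e;
  0x4091b0e1e; 0x4190b181f; 0x8111b1e0f; 0x8091b1e17; 0x4190b0a1f; 0x4091b1e0f; 0x4091b191e;
  0x4091b1b1e; 0x10c1e1e1b]); (0x41a191917, [:: 0x101c1c031f; 0x101c140f1b; 0x101c061d1b;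
  0x100c1e151b; 0x100e141d1b; 0x10141d0e1b; 0x10140f1c1b; 0x10061d1c1b; 0x14001d1b1b; 0x4181d131b;
  0x41c111b1b; 0x4181b1917; 0x4181b151b; 0x4101f191b; 0x101c07031f; 0x100c17171b; 0x81417171b;
  0x1400171b1b; 0x4101f131b; 0x4141b1b1b; 0x1e15151b; 0x41a111d1b; 0x4121d151b; 0x41619111f;
  0x416111b1d; 0x4121d131b; 0x41217191d; 0x2141d1d1b; 0x10150c1e1b; 0x1d16161b; 0x4111e1e1b;
  0x171c1c1b; 0x419181b17; 0x41918171b; 0x4111e191b; 0x419121b17; 0x41912171b; 0x1401061b1f;
  0x411161f1b; 0x415121b1f; 0x413141b1f; 0x411171a1e; 0x41919121f; 0x41913121f; 0x411171e1b;
  0x419111b1e; 0x4111b191e; 0x4111b1b1e; 0x1141e1e1b]); (0x81a191917, [:: 0x101a180f1b;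
  0x101a0c1b1b; 0x100e181b1b; 0x101a1a091f; 0x100a1e191b; 0x101a0a1b1d; 0x10181b0e1b;
  0x10180f1a1b; 0x100c1b1a1b; 0x100a1b1a1d; 0x18001d1b1b; 0x8181d131b; 0x81c111b1b; 0x8181b1917;
  0x8181b151b; 0x8101f191b; 0x10081f0b1b; 0x1800171b1b; 0x8101f131b; 0x18000f1b1b; 0x81817131b;
  0x81817171b; 0x100c1b0b1b; 0x8141b131b; 0x4181b1b1b; 0x81a111d1b; 0x101a0d091f; 0x8121d1917;
  0x81a15111f; 0x100a1d1d1b; 0x1e19191b; 0x101a090f1d; 0x81a11171d; 0x101a090f1b; 0x100a1b0d1d;
  0x8121b151d; 0x101a0b091f; 0x100a1b1b1d; 0x2181d1d1b; 0x10190a1e1b; 0x8111e1e1b; 0x1d1a1a1b;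
  0x1b1c1c1b; 0x819181b17; 0x81918171b; 0x8111e191b; 0x819121b17; 0x81912171b; 0x10091a1f0f;
  0x10190a0f1f; 0x1801120f1f; 0x18010a171f; 0x8111a1f17; 0x81912171f; 0x100b180f1f; 0x81318171f;
  0x10091b0e1e; 0x8111b161e; 0x81919121f; 0x81913121f; 0x10091b1e0f; 0x8111b1e17; 0x819111b1e;
  0x8111b191e; 0x8111b1b1e; 0x1181e1e1b]); (0x81c191917, [:: 0x101c1c091f; 0x101c0c1d1b;
  0x101c180f1d; 0x101c0a1d1d; 0x100c1e191d; 0x100e181d1d; 0x100c1d1c1b; 0x10181d0e1d;
  0x10180f1c1d; 0x100a1d1c1d; 0x8181d1917; 0x101c0d091f; 0x100c1d1d1b; 0x18001d1b1d; 0x8181d131d;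
  0x18001d171d; 0x81c111b1d; 0x100c1d0b1d; 0x101c090f1b; 0x81c11171b; 0x100c1d0b1b; 0x8141d131b;
  0x8181b151d; 0x8101f191d; 0x8101f151d; 0x8141b151d; 0x101c0b091f; 0x81c13111f; 0x100c1b1b1d;
  0x8141b1b1d; 0x4181b1b1d; 0x81a111d1d; 0x8121d1d1d; 0x1e19191d; 0x2181d1d1d; 0x10190c1e1d;
  0x1d1a1a1d; 0x1b1c1c1d; 0x819181d17; 0x819141d17; 0x81918171d; 0x10190c0f1d; 0x81914171d;
  0x100d180f1d; 0x819141b17; 0x10091c1f0f; 0x10190c0f1f; 0x1801140f1f; 0x18010c171f; 0x8111c1f17;
  0x81914171f; 0x100d180f1f; 0x81518171f; 0x8111e191d; 0x8111e151d; 0x8111e1d17; 0x10091d0e1e;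
  0x8111d161e; 0x81919141f; 0x81915141f; 0x10091d0e1d; 0x8111d1a17; 0x10091d1e0f; 0x819111d1e;
  0x8111d191e; 0x8111d1d1e; 0x1181e1e1d]); (0x81c1a1a17, [:: 0x8181e1c17; 0x101c1a0c1f;
  0x81c1a141f; 0x101c0e181f; 0x100c1e1c1b; 0x101c0a1e1d; 0x81c121e1d; 0x8141e1a1d; 0x8181e1e17;
  0x101c0e0a1f; 0x81c16121f; 0x100c1e1e1b; 0x8141e1e1b; 0x8161c181f; 0x101c180f1e; 0x101c0c1b1e;
  0x8181e151e; 0x100c1e0b1e; 0x8141e131e; 0x81a141d1e; 0x816181d1e; 0x101a0c0f1e; 0x81a14171e;
  0x100e180f1e; 0x81618171e; 0x100a1e0d1e; 0x8121e151e; 0x101c0a0f1b; 0x81c12171b; 0x100c1e0b1b;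
  0x8141e131b; 0x81618171b; 0x100e0c1b1b; 0x101a0e091f; 0x81a16111f; 0x100a1e0d1b; 0x8121e151b;
  0x100a1e1d0f; 0x8121e1d17; 0x100e0a1d1b; 0x100a1e0b1d; 0x8121e131d; 0x100e0a1b1d; 0x816121b1d;
  0x10181d0e1e; 0x100c1d1a1e; 0x81817161e; 0x8141b161e; 0x8121d1c1e; 0x100a1d0e1e; 0x100c1b0e1b;
  0x8141b161b; 0x100e091e1b; 0x100a1f0c1f; 0x8121f141f; 0x100a0f1e1d; 0x812171e1d; 0x100a1d0f1e;
  0x100e091b1e; 0x812171d1e; 0x1e1b191e; 0x2181d1d1e; 0x10190c1e1e; 0x100d181e1e; 0x10091e1c1e;
  0x8111e161e; 0x1b1c1c1e; 0x813141e1e; 0x100d1a0a1f; 0x8151a121f; 0x100d0a1b1e; 0x815121b1e;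
  0x1f181b1e; 0x1d1b1a1e; 0x1181e1e1e]); (0x21a150b1b, [:: 0x100c170b1b; 0x814170b1b; 0x418170b1b;
  0x101a050f1b; 0x100e110f1b; 0x816110f1b; 0x1e150b1b; 0x100a170d1b; 0x812170d1b; 0x100a170b1b;
  0x812170b1b; 0x1e1b0b17; 0x1e170b1b; 0x218170b1b; 0x1d160b1b; 0x1b160d1b; 0x1b160b1b;
  0x1b1e130f; 0x100b060f1b; 0x1f1a031f; 0x1f120f1b; 0x219140f1b; 0x1b170e1b; 0x1d170b1b;
  0x100b050f1b; 0x1b1d071b; 0x1f110f1b; 0x1b170d1b; 0x1b1b0f17; 0x1b170b1b; 0x1b171b0f;
  0x1b1f031f; 0x1b0f171b; 0x1f031b1b; 0x219051d1b; 0x11a061e1b]); (0x41c150b1b, [:: 0x101c050f1b;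
  0x41c110f1b; 0x100c170d1b; 0x814170d1b; 0x418170d1b; 0x418170b1b; 0x1e150d1b; 0x100e050f1b;
  0x1e1d071b; 0x41a110f1b; 0x1e170d1b; 0x1d160d1b; 0x100d060f1b; 0x419120f1b; 0x1f140f1b;
  0x1d170e1b; 0x100d050f1b; 0x419110f1b; 0x1d170d1b; 0x1d171b0f; 0x1d1f031f; 0x1d0f1b17;
  0x1d0f171b; 0x419031b1b; 0x1b1d150f; 0x1f111d0f; 0xf1d1917; 0x1f051d1b; 0x11c061e1b]);
  (0x41c160b1b, [:: 0x101c060f1b; 0x41c120f1b; 0x10160c0f1b; 0x100e140f1b; 0x10061e0d1b;
  0x100e060f1b; 0x41a120f1b; 0x10140f0e1b; 0x814170e1b; 0x418170e1b; 0x1e150e1b; 0x1e1b160f;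
  0x1e1b0e17; 0x1e170e1b; 0x101c050f1b; 0x14001d0f1b; 0x10041f0d1b; 0x8141b170f; 0x8141b0f17;
  0x8141f031f; 0x10140f0f1b; 0x814170f1b; 0x4181b0f17; 0x418171b0f; 0x4181f031f; 0x418170f1b;
  0x1e150d1b; 0x1e1b170f; 0x1e1f031f; 0x1e0f1b17; 0x1e170f1b; 0x1f0a1e17; 0x10051e0d1b]);
  (0x41c160d1b, [:: 0x81c16051f; 0x41c16091f; 0x101c060f1d; 0x100c1e071d; 0x8141e071d;
  0x4181e071d; 0x41c120f1d; 0x100e140f1d; 0x816140f1d; 0x41a140f1d; 0x1e160d1d; 0x100e0e051f;
  0x41a1a051f; 0x41a16091f; 0x100e060f1d; 0x41a120f1d; 0x21c1c051f; 0x21c140f1d; 0x100c170e1d;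
  0x814170e1d; 0x418170e1d; 0x1e170e1d; 0x100c0f071d; 0x4181b071d; 0x1e1d150f; 0x1e1d0d17;
  0x41a15091f; 0x100e050f1d; 0x41a110f1d; 0x1e1d170f; 0x1e170d1d; 0x1e1f051f; 0x1e0f1d17;
  0x41a13091f; 0x1e170f1d; 0x1d160e1d; 0x1d1e160f; 0x1d1e0e17; 0x1f0c1e17; 0x41916091f;
  0x100d060f1d; 0x419120f1d; 0x1f1c051f; 0x1f140f1d; 0x1d170e1d]); (0x81c160d1b, [:: 0x41c180f1b;
  0x101c0e091f; 0x81c16091f; 0x41c1a091f; 0x8181e071d; 0x101c0a0f1d; 0x81c120f1d; 0x4181e0b1d;
  0x101a0c0f1d; 0x81a140f1d; 0x41a180f1d; 0x100e0c0f1b; 0x816140f1b; 0x41a180f1b; 0x100a1e0d1d;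
  0x8121e0d1d; 0x1e1a0d1d; 0x81a16051f; 0x100e0e091f; 0x81616091f; 0x1e1e0d1b; 0x8121e071d;
  0x100e0a0f1d; 0x816120f1d; 0x21c1c091f; 0x21c180f1d; 0x4181d0e1b; 0x10180f0e1d; 0x818170e1d;
  0x4181b0e1d; 0x1e1d0e1b; 0x1e1b0e1d; 0x81c19051f; 0x101c0d091f; 0x81c15091f; 0x101c090f1d;
  0x81c110f1d; 0x4181d1b0f; 0x4181d0f1b; 0x10081f0d1d; 0x8101f0d1d; 0x818171d0f; 0x8181f051f;
  0x8180f1d17; 0x101c0b091f; 0x81c13091f; 0x4181f091f; 0x10180f0f1d; 0x8180f171d; 0x81c031b1d;
  0x4181b0f1d; 0x81a051d1d; 0x1e190d1d; 0x1e1d0f1b; 0x1e1b1d0f; 0x81613051f; 0x1e1f091f;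
  0x1e1b0f1d; 0x819061e1d; 0x1d1e1a0f; 0x1f181e0f; 0x10091e0d1d; 0x8111e0d1d]); (0x101c160d1b, [::
  0x81c1c121f; 0x81c141e1b; 0x8141e1c1b; 0x81c16121f; 0x8141e1e1b; 0x81c18171e; 0x81c121d1e;
  0x8141e191e; 0x8141e131e; 0x816181d1e; 0x81a14171e; 0x81618171e; 0x8121e151e; 0x81c1c111f;
  0x81c141d1b; 0x18000c1f1d; 0x81c101f1d; 0x18080c171f; 0x8181c1f17; 0x8001014171f; 0x81c18171b;
  0x81c18171f; 0x101c0c171b; 0x81c14171b; 0x8141e191d; 0x8181e1d17; 0x81c121d1b; 0x101c1a051f;
  0x18040a1d1f; 0x81c121d1f; 0x101c16091f; 0x100c1e151b; 0x8141e151b; 0x4181e151b; 0x41c1a111f;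
  0x101c120f1d; 0x8141a1f1d; 0x8141e1b1d; 0x4181e131d; 0x101c021f1b; 0x100c1e131b; 0x816181d1d;
  0x816181d1b; 0x101e001d1f; 0x816181d1f; 0x1e1c151b; 0x101a041f1d; 0x101a140f1d; 0x81a14171d;
  0x41a18171d; 0x101e001b1f; 0x81618171b; 0x1e1c131b; 0x100e0c171b; 0x41a18171b; 0x100a1e151d;
  0x8121e151d; 0x1e1a151d; 0x81a16111f; 0x8121e151b; 0x8121e1d17; 0x10160e091f; 0x81616111f;
  0x1e1e151b; 0x8121e131d; 0x101a060f1d; 0x100a1e071d; 0x816121b1d; 0x100e120f1d; 0x81612171d;
  0x10061e0b1d; 0x101a060f1b; 0x1016120f1b; 0x10160a171b; 0x100e12171b; 0x100e120f1b;
  0x100e0a171b; 0x81612171b; 0x10061e131b; 0x1e1e131b; 0x41a121b1b; 0x21c1c111f; 0x21c141d1b;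
  0x21c18171d; 0x8121d161e; 0x8141d1c1b; 0x81c111e1d; 0x8181d161b; 0x100c1d161b; 0x8141d161b;
  0x818171c1b; 0x1018170e1d; 0x81817161d; 0x4181b161d; 0x101c031e1b; 0x100c0f161b; 0x4181b161b;
  0x8121d1c1b; 0x101a051e1d; 0x81619121f; 0x8121f141f; 0x100a170e1d; 0x81217161d; 0x812171e1d;
  0x1012170e1b; 0x10120f161b; 0x100a17161b; 0x100a170e1b; 0x100a0f161b; 0x81217161b; 0x4121b1a1b;
  0x2141d1c1b; 0x2181d161d; 0x8121d171e; 0x101c19051f; 0x101c0d111f; 0x81c15111f; 0x101c051d1b;
  0x8141d1d1b; 0x101c09171d; 0x81c11171d; 0x10181d0f17; 0x101c09171b; 0x100c1d131b; 0x4181d131b;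
  0x4181d1b17; 0x4181d171b; 0x10081f151d; 0x8101f151d; 0x81817191b; 0x81817151b; 0x1018171d0f;
  0x10181f051f; 0x8141b191b; 0x101c0b111f; 0x81c13111f; 0x4181f111f; 0x8181b131d; 0x1018170f1d;
  0x81817171d; 0x101c031b1d; 0x4181b171d; 0x10081f131b; 0x1800171b1b; 0x81817131b; 0x101c031b1b;
  0x8141b131b; 0x10041f131b; 0x10140f131b; 0x100c0f131b; 0x81417131b; 0x100c17171b; 0x4181b131b;
  0x14001b171b; 0x41817131b; 0x41817171b; 0x101a051d1d; 0x1e19151d; 0x81a19111f; 0x81a111d1b;
  0x8121d1d1b; 0x81615111f; 0x1e15151b; 0x81611171d; 0x101a09171b; 0x81a11171b; 0x101a05171b;
  0x100e111b1b; 0x816111b1b; 0x1016011f1b; 0x100e11171b; 0x81611171b; 0x100e09171f; 0x1e191f17;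
  0x81611171f; 0x10061d131b; 0x1e15131b; 0x1e1d1b17; 0x41a111b1b; 0x81217151d; 0x1e1b151d;
  0x101a0b111f; 0x81a13111f; 0x100a17151b; 0x81217151b; 0x1e13191b; 0x1016031d1b; 0x100a1b131d;
  0x8121b131d; 0x101a03171b; 0x100a17131b; 0x81217131b; 0x1e13131b; 0x4121b1b1b; 0x2141d1d1b;
  0x21c11171b; 0x2181b151b; 0x21817191b; 0x21817151b; 0x2181b131d; 0x21817171b; 0x21a111d1b;
  0x21a111b1d; 0x2121b191d; 0x819141e1b; 0x1d1c161b; 0x1d1e1a17; 0x1d16161b; 0x1d1e161b;
  0x1f1c121f; 0x1f1a141f; 0x100b061e1d; 0x1b1e161d; 0x1013061e1b; 0x1b16161b; 0x100b061e1b;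
  0x1f18171e; 0x81518171b; 0x1d1c131b; 0x10091e151d; 0x8111e151d; 0x8111e191b; 0x8111e151b;
  0x819121b1d; 0x81912171b; 0x10091e131b; 0x8111e1b17; 0x815121b1b; 0x81512171b; 0x1d16131b;
  0x1d1e131b; 0x813181d1b; 0x813141d1b; 0x81314171d; 0x1017001b1f; 0x1f18171f; 0x1b16151b;
  0x1b1a131d; 0x1b16131b; 0x219121d1b; 0x21912171b; 0x213181b1d; 0x81915121f; 0x8111d161b;
  0x81913181f; 0x8111b1c1b; 0x81913121f; 0x8111f121f; 0x811171e1b; 0x81513121f; 0x81315141f;
  0x2111b1c1b; 0x2111b161b; 0x21319181f; 0x21319121f; 0x81911171e; 0x8111b191e; 0x8111b151e;
  0x8111b1b1e; 0x8111b171e; 0x81117171e; 0x2111b131e; 0x2111b1b1e; 0x81511171b; 0x100d051b1b;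
  0x1d1d131b; 0x419111b1b; 0x81117151b; 0x10051b0d1b; 0x10050f191b; 0x4111b191b; 0x101903171b;
  0x10110f131b; 0x81117131b; 0x81117171b; 0x1015031b1b; 0x100d03171b; 0x1d17131b; 0x1d17171b;
  0x1007091d1b; 0x171d1d1b; 0x101309171b; 0x100b11171b; 0x1b15131b; 0x100b05171b; 0x1f11171b;
  0x10031b151b; 0x1b17151b; 0x1b17171b; 0x1007031b1b; 0x171b131b; 0x2111d131b; 0x11c141e1b;
  0x1141e1c1b; 0x11a121b1d; 0x1121e131b; 0x1121b1a1d; 0x11a11171b; 0x11a13111f; 0x1121b1b1d])]%num.

Definition certificate_trie : trie :=
  trie_of [seq (decode c.1, [seq decode h | h <- c.2]) | c <- certificates].

Definition survivors : seq word := search certificate_trie (columns 5) 6 62 [::].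

Lemma certificates_valid : trie_all (certifies 5) certificate_trie.
Proof. by vm_compute. Qed.

Lemma survivors_count : size survivors <= 1175.
Proof. by vm_compute. Qed.

(** * Functionals in five variables and degree 62 *)

(** The r by n matrices of rank r in reduced echelon form, with their pivot
    positions, listed by columns; k pivots have already been placed.  Columns
    come first because the column of index j is the linear form substituted for
    the variable of index j. *)
Fixpoint echelon (r n k : nat) : seq (seq bitseq * seq nat) :=
  if n is n'.+1 then
    [seq ((c ++ nseq (r - k) false) :: M.1, map succn M.2)
    | c <- columns k, M <- echelon r n' k] ++
    (if k < r then
       [seq ((nseq k false ++ true :: nseq (r - k.+1) false) :: M.1, 0 :: map succn M.2)
       | M <- echelon r n' k.+1]
     else [::])
  else if k == r then [:: ([::], [::])] else [::].

(** The componentwise order on column sets of the same size, under which standard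
    monomials in minors are chains.  The counter d is the number of elements of
    the first set met so far, less those of the second. *)
Fixpoint dominates (d : nat) (A B : column) : bool :=
  match A, B with
  | a :: A', b :: B' =>
      if a + d < b then false else dominates (a + d - b) A' B'
  | _, _ => true
  end.

(** Continuations by k columns of a chain at A.  Minors take values in F_2, where
    x^2 = x, so a chain is strict until it becomes constant. *)
Fixpoint chains_from (cols : seq column) (k : nat) (A : column) : seq word :=
  if k is k'.+1 then
    nseq k A ::
    flatten [seq [seq B :: t | t <- chains_from cols k' B]
            | B <- cols & dominates 0 A B && (A != B)]
  else [:: [::]].

Definition of_weight r := [seq A <- columns 5 | weight A == r].

Definition chains r k : seq word :=
  flatten [seq [seq A :: t | t <- chains_from (of_weight r) k.-1 A] | A <- of_weight r].

Definition only i : column := [seq x == i | x <- iota 0 5].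
Definition all_but j : column := [seq x != j | x <- iota 0 5].

(** The spike (31, 31); on a test word the value is a product of five minors of
    size two. *)
Definition plane_block : block := Block
  [:: pad 5 6 (nseq 5 [:: true; true])]
  [seq M.1 | M <- echelon 2 5 0]
  [seq [:: pad 5 6 t] | t <- chains 2 5].

(** For a 3-space with pivot i and a position j that is not a pivot, the rows are
    the basis vector with pivot i, the two others, and the unit vector at the
    remaining position j' without pivot.  The hyperplane they span is the kernel
    of a form with coefficient one at j and zero at the positions beyond j. *)
Definition flag_substitution i j (M : seq bitseq * seq nat) : seq bitseq :=
  let a := index i M.2 in
  let j' := head 0 [seq x <- iota 0 5 | (x != j) && (x \notin M.2)] in
  [seq let c := nth [::] M.1 k in nth false c a :: take a c ++ drop a.+1 c ++ [:: k == j']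
  | k <- iota 0 5].

(** The spike (31, 15, 15, 1).  On a test word the value is the product of a
    coordinate of the hyperplane, three minors of the 3-space and a coordinate
    of the line.  The coordinates of the line before its pivot i vanish, and so
    do those of the hyperplane after j; hence the order of the blocks, by
    decreasing j and then increasing i. *)
Definition flag_block i j : block := Block
  [:: pad 5 6 [:: nseq 4 true; nseq 3 true; nseq 3 true; nseq 3 true; [:: true]]]
  [seq flag_substitution i j M | M <- echelon 3 5 0 & (i \in M.2) && (j \notin M.2)]
  [seq [:: pad 5 6 (all_but j :: t ++ [:: only i])] | t <- chains 3 3].

(** Exponent vectors whose first entry is 31.  They represent the product of the
    31st divided power of a vector with a class of degree 31 in four variables
    that is annihilated by the squares.  Unlike the functionals from the two
    spikes, those obtained here do not vanish on exotic_tests. *)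
Definition exotic_terms : seq N := [::
  0x119150d0f; 0x115190d0f; 0x1190d150f; 0x10d19150f; 0x1150d190f; 0x10d15190f; 0x1190d0b17;
  0x10d190b17; 0x1190b0d17; 0x1190d0d17; 0x10b190d17; 0x10d190d17; 0x119190d17; 0x10d0b1917;
  0x10b0d1917; 0x10d0d1917; 0x1190d1917; 0x10d191917; 0x1190d071b; 0x10d19071b; 0x1150d0b1b;
  0x10d150b1b; 0x119070d1b; 0x1150b0d1b; 0x10b150d1b; 0x119150d1b; 0x107190d1b; 0x115190d1b;
  0x10d0b151b; 0x10b0d151b; 0x1190d151b; 0x10d19151b; 0x10d07191b; 0x1070d191b; 0x1150d191b;
  0x10d15191b; 0x1190b071d; 0x10b19071d; 0x11919071d; 0x119070b1d; 0x1150b0b1d; 0x1150d0b1d;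
  0x10b150b1d; 0x10d150b1d; 0x119150b1d; 0x107190b1d; 0x115190b1d; 0x1150b0d1d; 0x1130d0d1d;
  0x10d130d1d; 0x10b150d1d; 0x10d0d131d; 0x10b0b151d; 0x10d0b151d; 0x1190b151d; 0x10b0d151d;
  0x10b19151d; 0x10b07191d; 0x11907191d; 0x1070b191d; 0x1150b191d; 0x10b15191d; 0x10719191d;
  0x1091f0b17; 0x1091f0d17; 0x1091f1917; 0x1091f071b; 0x1051f0b1b; 0x1091f151b; 0x1051f191b;
  0x1091f071d; 0x1031f0d1d; 0x1111f0d1d; 0x1051f191d; 0x10b091f17; 0x10d091f17; 0x119091f17;
  0x10b051f1b; 0x119051f1b; 0x107091f1b; 0x115091f1b; 0x10d031f1d; 0x119051f1d; 0x107091f1d;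
  0x10d111f1d; 0x1110f1f0f; 0x109171f0f; 0x1051b1f0f; 0x1031d1f0f; 0x1111d1f0f; 0x1090f1f17;
  0x1091b1f17; 0x109171f1b; 0x1051b1f1b; 0x1051d1f1b; 0x1051b1f1d]%num.

(** A permutation matrix whose first two vectors are the unit vectors at i and j;
    for l > 0 the l-th vector is added to the first. *)
Definition exotic_substitution i j l : seq bitseq :=
  let r := i :: j :: [seq x <- iota 0 5 | (x != i) && (x != j)] in
  [seq ((k == i) || (l != 0) && (k == nth 0 r l)) :: [seq k == x | x <- behead r]
  | k <- iota 0 5].

(** Differences of words with triples p, p, q and p, q, q.  A product of minors
    takes the same value on both, since p^2 q = p q^2 over F_2, so the flag
    functionals vanish on them.  The condition on i and j keeps enough of these
    tests to detect the exotic functionals. *)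
Definition exotic_tests i j : seq (seq word) :=
  [seq [:: pad 5 6 [:: all_but j; p.1; p.1; p.2; only i];
           pad 5 6 [:: all_but j; p.1; p.2; p.2; only i]]
  | p <- [seq (A, B) | A <- of_weight 3, B <- of_weight 3]
  & [&& weight (andc p.1 p.2) == 1, code p.1 < code p.2 &
        let ij := xorc (only i) (only j) in subc ij p.1 || subc ij p.2]].

Definition distinct_pairs : seq (nat * nat) :=
  [seq (i, j) | i <- iota 0 5, j <- [seq j <- iota 0 5 | j != i]].

Definition exotic_block : block := Block
  [seq pad 5 6 (decode x) | x <- exotic_terms]
  [seq exotic_substitution p.1 p.2 l | p <- distinct_pairs, l <- iota 0 4]
  (flatten [seq exotic_tests p.1 p.2 | p <- distinct_pairs]).

Definition blocks : seq block :=
  [:: plane_block, exotic_block &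
      [seq flag_block i j | j <- rev (iota 0 5), i <- [seq i <- iota 0 5 | i != j]]].

Lemma blocks_valid : blocks_ok 5 6 62 [::] blocks.
Proof. by vm_compute. Qed.

Lemma blocks_rank : 1105 <= sumn (map (block_rank 5) blocks).
Proof. by vm_compute. Qed.

Theorem mainTheorem4 :
  (1105 <= \dim {: quotv (hits : {vspace dhomog 5 'F_2 62})} <= 1175)%N.
Proof.
have lt_d : (62 < 2 ^ 6)%N by [].
have le_dim := dim_quotient_ge lt_d blocks_valid.
apply/andP; split; first exact: leq_trans blocks_rank le_dim.
apply: leq_trans (dim_quotient_le lt_d _) survivors_count => w sw fw dw.
have cols : {subset w <= columns 5}.
  by move=> A Aw; apply: mem_columns; apply/eqP; apply: (allP fw).
case: (search_complete [::] certificates_valid sw cols dw) => [w_surv | [c c_ok [u [v /= wE]]]].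
  by left; exact: w_surv.
right; exists (size w); rewrite wE.
have /and3P[wu _ wv] : [&& wf 5 u, wf 5 c.1 & wf 5 v].
  by rewrite -!all_cat -wE; apply: full_wf.
by apply: reducible_window => //; apply: certifies_reducible.
Qed.
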